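(* Let $u_0\in W^{1,2}_{\rm loc}(\mathbb{R})$ and $u_1\in L^2_{\rm loc}(\mathbb{R})$. Assume that $u_0\ge 0$ and that $u_1\ge 0$ a.e. in $\{u_0=0\}$. Let $u\in L^\infty_{{\rm loc},t}((0,\infty);W^{1,2}_{{\rm loc},x}(\mathbb{R}))\cap W^{1,\infty}_{{\rm loc},t}((0,\infty);L^2_{{\rm loc},x}(\mathbb{R}))$ be the unique solution of the zero-obstacle problem for the wave equation with initial data $(u_0,u_1)$, that is, $$\min\{\square u,u\}=0 \ \text{ in } \mathbb{R}\times[0,\infty),\qquad u(\cdot,0)=u_0 \ \text{ in }\mathbb{R},\qquad u_t(\cdot,0)=u_1\ \text{ a.e. in }\mathbb{R},$$ satisfying moreover, in the sense of distributions, $$\frac{d}{dx}(-2u_xu_t)+\frac{d}{dt}(u_x^2+u_t^2)=0\quad\text{in }\mathbb{R}\times(0,\infty).$$ Then, in the characteristic variables $\xi=\frac{x+t}{\sqrt2}$, $\eta=\frac{-x+t}{\sqrt2}$, $$|u_\xi|_\eta\equiv|u_\eta|_\xi\equiv 0\qquad\text{a.e. in }\{\xi+\eta\ge 0\}.$$ In particular, $$|u_\xi(x,t)|=|u_\xi(x+t,0)|\qquad\text{and}\qquad |u_\eta(x,t)|=|u_\eta(x-t,0)|\qquad\text{for a.e. }(x,t)\in\mathbb{R}\times[0,\infty).$$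
   Context: $\square u:=u_{tt}-u_{xx}$. The equation $\min\{\square u,u\}=0$ means: $u\ge 0$, $\square u\ge 0$ in the sense of distributions (so $\square u$ is a nonnegative measure), and $\square u=0$ in the open set $\{u>0\}$. The condition $u\in L^\infty_{{\rm loc},t}((0,\infty);W^{1,2}_{{\rm loc},x}(\mathbb{R}))\cap W^{1,\infty}_{{\rm loc},t}((0,\infty);L^2_{{\rm loc},x}(\mathbb{R}))$ means that for every compact $K\subset\mathbb{R}$ and every $T>0$ there is a constant $C(T,K)<\infty$ with $\int_K\{|u(x,t)|^2+|u_x(x,t)|^2+|u_t(x,t)|^2\}\,dx\le C(T,K)$ for a.e. $t\in(0,T)$. Known existence and uniqueness theorem (Schatzman, 1980): for $u_0,u_1$ as in the claim there exists a unique solution $u$ in this class satisfying all the listed conditions. Characteristic derivatives: $u_\xi=\frac{1}{\sqrt2}(u_t+u_x)$ and $u_\eta=\frac{1}{\sqrt2}(u_t-u_x)$; at $t=0$ these are computed from the initial data: $u_\xi(x,0)=\frac{1}{\sqrt2}(u_1(x)+u_0'(x))$ and $u_\eta(x,0)=\frac{1}{\sqrt2}(u_1(x)-u_0'(x))$. The region $\{\xi+\eta\ge0\}$ is $\{t\ge 0\}$. The identity $|u_\xi|_\eta\equiv|u_\eta|_\xi\equiv0$ a.e. means that, with $u$ viewed as a function of $(\xi,\eta)$, $|u_\xi|$ does not depend on $\eta$ and $|u_\eta|$ does not depend on $\xi$ (up to null sets). *)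

(* Defs.v *)
From HB Require Import structures.
From mathcomp Require Import all_boot all_order all_algebra.
From mathcomp Require Import all_classical all_reals all_analysis.

Set Implicit Arguments.
Unset Strict Implicit.
Unset Printing Implicit Defensive.

Import Order.TTheory GRing.Theory Num.Theory.
Import numFieldNormedType.Exports.
Local Open Scope classical_set_scope.
Local Open Scope ring_scope.

(* Points of the space-time plane R * R are pairs z = (x, t). *)

Definition leb {R : realType} : {measure set (measurableTypeR R) -> \bar R} :=
  @lebesgue_measure R.

Definition leb2 {R : realType} :
    {measure set (measurableTypeR R * measurableTypeR R) -> \bar R} :=
  (@lebesgue_measure R \x @lebesgue_measure R)%E.

Section test_functions.
Variables (R : realType) (V : normedModType R).

(* C^oo: every iterated directional derivative is (Frechet) differentiable. *)
Definition smooth (phi : V -> R) : Prop :=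
  forall (vs : seq V) (z : V),
    differentiable (foldr (fun v (g : V -> R) => 'D_v g) phi vs) z.

Definition test_function (Omega : set V) (phi : V -> R) : Prop :=
  smooth phi /\
  exists K : set V,
    [/\ compact K, K `<=` Omega & forall z, ~ K z -> phi z = 0].

End test_functions.

Section one_dimensional.
Variable R : realType.
Implicit Types f g : R -> R.

Definition L2loc f : Prop :=
  measurable_fun [set: R] f /\
  forall K : set R, compact K -> leb.-integrable K (fun x => (f x ^+ 2)%:E).

(* [f] is in W^{1,2}_loc(R) and its weak derivative is (represented by) [g]. *)
Definition W12loc f g : Prop :=
  [/\ L2loc f, L2loc g &
      forall phi : R -> R, test_function [set: R] phi ->
        \int[leb]_x (f x * 'D_1 phi x) = - \int[leb]_x (g x * phi x)].

End one_dimensional.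

Section wave_obstacle.
Variable R : realType.
Implicit Types u ux ut phi : R * R -> R.

Definition dir_x : R * R := (1, 0).
Definition dir_t : R * R := (0, 1).

Definition upper : set (R * R) := [set z | 0 < z.2].
Definition cupper : set (R * R) := [set z | 0 <= z.2].

(* In the integrals below the integrand is always a locally integrable function
   times a test function, hence integrable: the default value of [Rintegral]
   on non-integrable functions plays no role. *)

Definition weak_partial (v : R * R) (f g : R * R -> R) : Prop :=
  forall phi, test_function upper phi ->
    \int[leb2]_(z in upper) (f z * 'D_v phi z) =
    - \int[leb2]_(z in upper) (g z * phi z).

(* [u] is in L^oo_loc,t((0,oo); W^{1,2}_loc,x) and in
   W^{1,oo}_loc,t((0,oo); L^2_loc,x), with weak derivatives [ux] and [ut].
   Every element of this class has a representative which is continuous on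
   {t >= 0}; [u] is that representative, so that {u > 0} and the values of [u]
   at t = 0 make sense pointwise.  The values of [u] at t < 0 and those of
   [ux], [ut] at t <= 0 are irrelevant. *)
Definition energy_class u ux ut : Prop :=
  [/\ {within cupper, continuous u},
      measurable_fun (upper : set (measurableTypeR R * measurableTypeR R)) ux,
      measurable_fun (upper : set (measurableTypeR R * measurableTypeR R)) ut,
      weak_partial dir_x u ux /\ weak_partial dir_t u ut &
      forall (K : set R) (T : R), compact K -> 0 < T ->
        exists C : R, {ae leb, forall t : R, 0 < t < T ->
          (\int[leb]_(x in K)
             (u (x, t) ^+ 2 + ux (x, t) ^+ 2 + ut (x, t) ^+ 2)%:E <= C%:E)%E}].

Definition dalembertian phi (z : R * R) : R :=
  'D_dir_t ('D_dir_t phi) z - 'D_dir_x ('D_dir_x phi) z.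

(* min {box u, u} = 0, with box u taken in the sense of distributions *)
Definition zero_obstacle u : Prop :=
  [/\ forall z, cupper z -> 0 <= u z,
      forall phi, test_function upper phi -> (forall z, 0 <= phi z) ->
        0 <= \int[leb2]_(z in upper) (u z * dalembertian phi z) &
      forall phi, test_function (upper `&` [set z | 0 < u z]) phi ->
        \int[leb2]_(z in upper) (u z * dalembertian phi z) = 0].

(* [ut] is only defined up to null sets, hence has no values on the line t = 0:
   the initial velocity is the one-sided time derivative of [u] at t = 0. *)
Definition initial_data (u0 u1 : R -> R) u : Prop :=
  (forall x, u (x, 0) = u0 x) /\
  {ae leb, forall x : R, t^-1 * (u (x, t) - u (x, 0)) @[t --> 0^'+] --> u1 x}.

(* d/dx (- 2 ux ut) + d/dt (ux^2 + ut^2) = 0 in the sense of distributions *)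
Definition energy_conservation ux ut : Prop :=
  forall phi, test_function upper phi ->
    \int[leb2]_(z in upper) ((- 2 * ux z * ut z) * 'D_dir_x phi z
                             + (ux z ^+ 2 + ut z ^+ 2) * 'D_dir_t phi z) = 0.

Definition d_xi ux ut (z : R * R) : R := (ut z + ux z) / Num.sqrt 2.
Definition d_eta ux ut (z : R * R) : R := (ut z - ux z) / Num.sqrt 2.

Definition d_xi0 (du0 u1 : R -> R) (x : R) : R := (u1 x + du0 x) / Num.sqrt 2.
Definition d_eta0 (du0 u1 : R -> R) (x : R) : R := (u1 x - du0 x) / Num.sqrt 2.

(* The point (x, t) with characteristic coordinates c = (xi, eta), i.e. with
   xi = (x + t) / sqrt 2 and eta = (- x + t) / sqrt 2. *)
Definition of_char (c : R * R) : R * R :=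
  ((c.1 - c.2) / Num.sqrt 2, (c.1 + c.2) / Num.sqrt 2).

(* For functions of (xi, eta): F_eta = 0 (resp. F_xi = 0) a.e. in
   {xi + eta >= 0}, in the sense that F does not depend on eta (resp. xi). *)
Definition indep_eta (F : R * R -> R) : Prop :=
  exists2 f : R -> R, measurable_fun [set: R] f &
    {ae leb2, forall c : R * R, 0 <= c.1 + c.2 -> F c = f c.1}.

Definition indep_xi (F : R * R -> R) : Prop :=
  exists2 f : R -> R, measurable_fun [set: R] f &
    {ae leb2, forall c : R * R, 0 <= c.1 + c.2 -> F c = f c.2}.

End wave_obstacle.

(* Main.v *)
(* In the characteristic variables write U for u, V = U_xi and P = U_eta.  Since
   box u >= 0, all rectangle increments of U are nonnegative, so V(xi, .) is
   nondecreasing.  Below a zero of U both V^2 and P^2 can only decrease, and the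
   conservation law forces them to be constant: the increment of U over a rectangle
   whose upper right corner is a zero of U vanishes.  Consequently, in a rectangle
   R with lower left corner (x0, y0), the increment of U over [x0, x] x [y0, y] is
   max(0, F(x) + K(y) - M), where F and K are the increments of the upper and right
   sides and M is that of R; V and P jump across the curve F + K = M only.
   Parametrising this curve by quantiles of F, at almost every point where V jumps
   the four one-sided velocities are derivatives along the sides of R, U vanishes on
   the curve, and the energy jumps of V and P balance along it.  These relations
   force the jump of V^2 to be zero.  So V(xi, .)^2 is constant for a.e. xi, the
   monotone function V(xi, .) has a limit of the same modulus at the initial line,
   and Lebesgue differentiation of U near that line identifies the limits of V and P
   with the initial values. *)

Require Import Defs.
From HB Require Import structures.
From mathcomp Require Import all_boot all_order all_algebra.
From mathcomp Require Import all_classical all_reals all_analysis.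
From mathcomp Require Import measurable_realfun ring lra.
Import Order.TTheory GRing.Theory Num.Theory.
Import numFieldNormedType.Exports.
Local Open Scope classical_set_scope.
Local Open Scope ring_scope.

Set Implicit Arguments.
Unset Strict Implicit.
Unset Printing Implicit Defensive.

(** * Integrals over compact intervals *)

Section almost_everywhere_facts.
Context d (T : measurableType d) (R : realType) (mu : {measure set T -> \bar R}).

(** A priori the measure box u has no structure: its support may be irregular, and V and P have no
    values at individual points. Hence the frames, whose four sides are good lines. All that happens
    inside is expressed by U and by V and P on the sides, functions of one variable to which
    Lebesgue differentiation applies. The two projections of the measure have the jumps of V and of
    P as densities; so null sets of either axis carry no mass, and almost every point of the curve,
    for the measure, is regular on both axes at once. At such a point three relations hold between
    increments h of xi and t of eta along the curve: both projections carry the same mass, U = 0 at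
    both ends, and the energies balance. With a jump n > 0 from V = v they leave only n + 2 v = 0,
    the elastic reflection of v to - v. Near the initial line the difficulty is another one: V(s, .)
    becomes constant below a height that depends on s, with no uniformity. This is why traces are
    obtained from integrals over short intervals, with an explicit defect term. *)

Lemma aeS (P Q : T -> Prop) : (forall x, P x -> Q x) ->
  {ae mu, forall x, P x} -> {ae mu, forall x, Q x}.
Proof. by move=> PQ; apply: (@filterS _ _ (ae_filter_ringOfSetsType mu)). Qed.

Lemma aeI (P Q : T -> Prop) : {ae mu, forall x, P x} ->
  {ae mu, forall x, Q x} -> {ae mu, forall x, P x /\ Q x}.
Proof.
move=> aP aQ.
by apply: (@filterS2 _ _ (ae_filter_ringOfSetsType mu) _ _ _ _ aP aQ) => x; split.
Qed.

Lemma ae_allC (C : countType) (P : C -> T -> Prop) :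
  (forall t, {ae mu, forall x, P t x}) -> {ae mu, forall x, forall t, P t x}.
Proof.
move=> H; pose Q n x := forall t, unpickle n = Some t -> P t x.
have : {ae mu, forall x, forall n, Q n x}.
  apply/ae_foralln => n; rewrite /Q; case E: (unpickle n) => [t|].
    by apply: aeS (H t) => x Px s [<-].
  by apply: aeW => x s.
by apply: aeS => x Qx t; apply: (Qx (pickle t)); rewrite pickleK.
Qed.

End almost_everywhere_facts.

Lemma ex_min2 (R : realDomainType) (a b : R) : 0 < a -> 0 < b ->
  exists d, [/\ 0 < d, d <= a & d <= b].
Proof.
by move=> a0 b0; exists (Num.min a b); rewrite lt_min a0 b0 !ge_min !lexx orbT.
Qed.

Lemma eq0_small (R : realFieldType) (C x : R) : 0 <= C ->
  (forall e, 0 < e -> `|x| <= C * e) -> x = 0.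
Proof.
move=> C0 H; apply/eqP; rewrite -normr_le0; apply/ler_addgt0Pr => e e0; rewrite add0r.
have C1 : 0 < C + 1 by rewrite ltr_wpDl.
apply: (le_trans (H (e / (C + 1)) _)); first by rewrite divr_gt0.
by rewrite mulrCA ler_piMr ?(ltW e0)// ler_pdivrMr// mul1r lerDl.
Qed.

Lemma norm_le_sqr (R : realFieldType) (t : R) : `|t| <= t ^+ 2 + 1.
Proof.
rewrite ler_norml; apply/andP; split.
  by have := sqr_ge0 (t + 1 / 2); lra.
by have := sqr_ge0 (t - 1 / 2); lra.
Qed.

Section interval_integrals.
Variable R : realType.
Local Notation mu := (@lebesgue_measure R).
Implicit Types (a b c d x y : R) (f g : R -> R).

Lemma ae_itv_ex (P : R -> Prop) a b : a < b ->
  {ae mu, forall x, P x} -> exists2 x, a < x < b & P x.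
Proof.
move=> ab [N [mN N0 NP]]; apply: contrapT => H.
have sub : [set` `]a, b[] `<=` N.
  move=> x /=; rewrite in_itv/= => xab; apply: NP => /= Px.
  by apply: H; exists x.
have : (mu [set` `]a, b[] <= mu N)%E by rewrite le_measure ?inE//.
rewrite [X in (_ <= X)%E -> _]N0 lebesgue_measure_itv/= lte_fin ab -EFinB lee_fin.
by rewrite subr_le0 leNgt ab.
Qed.

Definition itg a b f : R := \int[mu]_(x in `[a, b]) f x.
Definition L1 a b f := mu.-integrable `[a, b] (EFin \o f).

Lemma L1S a b c d f : a <= c -> d <= b -> L1 a b f -> L1 c d f.
Proof.
move=> ac db; apply: integrableS => //.
by apply: subset_itv; rewrite bnd_simp.
Qed.

Lemma L1_cst a b k : L1 a b (fun=> k).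
Proof.
apply: continuous_compact_integrable; first exact: segment_compact.
by apply: continuous_subspaceT => x; exact: cvg_cst.
Qed.

Lemma L1_continuous a b f : {within `[a, b], continuous f} -> L1 a b f.
Proof. by move=> cf; apply: continuous_compact_integrable => //; exact: segment_compact. Qed.

Lemma L1D a b f g : L1 a b f -> L1 a b g -> L1 a b (fun x => f x + g x).
Proof. by move=> Lf Lg; apply: (integrableD _ Lf Lg). Qed.

Lemma L1B a b f g : L1 a b f -> L1 a b g -> L1 a b (fun x => f x - g x).
Proof. by move=> Lf Lg; apply: (integrableB _ Lf Lg). Qed.

Lemma L1Z a b k f : L1 a b f -> L1 a b (fun x => k * f x).
Proof. by move=> Lf; apply: (integrableZl _ k Lf). Qed.

Lemma L1_norm a b f : L1 a b f -> L1 a b (fun x => `|f x|).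
Proof. exact: integrable_norm. Qed.

Lemma L1_measurable a b f : L1 a b f -> measurable_fun `[a, b] f.
Proof. by move=> /(measurable_int mu)/measurable_EFinP. Qed.

Lemma L1_le a b f g : measurable_fun `[a, b] f -> L1 a b g ->
  (forall x, a <= x <= b -> `|f x| <= g x) -> L1 a b f.
Proof.
move=> mf Lg fg; apply: le_integrable Lg => //; first exact/measurable_EFinP.
move=> x /=; rewrite in_itv/= => /fg fgx; rewrite lee_fin.
by apply: (le_trans fgx); exact: ler_norm.
Qed.

Lemma L1M a b f g C : L1 a b f -> measurable_fun `[a, b] g ->
  (forall x, a <= x <= b -> `|g x| <= C) -> L1 a b (fun x => f x * g x).
Proof.
move=> Lf mg gC; apply: (@L1_le _ _ _ (fun x => C * `|f x|)).
- by apply: measurable_funM => //; exact: L1_measurable.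
- by apply: L1Z; exact: L1_norm.
- by move=> x xab; rewrite normrM mulrC ler_wpM2r// gC.
Qed.

Lemma eq_itg a b f g : (forall x, a <= x <= b -> f x = g x) -> itg a b f = itg a b g.
Proof.
by move=> fg; apply: eq_Rintegral => x; rewrite inE/= in_itv/=; exact: fg.
Qed.

Lemma eq_L1 a b f g : (forall x, a <= x <= b -> f x = g x) -> L1 a b f -> L1 a b g.
Proof.
move=> fg; apply: eq_integrable => // x; rewrite inE/= in_itv/= => xab.
by rewrite /= fg.
Qed.

Lemma itgD a b f g : L1 a b f -> L1 a b g ->
  itg a b (fun x => f x + g x) = itg a b f + itg a b g.
Proof. by move=> Lf Lg; apply: RintegralD. Qed.

Lemma itgB a b f g : L1 a b f -> L1 a b g ->
  itg a b (fun x => f x - g x) = itg a b f - itg a b g.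
Proof. by move=> Lf Lg; apply: RintegralB. Qed.

Lemma itgZ a b k f : L1 a b f -> itg a b (fun x => k * f x) = k * itg a b f.
Proof. by move=> Lf; apply: RintegralZl. Qed.

Lemma itg0 a b : itg a b (fun=> 0) = 0.
Proof. by rewrite /itg Rintegral_cst// mul0r. Qed.

Lemma itgxx a f : itg a a f = 0.
Proof. by rewrite /itg set_itv1 Rintegral_set1. Qed.

Lemma itg_ge0 a b f : (forall x, a <= x <= b -> 0 <= f x) -> 0 <= itg a b f.
Proof. by move=> f0; apply: Rintegral_ge0 => x /=; rewrite in_itv/=; exact: f0. Qed.

Lemma le_itg a b f g : L1 a b f -> L1 a b g ->
  (forall x, a <= x <= b -> f x <= g x) -> itg a b f <= itg a b g.
Proof.
by move=> Lf Lg fg; apply: le_Rintegral => // x /=; rewrite in_itv/=; exact: fg.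
Qed.

Lemma itg_norm a b f : L1 a b f -> `|itg a b f| <= itg a b (fun x => `|f x|).
Proof. by move=> Lf; apply: le_normr_Rintegral. Qed.

Lemma itg_cat a b c f : a <= b -> b <= c -> L1 a c f ->
  itg a c f = itg a b f + itg b c f.
Proof.
move=> ab bc Lf; rewrite /itg -(@Rintegral_itv_obnd_cbnd _ b).
  rewrite -(@Rintegral_itvB _ f (BLeft a) (BRight c) b Lf) ?bnd_simp//.
  by rewrite addrC subrK.
by apply: integrableS Lf => //; apply: subset_itvr; rewrite bnd_simp.
Qed.

Lemma itg_ae a b f g : L1 a b f -> L1 a b g ->
  {ae mu, forall x, a <= x <= b -> f x = g x} -> itg a b f = itg a b g.
Proof.
move=> Lf Lg fg; congr fine; apply: ae_eq_integral => //.
- exact: (measurable_int mu Lf).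
- exact: (measurable_int mu Lg).
by apply: aeS fg => x fgx /=; rewrite in_itv/= => /fgx ->.
Qed.

(** The pointwise comparison applies to [f] and the maximum of [f] and [g], which is almost
    everywhere equal to [g]. *)
Lemma le_itg_ae a b f g : L1 a b f -> L1 a b g ->
  {ae mu, forall x, a <= x <= b -> f x <= g x} -> itg a b f <= itg a b g.
Proof.
move=> Lf Lg fg; pose h x := Num.max (f x) (g x).
have mh : measurable_fun `[a, b] h.
  by apply: measurable_maxr; exact: L1_measurable.
have Lh : L1 a b h.
  apply: (L1_le mh (L1D (L1_norm Lf) (L1_norm Lg))) => x _ /=.
  rewrite /h; case: (leP (f x) (g x)) => _.
    by rewrite lerDr.
  by rewrite lerDl.
rewrite (@itg_ae _ _ g h)//; last first.
  by apply: aeS fg => x H /H; rewrite /h; case: leP.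
by apply: le_itg => // x _; rewrite le_max lexx.
Qed.

Lemma itg_eq0_ae a b f : L1 a b f -> (forall x, a <= x <= b -> 0 <= f x) ->
  itg a b f = 0 -> {ae mu, forall x, a <= x <= b -> f x = 0}.
Proof.
move=> Lf f0 If0.
have mf := measurable_int mu Lf.
have [+ _] := (ae_eq_integral_abs mu (measurable_itv `[a, b]) mf).
have -> : (\int[mu]_(x in `[a, b]) `|(EFin \o f) x|)%E = 0.
  rewrite -[RHS]/(0%:E) -If0 /itg /Rintegral fineK; last first.
    by apply: integrable_fin_num.
  apply: eq_integral => x; rewrite inE/= in_itv/= => xab.
  by rewrite ger0_norm// f0.
move=> /(_ erefl); apply: aeS => x H xab.
by have /= := H; rewrite in_itv/= => /(_ xab) [].
Qed.

Lemma itg_eq_ae a b f g : L1 a b f -> L1 a b g ->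
  {ae mu, forall x, a <= x <= b -> g x <= f x} -> itg a b f = itg a b g ->
  {ae mu, forall x, a <= x <= b -> f x = g x}.
Proof.
move=> Lf Lg gf fgE; pose h x := Num.max (f x - g x) 0.
have Lfg := L1B Lf Lg.
have mh : measurable_fun `[a, b] h.
  by apply: measurable_maxr; [exact: L1_measurable Lfg|exact: measurable_cst].
have Lh : L1 a b h.
  apply: (L1_le mh (L1_norm Lfg)) => x _; rewrite /h.
  by case: (leP (f x - g x) 0) => _ //; rewrite normr0 normr_ge0.
have hE : {ae mu, forall x, a <= x <= b -> f x - g x = h x}.
  by apply: aeS gf => x H /H fx; rewrite /h max_l// subr_ge0.
have Ih : itg a b h = 0 by rewrite -(itg_ae Lfg Lh hE) itgB// fgE subrr.
have h0 : {ae mu, forall x, a <= x <= b -> h x = 0}.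
  by apply: itg_eq0_ae Lh _ Ih => x _; rewrite /h le_max lexx orbT.
apply: aeS (aeI h0 hE) => x [hx fx] xab.
by apply/eqP; rewrite -subr_eq0 fx// hx.
Qed.

Lemma itg_supp a b c d f : a <= c -> c <= d -> d <= b -> L1 a b f ->
  (forall x, x <= c \/ d <= x -> f x = 0) -> itg a b f = itg c d f.
Proof.
move=> ac cd db Lf f0.
rewrite (@itg_cat a c b)// ?(le_trans cd)//.
rewrite (@itg_cat c d b)//; last by apply: L1S Lf.
rewrite (@eq_itg a c f (fun=> 0)); last by move=> x /andP[_ xc]; apply: f0; left.
rewrite (@eq_itg d b f (fun=> 0)); last by move=> x /andP[xd _]; apply: f0; right.
by rewrite !itg0 add0r addr0.
Qed.

(** Absolute continuity of the integral, uniform in the position of the short interval. *)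
Lemma itg_small a b f : L1 a b f -> forall e, 0 < e -> exists2 h, 0 < h &
  forall c d, a <= c -> c <= d -> d <= b -> d - c <= h -> itg c d (fun x => `|f x|) <= e.
Proof.
move=> Lf e e0.
have Lf' : mu.-integrable setT (EFin \o f \_ `[a, b]).
  by rewrite -restrict_EFin; apply/integrable_restrict => //=; rewrite setTI.
have [h [h0 /= H]] := integral_normr_continuous Lf' e0.
exists (h / 2); first by rewrite divr_gt0.
move=> c d ac cd db dc.
have /H : (mu `[c, d] < h%:E)%E.
  rewrite lebesgue_measure_itv/= lte_fin; case: ifP => _; last by rewrite lte_fin.
  by rewrite -EFinB lte_fin; apply: (le_lt_trans dc); rewrite ltr_pdivrMr// ltr_pMr// ltr1n.
move=> /(_ (measurable_itv _)) /ltW; apply: le_trans; rewrite le_eqVlt; apply/orP; left; apply/eqP.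
apply: eq_Rintegral => x; rewrite inE/= in_itv/= => /andP[cx xd].
by rewrite patchE mem_set//= in_itv/= (le_trans ac cx) (le_trans xd db).
Qed.

Lemma L2loc_L1 a b f : L2loc f -> L1 a b f.
Proof.
move=> [mf Lf]; apply: (@L1_le _ _ _ (fun x => f x ^+ 2 + 1)) => [||x _].
- exact: measurable_funTS.
- by apply: L1D; [apply: Lf; exact: segment_compact|exact: L1_cst].
- exact: norm_le_sqr.
Qed.

End interval_integrals.

(** * Smooth steps and plateaus *)

Section smooth_step.
Variable R : realType.
Implicit Types (p q : {poly R}) (x y : R).

(** Serves at the junction x = 0 of [flat], where no differentiation rule applies. *)
Lemma is_derive_quadratic (f : R -> R) x l C :
  (forall h, `|f (h + x) - f x - l * h| <= C * h ^+ 2) -> is_derive x 1 f l.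
Proof.
move=> H; suff fl : h^-1 *: (f (h *: 1 + x) - f x) @[h --> 0^'] --> l.
  by apply: DeriveDef; [apply/cvg_ex; exists l | exact/cvg_lim].
have C0 : 0 <= C.
  by have := H 1; rewrite expr1n !mulr1; exact: le_trans (normr_ge0 _).
apply/cvgrPdist_le => e e0.
have e1 : 0 < e / (C + 1) by rewrite divr_gt0// ltr_wpDl.
near=> h.
have h0 : h != 0 by near: h; exact: nbhs_dnbhs_neq.
have hC : `|h| <= e / (C + 1) by near: h; exact: dnbhs0_le.
rewrite [h *: 1]mulr1 distrC.
have -> : h^-1 *: (f (h + x) - f x) - l = h^-1 * (f (h + x) - f x - l * h).
  by rewrite /GRing.scale/=; field.
rewrite normrM normfV ler_pdivrMl ?normr_gt0//; apply: (le_trans (H h)).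
rewrite -real_normK ?num_real// expr2 mulrA [leRHS]mulrC ler_wpM2r//.
apply: (le_trans (ler_wpM2l C0 hC)).
rewrite mulrA ler_pdivrMr ?ltr_wpDl// mulrC ler_wpM2l ?(ltW e0)//.
by rewrite lerDl.
Unshelve. all: by end_near. Qed.

(* The functions p(1/x) e^(-1/x), extended by 0 to x <= 0, form a class which is
   closed under differentiation; this makes them smooth at 0. *)
Definition flat p x : R := if 0 < x then p.[x^-1] * expR (- x^-1) else 0.

(** For x > 0 the derivative of p(1/x) e^(-1/x) is x^(-2) (p(1/x) - p'(1/x)) e^(-1/x), which has the
    same shape. *)
Definition flat_next p : {poly R} := 'X ^+ 2 * (p - p^`()).

Lemma expR_Xn_bounded n y : 0 <= y -> y ^+ n * expR (- y) <= n`!%:R.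
Proof.
case: n => [|n] y0.
  by rewrite expr0 mul1r fact0 -expR0 ler_expR oppr_le0.
rewrite expRN ler_pdivrMr ?expR_gt0//.
have := expR_ge1Dxn n y0; rewrite -(@ler_pM2l _ n.+1`!%:R) ?ltr0n ?fact_gt0//.
by apply: le_trans; rewrite mulrDr mulrCA divff ?mulr1 ?lerDr ?mulr_ge0//.
Qed.

Lemma poly_expR_bounded p : exists2 C, 0 <= C &
  forall y, 0 <= y -> `|p.[y]| * expR (- y) <= C.
Proof.
exists (\sum_(i < size p) `|p`_i| * i`!%:R).
  by apply: sumr_ge0 => i _; rewrite mulr_ge0.
move=> y y0; rewrite horner_coef.
apply: (@le_trans _ _ ((\sum_(i < size p) `|p`_i| * y ^+ i) * expR (- y))).
  rewrite ler_wpM2r ?expR_ge0//; apply: (le_trans (ler_norm_sum _ _ _)).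
  by apply: ler_sum => i _; rewrite normrM [`|y ^+ i|]ger0_norm ?exprn_ge0.
rewrite mulr_suml; apply: ler_sum => i _; rewrite -mulrA.
by rewrite ler_wpM2l// expR_Xn_bounded.
Qed.

Lemma flat_le0 p x : x <= 0 -> flat p x = 0.
Proof. by rewrite /flat ltNge => ->. Qed.

Lemma is_derive_flat p x : is_derive x 1 (flat p) (flat (flat_next p) x).
Proof.
have [x0|x0|->] := ltgtP x 0.
- rewrite (flat_le0 (flat_next p) (ltW x0)).
  apply: (@near_eq_is_derive _ _ _ (cst 0)).
  near=> y; rewrite flat_le0//; near: y.
  by apply: lt_le_nbhsl.
- rewrite /flat x0.
  have dV : is_derive x 1 (fun y : R => y^-1) (- x ^- 2).
    have := @is_deriveV R id x 1 1 (lt0r_neq0 x0) (is_derive_id _ _).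
    by rewrite /GRing.scale/= mulr1.
  apply: (@near_eq_is_derive _ _ _ ((horner p \o (fun y => y^-1)) * (expR \o (fun y => - y^-1)))).
    by near=> y; rewrite ifT//; near: y; exact: lt_nbhsr.
  have d1 := is_derive1_comp (is_derive_poly p x^-1) dV.
  have d2 := @is_derive1_comp R expR (fun y => - y^-1) x _ _ (is_derive_expR _)
    (is_deriveN dV).
  apply: is_derive_eq (is_deriveM d1 d2) _.
  rewrite /flat_next !hornerE /= /GRing.scale /=.
  have xn0 := lt0r_neq0 x0; field; exact: xn0.
- rewrite flat_le0//.
  (* With y = 1/h, boundedness of y^2 p(y) e^(-y) says that [flat p h] is at most C h^2 in modulus:
     the derivative at 0 is 0. *)
  have [C C0 H] := poly_expR_bounded ('X ^+ 2 * p).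
  apply: (@is_derive_quadratic _ _ _ C) => h; rewrite addr0 mul0r subr0.
  rewrite (@flat_le0 _ 0)// subr0 /flat; case: ifPn => h0; last first.
    by rewrite normr0 mulr_ge0 ?sqr_ge0.
  have hV : 0 <= h^-1 by rewrite invr_ge0 ltW.
  have := H _ hV; rewrite !hornerE normrM [`|_ ^+ 2|]ger0_norm ?exprn_ge0//.
  rewrite normrM (gtr0_norm (expR_gt0 _)).
  by rewrite -mulrA exprVn ler_pdivrMl ?exprn_gt0// => /le_trans; apply; rewrite mulrC expr2 mulrA.
Unshelve. all: by end_near. Qed.

Lemma flat_ge0 x : 0 <= flat 1 x.
Proof. by rewrite /flat; case: ifP => // _; rewrite hornerE mul1r expR_ge0. Qed.

Lemma flat_gt0 x : 0 < x -> 0 < flat 1 x.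
Proof. by rewrite /flat => ->; rewrite hornerE mul1r expR_gt0. Qed.

Lemma flat_le1 x : flat 1 x <= 1.
Proof.
rewrite /flat; case: ifP => // x0; rewrite hornerE mul1r -expR0 ler_expR.
by rewrite oppr_le0 invr_ge0 ltW.
Qed.

Definition bump x := flat 1 x * flat 1 (1 - x).

Lemma is_derive_flat_onem p x :
  is_derive x 1 (fun y => flat p (1 - y)) (- flat (flat_next p) (1 - x)).
Proof.
have d : is_derive x 1 (fun y : R => 1 - y) (- 1).
  by have := is_deriveB (is_derive_cst (1:R) x 1) (is_derive_id x 1); rewrite sub0r.
by have := @is_derive1_comp R (flat p) _ x _ _ (is_derive_flat p _) d; rewrite mulrN1.
Qed.

Lemma continuous_bump : continuous bump.
Proof.
move=> x; apply/differentiable_continuous/derivable1_diffP.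
have := is_deriveM (is_derive_flat 1 x) (is_derive_flat_onem 1 x).
by move=> /@ex_derive.
Qed.

Lemma bump_ge0 x : 0 <= bump x.
Proof. by rewrite mulr_ge0 ?flat_ge0. Qed.

Lemma bump_gt0 x : 0 < x < 1 -> 0 < bump x.
Proof. by move=> /andP[x0 x1]; rewrite mulr_gt0 ?flat_gt0 ?subr_gt0. Qed.

Lemma bump_eq0 x : x <= 0 \/ 1 <= x -> bump x = 0.
Proof.
by case=> hx; rewrite /bump; [rewrite flat_le0 ?mul0r|
  rewrite (@flat_le0 _ (1 - x)) ?mulr0// subr_le0].
Qed.

Local Notation mu := (@lebesgue_measure R).

Lemma L1_bump a b : L1 a b bump.
Proof. by apply: L1_continuous; apply: continuous_subspaceT; exact: continuous_bump. Qed.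

Definition bump_mass : R := itg 0 1 bump.

Lemma bump_mass_gt0 : 0 < bump_mass.
Proof.
rewrite lt_def itg_ge0 ?andbT; last by move=> *; exact: bump_ge0.
apply/eqP => I0; have := itg_eq0_ae (@L1_bump 0 1) (fun x _ => bump_ge0 x) I0.
move=> /(ae_itv_ex ltr01)[x x01]; have [/ltW x0 /ltW x1] := andP x01.
rewrite x0 x1 => /(_ isT) bx0.
by have := bump_gt0 x01; rewrite bx0 ltxx.
Qed.

(** The integral starts at -1, where [bump] already vanishes, so that the fundamental theorem of
    calculus also covers x = 0 as an interior point. *)
Definition step x : R := bump_mass^-1 * itg (-1) x bump.
Definition step' x : R := bump_mass^-1 * bump x.

Lemma step_le0 x : x <= 0 -> step x = 0.
Proof.
move=> x0; rewrite /step (@eq_itg _ _ _ _ (fun=> 0)) ?itg0 ?mulr0//.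
by move=> y /andP[_ yx]; rewrite bump_eq0//; left; exact: le_trans x0.
Qed.

Lemma step_ge1 x : 1 <= x -> step x = 1.
Proof.
move=> x1; rewrite /step (@itg_supp _ _ _ 0 1)//.
- by rewrite mulVf// gt_eqF// bump_mass_gt0.
- exact: L1_bump.
- exact: bump_eq0.
Qed.

Lemma is_derive_step x : is_derive x 1 step (step' x).
Proof.
have [x0|x0] := ltP x 0.
  have -> : step' x = 0 by rewrite /step' bump_eq0 ?mulr0//; left; exact: ltW.
  apply: (@near_eq_is_derive _ _ _ (cst 0)).
  near=> y; rewrite step_le0//; near: y.
  by apply: lt_le_nbhsl.
have x1 : -1 < x by apply: lt_le_trans x0; rewrite ltrN10.
have xx1 : x < x + 1 by rewrite ltrDl.
have [d1 d2] := @continuous_FTC1_closed R bump (-1) x (x + 1) xx1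
  (@L1_bump _ _) x1 (@continuous_bump x).
have dF : is_derive x 1 (fun y : R => itg (-1) y bump) (bump x).
  apply: DeriveDef; first exact: d1.
  by rewrite -derive1E; exact: d2.
exact: is_deriveZ dF.
Unshelve. all: by end_near. Qed.

Lemma step'_ge0 x : 0 <= step' x.
Proof. by rewrite mulr_ge0 ?bump_ge0// invr_ge0 ltW// bump_mass_gt0. Qed.

Lemma step'_gt0 x : 0 < x < 1 -> 0 < step' x.
Proof. by move=> x01; rewrite mulr_gt0 ?bump_gt0// invr_gt0 bump_mass_gt0. Qed.

Lemma step'_eq0 x : x <= 0 \/ 1 <= x -> step' x = 0.
Proof. by move=> x01; rewrite /step' bump_eq0// mulr0. Qed.

Lemma continuous_step' : continuous step'.
Proof. by move=> x; apply: cvgM; [exact: cvg_cst|exact: continuous_bump]. Qed.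

Lemma le_step : {homo step : x y / x <= y}.
Proof.
move=> x y xy; have [x0|x0] := leP x (-1).
  rewrite (@step_le0 x) ?(le_trans x0) ?lerN10//.
  apply: mulr_ge0; first by rewrite invr_ge0 ltW ?bump_mass_gt0.
  by apply: itg_ge0 => *; exact: bump_ge0.
rewrite ler_wpM2l ?invr_ge0 ?(ltW bump_mass_gt0)//.
rewrite (@itg_cat _ (-1) x y) ?(ltW x0)//; last exact: L1_bump.
by rewrite lerDl; apply: itg_ge0 => *; exact: bump_ge0.
Qed.

Lemma step_itv x : 0 <= step x <= 1.
Proof.
have [x0|x0] := leP x 0; first by rewrite step_le0// lexx ler01.
have [x1|x1] := leP 1 x; first by rewrite step_ge1// lexx ler01.
rewrite -[X in X <= _ <= _](@step_le0 0)// -[X in _ <= _ <= X](@step_ge1 1)//.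
by rewrite !le_step// ltW.
Qed.

End smooth_step.

(** * Smooth cutoff functions *)

Section ramps.
Variable R : realType.
Implicit Types (a b e x : R).

(* A smooth transition from 0 to 1 over [a, a + e], so that [ramp'] is a
   probability density on that interval. *)
Definition ramp e a x : R := step (e^-1 * (x - a)).
Definition ramp' e a x : R := e^-1 * step' (e^-1 * (x - a)).

Lemma is_derive_affine_comp (f : R -> R) k a x l : is_derive (k * (x - a)) 1 f l ->
  is_derive x 1 (fun y => f (k * (y - a))) (k * l).
Proof.
move=> fl; have d : is_derive x 1 (fun y => k * (y - a)) k.
  have := is_deriveZ k (is_deriveB (is_derive_id x 1) (is_derive_cst a x 1)).
  by rewrite subr0 [_ *: _]mulr1.
by have := @is_derive1_comp R f _ x _ _ fl d; rewrite mulrC.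
Qed.

Lemma is_derive_ramp e a x : is_derive x 1 (ramp e a) (ramp' e a x).
Proof. by apply: is_derive_affine_comp; exact: is_derive_step. Qed.

Lemma ramp_le e a x : 0 < e -> x <= a -> ramp e a x = 0.
Proof. by move=> e0 xa; rewrite /ramp step_le0// pmulr_rle0 ?invr_gt0// subr_le0. Qed.

Lemma ramp_ge e a x : 0 < e -> a + e <= x -> ramp e a x = 1.
Proof.
by move=> e0 xa; rewrite /ramp step_ge1// mulrC ler_pdivlMr// mul1r lerBrDl.
Qed.

Lemma ramp_itv e a x : 0 <= ramp e a x <= 1.
Proof. exact: step_itv. Qed.

Lemma ramp'_ge0 e a x : 0 < e -> 0 <= ramp' e a x.
Proof. by move=> e0; rewrite mulr_ge0 ?step'_ge0// invr_ge0 ltW. Qed.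

Lemma ramp'_gt0 e a x : 0 < e -> a < x < a + e -> 0 < ramp' e a x.
Proof.
move=> e0 /andP[ax xa]; rewrite mulr_gt0 ?invr_gt0// step'_gt0//.
by rewrite mulr_gt0 ?invr_gt0 ?subr_gt0//= mulrC ltr_pdivrMr// mul1r ltrBlDl.
Qed.

Lemma ramp'_eq0 e a x : 0 < e -> x <= a \/ a + e <= x -> ramp' e a x = 0.
Proof.
move=> e0 H; rewrite /ramp' step'_eq0 ?mulr0//; case: H => H; [left|right].
  by rewrite pmulr_rle0 ?invr_gt0// subr_le0.
by rewrite mulrC ler_pdivlMr// mul1r lerBrDl.
Qed.

Lemma continuous_ramp e a : continuous (ramp e a).
Proof.
move=> x; apply/differentiable_continuous/derivable1_diffP.
by have /@ex_derive := is_derive_ramp e a x.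
Qed.

Lemma continuous_ramp' e a : continuous (ramp' e a).
Proof.
move=> x; apply: cvgM; first exact: cvg_cst.
apply: (@continuous_comp _ _ _ (fun y => e^-1 * (y - a)) (@step' R)).
  by apply: cvgM; [exact: cvg_cst|apply: cvgB; [exact: cvg_id|exact: cvg_cst]].
exact: continuous_step'.
Qed.

Lemma itg_ramp' e a c d : 0 < e -> c <= a -> a + e <= d -> itg c d (ramp' e a) = 1.
Proof.
move=> e0 ca ad.
have cd : c < d by apply: (le_lt_trans ca); apply: lt_le_trans ad; rewrite ltrDl.
have H := @continuous_FTC2 R (ramp' e a) (ramp e a) c d cd.
rewrite /itg /Rintegral H.
- by rewrite /= (ramp_le e0 ca) (ramp_ge e0 ad) subr0.
- by apply: continuous_subspaceT; exact: continuous_ramp'.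
- split => [x _||]; first by have /@ex_derive := is_derive_ramp e a x.
  + by apply: cvg_at_right_filter; exact: continuous_ramp.
  + by apply: cvg_at_left_filter; exact: continuous_ramp.
- by move=> x _; rewrite derive1E; have /@derive_val := is_derive_ramp e a x.
Qed.

Lemma ramp'_bounded e a : 0 < e -> exists C, forall x, `|ramp' e a x| <= C.
Proof.
move=> e0; exists (e^-1 * (bump_mass R)^-1) => x.
rewrite ger0_norm ?ramp'_ge0// /ramp' ler_wpM2l ?invr_ge0 ?(ltW e0)//.
rewrite /step' ler_piMr ?invr_ge0 ?(ltW (bump_mass_gt0 R))//.
by rewrite /bump mulr_ile1 ?flat_ge0 ?flat_le1.
Qed.

Lemma L1_ramp' e a c d : L1 c d (ramp' e a).
Proof. by apply: L1_continuous; apply: continuous_subspaceT; exact: continuous_ramp'. Qed.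

Lemma L1_Mramp' e a c d E : 0 < e -> L1 c d E -> L1 c d (fun r => E r * ramp' e a r).
Proof.
move=> e0 LE; have [C HC] := ramp'_bounded a e0.
by apply: (L1M LE (L1_measurable (L1_ramp' e a c d))) => x _; exact: HC.
Qed.

Section ramp_mean.
Variables (e a c d : R) (E : R -> R).
Hypotheses (e0 : 0 < e) (ca : c <= a) (ad : a + e <= d) (LE : L1 c d E).

Lemma itg_ramp'_cst k : itg c d (fun r => k * ramp' e a r) = k.
Proof. by rewrite itgZ ?itg_ramp' ?mulr1//; exact: L1_ramp'. Qed.

Lemma ramp'_supp x : ~ (a < x < a + e) -> ramp' e a x = 0.
Proof.
move=> /negP; rewrite negb_and -!leNgt => /orP H.
exact: ramp'_eq0.
Qed.

Lemma ramp_mean_ge k : {ae lebesgue_measure, forall r, a < r < a + e -> k <= E r} ->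
  k <= itg c d (fun r => E r * ramp' e a r).
Proof.
move=> H; rewrite -[leLHS]itg_ramp'_cst.
apply: le_itg_ae; [by apply: L1Z; exact: L1_ramp'|exact: L1_Mramp'|].
apply: aeS H => r H _; have [ar|ar] := pselect (a < r < a + e).
  by rewrite ler_wpM2r ?ramp'_ge0// H.
by rewrite ramp'_supp// !mulr0.
Qed.

Lemma ramp_mean_le k : {ae lebesgue_measure, forall r, a < r < a + e -> E r <= k} ->
  itg c d (fun r => E r * ramp' e a r) <= k.
Proof.
move=> H; rewrite -[leRHS]itg_ramp'_cst.
apply: le_itg_ae; [exact: L1_Mramp'|by apply: L1Z; exact: L1_ramp'|].
apply: aeS H => r H _; have [ar|ar] := pselect (a < r < a + e).
  by rewrite ler_wpM2r ?ramp'_ge0// H.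
by rewrite ramp'_supp// !mulr0.
Qed.

(** As [ramp'] is positive inside its support, a mean equal to the lower bound leaves no room for
    larger values. *)
Lemma ramp_mean_eq k : {ae lebesgue_measure, forall r, a < r < a + e -> k <= E r} ->
  itg c d (fun r => E r * ramp' e a r) = k ->
  {ae lebesgue_measure, forall r, a < r < a + e -> E r = k}.
Proof.
move=> H Ek; have LEr := L1_Mramp' a e0 LE.
have Lkr : L1 c d (fun r => k * ramp' e a r) by apply: L1Z; exact: L1_ramp'.
have := itg_eq_ae LEr Lkr _ _; rewrite itg_ramp'_cst => /(_ _ Ek)/wrap[].
  apply: aeS H => r H _; have [ar|ar] := pselect (a < r < a + e).
    by rewrite ler_wpM2r ?ramp'_ge0// H.
  by rewrite ramp'_supp// !mulr0.
apply: aeS => r Er ar; have /andP[ar1 ar2] := ar.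
have cd : c <= r <= d by rewrite (le_trans ca (ltW ar1)) (le_trans (ltW ar2) ad).
have := Er cd; have r0 := ramp'_gt0 e0 ar => /eqP.
by rewrite -subr_eq0 -mulrBl mulf_eq0 (gt_eqF r0) orbF subr_eq0 => /eqP.
Qed.

End ramp_mean.

(** Both transitions lie to the right of their base points, over [a, a + e] and [b, b + e]; the
    support is therefore contained in [a, b + e], and limits at a and b are taken from the right. *)
Definition plateau e a b x := ramp e a x - ramp e b x.
Definition plateau' e a b x := ramp' e a x - ramp' e b x.

Lemma plateau_itv e a b x : 0 < e -> a <= b -> 0 <= plateau e a b x <= 1.
Proof.
move=> e0 ab; rewrite /plateau subr_ge0; apply/andP; split.
  by apply: le_step; rewrite ler_wpM2l ?invr_ge0 ?(ltW e0)// lerB.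
have /andP[_ h1] := ramp_itv e a x; have /andP[h2 _] := ramp_itv e b x.
by rewrite lerBlDr (le_trans h1)// lerDl.
Qed.

Lemma plateau_eq1 e a b x : 0 < e -> a + e <= x <= b -> plateau e a b x = 1.
Proof. by move=> e0 /andP[ax xb]; rewrite /plateau ramp_ge// ramp_le// subr0. Qed.

Lemma plateau_eq0 e a b x : 0 < e -> a <= b -> x <= a \/ b + e <= x -> plateau e a b x = 0.
Proof.
move=> e0 ab [xa|bx]; rewrite /plateau.
  by rewrite !ramp_le ?subrr// (le_trans xa).
by rewrite !ramp_ge ?subrr//; apply: le_trans bx; rewrite lerD2r.
Qed.

Lemma continuous_plateau e a b : continuous (plateau e a b).
Proof. by move=> x; apply: cvgB; exact: continuous_ramp. Qed.

Lemma measurable_plateau e a b (D : set R) : measurable D -> measurable_fun D (plateau e a b).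
Proof.
move=> mD; apply: measurable_funTS; apply: continuous_measurable_fun.
exact: continuous_plateau.
Qed.

Lemma L1_Mplateau e a b c d E : 0 < e -> a <= b -> L1 c d E -> L1 c d (fun r => E r * plateau e a b r).
Proof.
move=> e0 ab LE; apply: (@L1M _ _ _ _ _ 1 LE); first exact: measurable_plateau.
by move=> x _; have /andP[h1 h2] := plateau_itv x e0 ab; rewrite ger0_norm.
Qed.

(** The plateau differs from the indicator of [a, b] only in the two transition zones, and there by
    at most 1. *)
Lemma plateau_itg_close e a b g : 0 < e -> a + e <= b -> L1 a (b + e) g ->
  `|itg a (b + e) (fun x => g x * plateau e a b x) - itg a b g| <=
  itg a (a + e) (fun x => `|g x|) + itg b (b + e) (fun x => `|g x|).
Proof.
move=> e0 aeb Lg; have aae : a <= a + e by rewrite lerDl ltW.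
have bbe : b <= b + e by rewrite lerDl ltW.
have ab : a <= b by exact: le_trans aeb.
have Lp : L1 a (b + e) (fun x => g x * plateau e a b x) by exact: L1_Mplateau.
rewrite (itg_cat ab bbe Lp).
have Lab : L1 a b g by apply: L1S Lg.
have Lpab : L1 a b (fun x => g x * plateau e a b x) by apply: L1S Lp.
have Laae : L1 a (a + e) g by apply: L1S Lab.
have Lpaae : L1 a (a + e) (fun x => g x * plateau e a b x) by apply: L1S Lpab.
have Lbbe : L1 b (b + e) g by apply: L1S Lg.
have Lpbbe : L1 b (b + e) (fun x => g x * plateau e a b x) by apply: L1S Lp.
rewrite addrAC; apply: (le_trans (ler_normD _ _)); apply: lerD.
  rewrite (itg_cat aae aeb Lab) (itg_cat aae aeb Lpab).
  rewrite (@eq_itg _ (a + e) b (fun x => g x * plateau e a b x) g); last first.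
    by move=> x /plateau_eq1 ->; rewrite ?mulr1.
  rewrite opprD addrACA subrr addr0 -itgB//.
  apply: (le_trans (itg_norm (L1B Lpaae Laae))).
  apply: le_itg; [exact/L1_norm/L1B|exact: L1_norm|move=> x _].
  have /andP[p0 p1] := plateau_itv x e0 ab.
  rewrite -{2}(mulr1 (g x)) -mulrBr normrM ler_piMr//.
  by rewrite ler_norml; lra.
apply: (le_trans (itg_norm Lpbbe)); apply: le_itg; [exact: L1_norm|exact: L1_norm|move=> x _].
have /andP[p0 p1] := plateau_itv x e0 ab.
by rewrite normrM ler_piMr// ger0_norm.
Qed.

End ramps.

(** * Smoothness of products of cutoffs *)

Section smooth_classes.
Variable R : realType.

(* Classes containing the test functions in use and stable under derivatives,
   so that [smooth_class] gives smoothness at once. *)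
Inductive smooth1 : (R -> R) -> Prop :=
| smooth1_flat p q k a : smooth1 (fun x => flat p (k * (x - a)) * flat q (1 - k * (x - a)))
| smooth1_step k a : smooth1 (fun x => step (k * (x - a)))
| smooth1D f g : smooth1 f -> smooth1 g -> smooth1 (fun x => f x + g x)
| smooth1Z c f : smooth1 f -> smooth1 (fun x => c * f x).

Lemma smooth1_derive f : smooth1 f ->
  exists2 f', smooth1 f' & forall x : R, is_derive x 1 f (f' x).
Proof.
elim=> {f} [p q k a|k a|f g _ [f' sf' ff'] _ [g' sg' gg']|c f _ [f' sf' ff']].
- exists (fun x => k * (flat (flat_next p) (k * (x - a)) * flat q (1 - k * (x - a)) +
     (-1) * (flat p (k * (x - a)) * flat (flat_next q) (1 - k * (x - a))))).
    by apply: smooth1Z; apply: smooth1D; [|apply: smooth1Z]; exact: smooth1_flat.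
  move=> x; pose h y := flat p y * flat q (1 - y).
  apply: (@is_derive_affine_comp _ h).
  apply: is_derive_eq (is_deriveM (is_derive_flat p _) (is_derive_flat_onem q _)) _.
  by rewrite /GRing.scale/=; ring.
- exists (fun x => k * ((bump_mass R)^-1 * (flat 1 (k * (x - a)) * flat 1 (1 - k * (x - a))))).
    by do 2! apply: smooth1Z; exact: smooth1_flat.
  by move=> x; apply: is_derive_affine_comp; exact: is_derive_step.
- exists (fun x => f' x + g' x); first exact: smooth1D.
  by move=> x; apply: is_deriveD.
- exists (fun x => c * f' x); first exact: smooth1Z.
  by move=> x; apply: is_deriveZ.
Qed.

Lemma smooth_class (V : normedModType R) (S : (V -> R) -> Prop) :
  (forall f, S f -> (forall z, differentiable f z) /\ forall v, S ('D_v f)) ->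
  forall f, S f -> smooth f.
Proof.
move=> HS f Sf vs z.
suff : S (foldr (fun v (g : V -> R) => 'D_v g) f vs) by case/HS.
by elim: vs => //= v vs /HS[].
Qed.

Lemma smooth1_smooth f : smooth1 f -> smooth f.
Proof.
apply: smooth_class => {}f /smooth1_derive[f' sf' ff']; split.
  by move=> z; apply/derivable1_diffP; have /@ex_derive := ff' z.
move=> v; suff -> : 'D_v f = fun x => v * f' x by exact: smooth1Z.
apply/funext => x; have df : differentiable f x.
  by apply/derivable1_diffP; have /@ex_derive := ff' x.
rewrite deriveE// -[v in LHS]mulr1 -[v * 1]/(v *: 1) linearZ/= -deriveE//.
by congr (_ * _); have /@derive_val := ff' x.
Qed.

Definition lform (l z : R * R) : R := l.1 * z.1 + l.2 * z.2.

Lemma is_diff_lform l z : is_diff z (lform l) (lform l).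
Proof.
have lin : linear (lform l : R * R -> R^o).
  by move=> k x y; rewrite /lform/= /GRing.scale/=; ring.
have lc : continuous (lform l).
  by move=> x; apply: cvgD; apply: cvgM; (try exact: cvg_cst); [exact: cvg_fst|exact: cvg_snd].
pose lM := GRing.isLinear.Build _ _ _ _ (lform l) lin.
pose L : {linear (R * R)%type -> R^o} := HB.pack (lform l) lM.
apply: DiffDef; first exact: (@linear_differentiable _ _ _ L).
exact: (@diff_lin _ _ _ L).
Qed.

Lemma smooth1_lform f f' l v z : (forall x : R, is_derive x 1 f (f' x)) ->
  differentiable (f \o lform l) z /\ 'D_v (f \o lform l) z = lform l v * f' (lform l z).
Proof.
move=> ff'; have df x : differentiable f x.
  by apply/derivable1_diffP; have /@ex_derive := ff' x.
have [dl dlE] := is_diff_lform l z.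
have dfl : differentiable (f \o lform l) z by exact: differentiable_comp.
split => //; rewrite deriveE// diff_comp// dlE/=.
rewrite -[lform l v in LHS]mulr1 -[_ * 1]/(_ *: 1) linearZ/= -deriveE//.
by congr (_ * _); have /@derive_val := ff' (lform l z).
Qed.

(** The linear forms are arbitrary: the products are formed in (xi, eta), while test functions live
    in (x, t). *)
Inductive smooth2 : (R * R -> R) -> Prop :=
| smooth2M f g l m : smooth1 f -> smooth1 g -> smooth2 (fun z : R * R => f (lform l z) * g (lform m z))
| smooth2D f g : smooth2 f -> smooth2 g -> smooth2 (fun z => f z + g z)
| smooth2Z c f : smooth2 f -> smooth2 (fun z => c * f z).

Lemma derive_tensor (f f' g g' : R -> R) (l m v z : R * R) :
  (forall x : R, is_derive x 1 f (f' x)) -> (forall x : R, is_derive x 1 g (g' x)) ->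
  differentiable (fun z : R * R => f (lform l z) * g (lform m z)) z /\
  'D_v (fun z : R * R => f (lform l z) * g (lform m z)) z =
    lform l v * (f' (lform l z) * g (lform m z)) + lform m v * (f (lform l z) * g' (lform m z)).
Proof.
move=> ff' gg'.
have [d1 e1] := smooth1_lform l v z ff'; have [d2 e2] := smooth1_lform m v z gg'.
have d := differentiableM d1 d2.
split; first exact: d.
rewrite (_ : 'D_v _ z = 'd ((f \o lform l) * (g \o lform m)) z v); last exact: deriveE.
transitivity ((f \o lform l) z * 'd (g \o lform m) z v + (g \o lform m) z * 'd (f \o lform l) z v).
  by rewrite (diffM d1 d2).
by rewrite -(deriveE v d1) -(deriveE v d2) e1 e2 /=; ring.
Qed.

Lemma smooth2_smooth f : smooth2 f -> smooth f.
Proof.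
apply: smooth_class => {}f; elim=> {f} [f g l m sf sg|f g _ [df sf] _ [dg sg]|c f _ [df sf]].
- have [f' sf' ff'] := smooth1_derive sf; have [g' sg' gg'] := smooth1_derive sg.
  split; first by move=> z; have [] := derive_tensor l m 0 z ff' gg'.
  move=> v; rewrite [X in smooth2 X](_ : _ = fun z =>
      lform l v * (f' (lform l z) * g (lform m z)) + lform m v * (f (lform l z) * g' (lform m z))).
    by apply: smooth2D; apply: smooth2Z; exact: smooth2M.
  by apply/funext => z; have [] := derive_tensor l m v z ff' gg'.
- split; first by move=> z; apply: differentiableD.
  move=> v; rewrite [X in smooth2 X](_ : _ = fun z => 'D_v f z + 'D_v g z); first exact: smooth2D.
  by apply/funext => z; rewrite -deriveD//; exact: diff_derivable.
- split; first by move=> z; apply: differentiableZ.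
  move=> v; rewrite [X in smooth2 X](_ : _ = fun z => c * 'D_v f z); first exact: smooth2Z.
  by apply/funext => z; rewrite -[RHS]/(c *: _) -deriveZ//; exact: diff_derivable.
Qed.

End smooth_classes.

(** * The characteristic change of variables *)

Section affine_change_of_variables.
Variable R : realType.
Local Notation mu := (@lebesgue_measure R).
Local Notation TR := (measurableTypeR R).

Lemma measurable_affine (k c : R) : measurable_fun [set: TR] (fun x : TR => k * x + c : TR).
Proof. by apply: measurable_funD => //; apply: measurable_funM. Qed.

(** By uniqueness of Lebesgue measure: k times the push-forward under the affine map has the right
    value on half-open intervals. *)
Lemma lebesgue_affine (k c : R) (A : set TR) : 0 < k -> measurable A ->
  mu ((fun x => k * x + c) @^-1` A) = ((k^-1)%:E * mu A)%E.
Proof.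
move=> k0 mA.
pose f (x : TR) : TR := k * x + c.
have mf : measurable_fun [set: TR] f := measurable_affine k c.
pose m : {measure set TR -> \bar R} := mscale (NngNum (ltW k0)) (pushforward mu f).
have -> : mu A = m mf A.
  apply: lebesgue_measure_unique => // _ [[a b] _ <-].
  transitivity (k%:E * mu (f @^-1` `]a, b]%classic))%E; last by [].
  rewrite (_ : f @^-1` _ = `](a - c) / k, (b - c) / k]%classic); last first.
    apply/seteqP; split => x /=; rewrite !in_itv/= /f.
      by rewrite ltr_pdivrMr// ler_pdivlMr// ltrBlDr lerBrDr ![x * k]mulrC.
    by rewrite ltr_pdivrMr// ler_pdivlMr// ltrBlDr lerBrDr ![x * k]mulrC.
  rewrite !lebesgue_measure_itv/= !lte_fin ltr_pM2r ?invr_gt0// ltrD2r.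
  case: ifP => _; last by rewrite mule0.
  rewrite -!EFinB -EFinM; congr EFin; field; exact: lt0r_neq0.
transitivity (k^-1%:E * (k%:E * mu (f @^-1` A)))%E; last by [].
by rewrite muleA -EFinM mulVf ?mul1e// lt0r_neq0.
Qed.

Lemma ge0_integral_affine (k c : R) (f : TR -> \bar R) : 0 < k ->
  measurable_fun setT f -> (forall x, 0 <= f x)%E ->
  (\int[mu]_x f (k * x + c)%R = (k^-1)%:E * \int[mu]_x f x)%E.
Proof.
move=> k0 mf f0.
have mk := measurable_affine k c.
rewrite -[LHS](@ge0_integral_pushforward _ _ _ _ _ (fun x : TR => k * x + c : TR) mk mu setT)//.
have kV0 : 0 <= k^-1 by rewrite invr_ge0 ltW.
pose m : {measure set TR -> \bar R} := mscale (NngNum kV0) mu.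
rewrite (eq_measure_integral m); last first.
  by move=> A mA _; rewrite /m /mscale/=; exact: lebesgue_affine.
by rewrite ge0_integral_mscale.
Qed.

Lemma ae_affine (k c : R) (P : R -> Prop) : 0 < k ->
  {ae mu, forall x, P x} -> {ae mu, forall x, P (k * x + c)}.
Proof.
move=> k0 [N [mN N0 NP]]; exists ((fun x => k * x + c) @^-1` N); split.
- by rewrite -[X in measurable X]setTI; exact: measurable_affine.
- by rewrite [LHS]lebesgue_affine// N0 mule0.
- by move=> x /= Px; apply: NP.
Qed.

Lemma ae_opp (P : R -> Prop) : {ae mu, forall x, P x} -> {ae mu, forall x, P (- x)}.
Proof.
move=> [N [mN N0 NP]]; exists (-%R @^-1` N); split.
- by rewrite -[X in measurable X]setTI; exact: oppr_measurable.
- by have := lebesgue_measureN mN; rewrite /pushforward => ->.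
- by move=> x /= Px; apply: NP.
Qed.

End affine_change_of_variables.

(** * The rotation between (x, t) and (xi, eta) *)

Section plane.
Variable R : realType.
Local Notation mu := (@lebesgue_measure R).
Local Notation TR := (measurableTypeR R).
Local Notation T2 := (TR * TR)%type.
Implicit Type f : T2 -> \bar R.

Lemma measurable_lin2 (k l : R) : measurable_fun [set: T2] (fun z : T2 => k * z.1 + l * z.2 : TR).
Proof. by apply: measurable_funD => //; apply: measurable_funM. Qed.

Lemma measurable_pair_lin2 (k l m n : R) :
  measurable_fun [set: T2] (fun z : T2 => (k * z.1 + l * z.2, m * z.1 + n * z.2) : T2).
Proof. by apply/measurable_fun_pairP; split; exact: measurable_lin2. Qed.

Definition to_char (z : R * R) : R * R :=
  ((z.1 + z.2) / Num.sqrt 2, (z.2 - z.1) / Num.sqrt 2).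

Lemma measurable_of_char : measurable_fun [set: T2] (@of_char R : T2 -> T2).
Proof.
rewrite (_ : @of_char R = fun z : T2 => ((Num.sqrt 2)^-1 * z.1 + (- (Num.sqrt 2)^-1) * z.2,
  (Num.sqrt 2)^-1 * z.1 + (Num.sqrt 2)^-1 * z.2)); first exact: measurable_pair_lin2.
by apply/funext => z; rewrite /of_char; congr pair; ring.
Qed.

Lemma measurable_to_char : measurable_fun [set: T2] (to_char : T2 -> T2).
Proof.
rewrite (_ : to_char = fun z : T2 => ((Num.sqrt 2)^-1 * z.1 + (Num.sqrt 2)^-1 * z.2,
  (- (Num.sqrt 2)^-1) * z.1 + (Num.sqrt 2)^-1 * z.2)); first exact: measurable_pair_lin2.
by apply/funext => z; rewrite /to_char; congr pair; ring.
Qed.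

Lemma sqrt2_gt0 : 0 < Num.sqrt 2 :> R. Proof. by rewrite sqrtr_gt0. Qed.

Lemma sqrt2_neq0 : Num.sqrt 2 != 0 :> R. Proof. by rewrite gt_eqF// sqrt2_gt0. Qed.

Lemma sqr_sqrt2 : Num.sqrt 2 * Num.sqrt 2 = 2 :> R. Proof. by rewrite -expr2 sqr_sqrtr. Qed.

Lemma of_charK : cancel (@of_char R) to_char.
Proof.
case=> x y; rewrite /to_char /of_char/=; congr pair.
  by rewrite -mulrDl addrACA addrA subrK -mulrA -invfM sqr_sqrt2; field.
by rewrite -mulrBl -mulrA -invfM sqr_sqrt2; field.
Qed.

Lemma to_charK : cancel to_char (@of_char R).
Proof.
case=> x y; rewrite /to_char /of_char/=; congr pair.
  by rewrite -mulrBl -mulrA -invfM sqr_sqrt2; field.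
by rewrite -mulrDl -mulrA -invfM sqr_sqrt2; field.
Qed.

(** The rotation is split into two one-dimensional substitutions. For fixed y, the variable X = (x -
    y) / sqrt 2 costs a factor sqrt 2 and turns the second coordinate into X + sqrt 2 y; after
    Tonelli, substituting this for y gives the factor back. *)
Lemma ge0_integral_of_char f : measurable_fun setT f -> (forall z, 0 <= f z)%E ->
  (\int[leb2]_z f (of_char z) = \int[leb2]_z f z)%E.
Proof.
move=> mf f0; rewrite /leb2.
have s0 := sqrt2_gt0; have sN0 := sqrt2_neq0.
have sV0 : 0 < (Num.sqrt 2)^-1 :> R by rewrite invr_gt0.
have mg : measurable_fun [set: T2] (fun z => f (z.1, z.1 + Num.sqrt 2 * z.2)).
  apply: measurableT_comp => //.
  have := measurable_pair_lin2 1 0 1 (Num.sqrt 2); congr measurable_fun.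
  by apply/funext => z; rewrite !mul1r mul0r addr0.
rewrite fubini_tonelli2//; last exact: measurableT_comp measurable_of_char.
rewrite /fubini_G.
transitivity (\int[mu]_y ((Num.sqrt 2)%:E * \int[mu]_x f (x, x + Num.sqrt 2 * y)%R))%E.
  apply: eq_integral => y _.
  have := @ge0_integral_affine _ _ (- (y / Num.sqrt 2)) (fun x => f (x, x + Num.sqrt 2 * y)) sV0.
  rewrite invrK => <-//.
    apply: eq_integral => x _; rewrite /of_char/=; congr (f (_, _)); first by ring.
    have -> : Num.sqrt 2 * y = y / Num.sqrt 2 + y / Num.sqrt 2.
      by apply: (mulIf sN0); rewrite mulrDl !divfK// mulrAC sqr_sqrt2; ring.
    by rewrite mulrDl; ring.
  exact: (measurableT_comp mg (pair2_measurable y)).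
rewrite ge0_integralZl//; last 2 first.
- exact: (measurable_fun_fubini_tonelli_G (fun z : T2 => f (z.1, (z.1 + Num.sqrt 2 * z.2)%R)) mg).
- by move=> y _; exact: integral_ge0.
rewrite (_ : (\int[mu]_y \int[mu]_x f (x, x + Num.sqrt 2 * y)%R =
    \int[mu]_x \int[mu]_y f (x, x + Num.sqrt 2 * y)%R)%E); last first.
  by rewrite -(@fubini_tonelli _ _ _ _ _ mu mu (fun z => f (z.1, z.1 + Num.sqrt 2 * z.2)%R)).
rewrite fubini_tonelli1// /fubini_F.
transitivity ((Num.sqrt 2)%:E * \int[mu]_x ((Num.sqrt 2)^-1%:E * \int[mu]_y f (x, y)))%E.
  congr (_ * _)%E; apply: eq_integral => x _.
  rewrite -(@ge0_integral_affine _ _ x (fun y => f (x, y)))//.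
    by apply: eq_integral => y _; rewrite addrC.
  exact: (measurableT_comp mf (pair1_measurable x)).
rewrite ge0_integralZl//.
- by rewrite muleA -EFinM mulfV// mul1e.
- exact: measurable_fun_fubini_tonelli_F.
- by move=> y _; exact: integral_ge0.
Qed.

Lemma integral_of_char f : measurable_fun setT f ->
  (\int[leb2]_z f (of_char z) = \int[leb2]_z f z)%E.
Proof.
move=> mf; rewrite integralE [RHS]integralE.
congr (_ - _)%E.
  rewrite -[RHS]ge0_integral_of_char//; last exact: measurable_funepos.
  by apply: eq_integral => z _; rewrite !funeposE.
rewrite -[RHS]ge0_integral_of_char//; last exact: measurable_funeneg.
by apply: eq_integral => z _; rewrite !funenegE.
Qed.

Lemma leb2_of_char (A : set T2) : measurable A -> leb2 (@of_char R @^-1` A) = leb2 A.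
Proof.
move=> mA.
have mB : measurable (@of_char R @^-1` A : set T2).
  by rewrite -[X in measurable X]setTI; exact: measurable_of_char.
have E B : measurable B -> leb2 B = (\int[leb2]_z (\1_B z : R)%:E)%E.
  by move=> mB'; rewrite integral_indic// setIT.
rewrite !E//.
rewrite -[RHS]ge0_integral_of_char//.
by apply/measurable_EFinP; exact: measurable_indic.
Qed.

Lemma ae_to_char (P : R * R -> Prop) :
  {ae leb2, forall c, P (of_char c)} -> {ae leb2, forall z, P z}.
Proof.
move=> [N [mN N0 NP]].
have mN' : measurable (to_char @^-1` N : set T2).
  by rewrite -[X in measurable X]setTI; exact: measurable_to_char.
exists (to_char @^-1` N); split => //.
- rewrite -leb2_of_char// -comp_preimage (_ : to_char \o _ = id) ?preimage_id//.
  by apply/funext => z; exact: of_charK.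
- by move=> x /= Px; apply: NP => /=; rewrite to_charK.
Qed.

Lemma ae_plane (A : set T2) : measurable A ->
  {ae mu, forall y, {ae mu, forall x, ~ A (x, y)}} -> {ae leb2, forall z, ~ A z}.
Proof.
move=> mA H; exists A; split => //; last by move=> z /= /contrapT.
have mf : measurable_fun setT (fun z : T2 => (\1_A z : R)%:E).
  by apply/measurable_EFinP; exact: measurable_indic.
rewrite -[A]setIT -integral_indic// /leb2 fubini_tonelli2//.
rewrite -[RHS](@integral0 _ _ _ mu setT).
apply: ae_eq_integral => //; first exact: measurable_fun_fubini_tonelli_G.
apply: aeS H => y Hy _; rewrite /fubini_G -[RHS](@integral0 _ _ _ mu setT).
apply: ae_eq_integral => //; first exact: (measurableT_comp mf (pair2_measurable y)).
by apply: aeS Hy => x Ax _; rewrite indicE memNset.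
Qed.

Lemma ae_plane_swap (A : set T2) : measurable A ->
  {ae mu, forall x, {ae mu, forall y, ~ A (x, y)}} -> {ae leb2, forall z, ~ A z}.
Proof.
move=> mA H; exists A; split => //; last by move=> z /= /contrapT.
have mf : measurable_fun setT (fun z : T2 => (\1_A z : R)%:E).
  by apply/measurable_EFinP; exact: measurable_indic.
rewrite -[A]setIT -integral_indic// /leb2 fubini_tonelli1//.
rewrite -[RHS](@integral0 _ _ _ mu setT).
apply: ae_eq_integral => //; first exact: measurable_fun_fubini_tonelli_F.
apply: aeS H => x Hx _; rewrite /fubini_F -[RHS](@integral0 _ _ _ mu setT).
apply: ae_eq_integral => //; first exact: (measurableT_comp mf (pair1_measurable x)).
by apply: aeS Hx => y Ay _; rewrite indicE memNset.
Qed.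

End plane.

(** * Derivatives of primitives and quantiles *)

Section dlim.
Variable R : realType.
Local Notation mu := (@lebesgue_measure R).
Implicit Types f g : R -> R.

(** The derivative of [f] at [x] is [l], written as an estimate that can be used at individual
    points near [x]. *)
Definition dlim f x l := forall e, 0 < e -> exists2 d, 0 < d &
  forall y, `|y - x| <= d -> `|f y - f x - l * (y - x)| <= e * `|y - x|.

Lemma dlim_cst k x : dlim (fun=> k) x 0.
Proof. by move=> e e0; exists 1 => // y _; rewrite subrr mul0r subr0 normr0 mulr_ge0// ltW. Qed.

Lemma dlim_local f g x l c d : 0 < d ->
  (forall y, `|y - x| <= d -> f y = g y + c) -> dlim g x l -> dlim f x l.
Proof.
move=> d0 fg gl e e0; have [d' d'0 H] := gl e e0.
exists (Num.min d d'); first by rewrite lt_min d0.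
move=> y; rewrite le_min => /andP[yd yd'].
rewrite (fg y yd) (fg x); last by rewrite subrr normr0 ltW.
by have := H y yd'; congr (`|_| <= _); ring.
Qed.

(** Left difference quotients alone determine a derivative. In [velocity_after_before] the left side
    is the controlled one, because F is nondecreasing. *)
Lemma dlim_le_left f g x l m d : dlim f x l -> dlim g x m -> 0 < d ->
  (forall y, x - d <= y <= x -> f x - f y <= g x - g y) -> l <= m.
Proof.
move=> fl gm d0 fg; rewrite -subr_le0; apply/ler_addgt0Pr => e e0; rewrite add0r.
have e2 : 0 < e / 2 by rewrite divr_gt0.
have [d1 d10 H1] := fl _ e2; have [d2 d20 H2] := gm _ e2.
pose h := Num.min d (Num.min d1 d2).
have h0 : 0 < h by rewrite !lt_min d0 d10 d20.
have [hd [hd1 hd2]] : h <= d /\ h <= d1 /\ h <= d2.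
  by rewrite /h !ge_min !lexx ?orbT.
have E : x - h - x = - h by ring.
have nh : `|x - h - x| = h by rewrite E normrN gtr0_norm.
have := H1 (x - h); rewrite nh => /(_ hd1); rewrite E ler_norml => /andP[A1 A2].
have := H2 (x - h); rewrite nh => /(_ hd2); rewrite E ler_norml => /andP[B1 B2].
have := fg (x - h); rewrite lerD2l lerN2 hd gerBl (ltW h0) => /(_ isT) C.
rewrite -(ler_pM2r h0); nra.
Qed.

Lemma dlim_cvg f x l : h^-1 *: (f (h *: 1 + x) - f x) @[h --> 0^'] --> l -> dlim f x l.
Proof.
move=> /cvgrPdist_le fl e e0.
have [d /= d0 H] := fl _ e0.
exists (d / 2); first by rewrite divr_gt0.
move=> y yd; have [->|yx] := eqVneq y x.
  by rewrite !subrr mulr0 subr0 normr0 mulr0.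
have /= := H (y - x); rewrite sub0r normrN => /(_ _)/wrap[].
  by apply: (le_lt_trans yd); rewrite ltr_pdivrMr// ltr_pMr// ltr1n.
rewrite subr_eq0 => /(_ yx).
rewrite [_ *: 1]mulr1 subrK -ler_pdivrMr ?normr_gt0 ?subr_eq0//.
rewrite -[`|y - x|^-1]normfV -normrM distrC; congr (`|_| <= _).
by rewrite /GRing.scale/=; field; rewrite subr_eq0.
Qed.

Lemma itg_dlim a b f : L1 a b f ->
  {ae mu, forall x, a < x < b -> dlim (fun y => itg a y f) x (f x)}.
Proof.
move=> Lf; have iT : mu.-integrable setT (EFin \o (f \_ `[a, b])).
  by rewrite -restrict_EFin; apply/integrable_restrict => //=; rewrite setTI.
have := @lebesgue_differentiation R (f \_ `[a, b]).
have /[swap]/[apply] : locally_integrable setT (f \_ `[a, b]).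
  exact: (@open_integrable_locally _ _ _ openT iT).
apply: aeS => x lx /andP[ax xb].
have [dF dF'] : derivable (fun y : R => itg a y (f \_ `[a, b])) x 1 /\
    (fun y : R => itg a y (f \_ `[a, b]))^`()%classic x = (f \_ `[a, b]) x.
  apply: (@FTC1_lebesgue_pt R (f \_ `[a, b]) (BLeft a) x b) => //.
    by apply: integrableS iT.
have fxE : (f \_ `[a, b]) x = f x.
  by rewrite patchE mem_set//= in_itv/= (ltW ax) (ltW xb).
apply: (@dlim_local _ (fun y => itg a y (f \_ `[a, b])) _ _ 0 (Num.min (x - a) (b - x))).
- by rewrite lt_min !subr_gt0 ax.
- move=> y; rewrite le_min => /andP[]; rewrite !ler_norml => /andP[A1 A2] /andP[B1 B2].
  rewrite addr0; apply: eq_itg => t /andP[t1 t2].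
  by rewrite patchE mem_set//= in_itv/= t1/=; lra.
- apply: dlim_cvg; rewrite -fxE -dF' derive1E; exact: dF.
Qed.

End dlim.

(** * Quantiles of a density *)

Section quantile.
Variables (R : realType) (x0 x1 : R) (n : R -> R).
Local Notation mu := (@lebesgue_measure R).
Local Notation TR := (measurableTypeR R).
Hypotheses (x01 : x0 <= x1) (Ln : L1 x0 x1 n) (n0 : forall x, x0 <= x <= x1 -> 0 <= n x).
Local Notation F x := (itg x0 x n).
Local Notation M := (F x1).

Lemma primitive_cat x y : x0 <= x -> x <= y -> y <= x1 -> F y = F x + itg x y n.
Proof. by move=> a b c; apply: itg_cat => //; apply: L1S Ln. Qed.

Lemma primitive_le x y : x0 <= x -> x <= y -> y <= x1 -> F x <= F y.
Proof.
move=> a b c; rewrite (primitive_cat a b c) lerDl; apply: itg_ge0 => z /andP[z1 z2].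
by rewrite n0// (le_trans a z1) (le_trans z2 c).
Qed.

Lemma primitive_small e : 0 < e -> exists2 d, 0 < d &
  forall x y, x0 <= x -> x <= y -> y <= x1 -> y - x <= d -> F y <= F x + e.
Proof.
move=> e0; have [d d0 H] := itg_small Ln e0; exists d => // x y a b c yx.
rewrite (primitive_cat a b c) lerD2l; apply: le_trans (H x y a b c yx).
by apply: (le_trans (ler_norm _)); apply: itg_norm; apply: L1S Ln.
Qed.

(** The alternative x = x0 keeps the set nonempty, so the supremum below is never a default value.
    For 0 < t <= M the supremum is the least point at which the primitive reaches t, the
    left-continuous generalised inverse. *)
Definition sublevel t := [set x | x0 <= x <= x1 /\ (x = x0 \/ F x < t)].

Definition quantile t := sup (sublevel t).

Lemma sublevel_ubound t : has_ubound (sublevel t).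
Proof. by exists x1 => x [/andP[]]. Qed.

Lemma sublevel_x0 t : sublevel t x0.
Proof. by split; [rewrite lexx|left]. Qed.

Lemma quantile_itv t : x0 <= quantile t <= x1.
Proof.
rewrite (ub_le_sup (@sublevel_ubound t) (@sublevel_x0 t))/=.
by apply: ge_sup; [exists x0; exact: sublevel_x0|move=> x [/andP[]]].
Qed.

Lemma quantile_mono : nondecreasing_fun quantile.
Proof.
move=> s t st; apply: ge_sup; first by exists x0; exact: sublevel_x0.
move=> x [xx H]; apply: ub_le_sup; first exact: sublevel_ubound.
by split => //; case: H => [|H]; [left|right; exact: lt_le_trans st].
Qed.

(** The Galois connection between the primitive and its generalised inverse. It computes the
    preimages of half-lines in [quantile_pushforward]; from right to left it uses the continuity of
    F. *)
Lemma lt_quantile t a : 0 < t <= M -> x0 <= a < x1 -> (a < quantile t) = (F a < t).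
Proof.
move=> /andP[t0 tM] /andP[xa ax]; apply/idP/idP => [aq|Fa].
  have [|x [/andP[xx xx1] H] ax'] := sup_gt _ aq.
    by exists x0; exact: sublevel_x0.
  case: H => [xE|]; first by move: ax'; rewrite xE ltNge xa.
  by apply: le_lt_trans; apply: primitive_le => //; exact: ltW.
have e0 : 0 < (t - F a) / 2 by rewrite divr_gt0// subr_gt0.
have [d d0 H] := primitive_small e0.
have am : a < Num.min (a + d) x1 by rewrite lt_min ltrDl d0.
apply: (lt_le_trans am); apply: ub_le_sup; first exact: sublevel_ubound.
have mx : Num.min (a + d) x1 <= x1 by rewrite ge_min lexx orbT.
split; first by rewrite (le_trans xa (ltW am)).
right; apply: (@le_lt_trans _ _ (F a + (t - F a) / 2)).
  apply: H => //; first exact: ltW.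
  by rewrite lerBlDl ge_min lexx.
by rewrite -ltrBrDl ltr_pdivrMr// ltr_pMr ?subr_gt0// ltr1n.
Qed.

Lemma quantileP t : 0 < t <= M -> F (quantile t) = t.
Proof.
move=> tt; have /andP[t0 tM] := tt; have /andP[q0 q1] := quantile_itv t.
have [Fq|Fq|//] := ltgtP (F (quantile t)) t; exfalso.
  have q1' : quantile t < x1.
    rewrite lt_neqAle q1 andbT; apply/eqP => qE.
    by move: Fq; rewrite qE ltNge tM.
  by have := lt_quantile tt (introT andP (conj q0 q1')); rewrite ltxx Fq.
have q0' : x0 < quantile t.
  rewrite lt_neqAle q0 andbT; apply/eqP => qE.
  by move: Fq; rewrite -qE itgxx ltNge (ltW t0).
have e0 : 0 < (F (quantile t) - t) / 2 by rewrite divr_gt0// subr_gt0.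
have [d d0 H] := primitive_small e0.
pose x := Num.max (quantile t - d) x0.
have xq : x < quantile t by rewrite gt_max q0' andbT gtrBl.
have x0x : x0 <= x by rewrite le_max lexx orbT.
have := lt_quantile tt (introT andP (conj x0x (lt_le_trans xq q1))).
rewrite xq => /esym Fx.
have : F (quantile t) <= F x + (F (quantile t) - t) / 2.
  apply: H => //; first exact: ltW.
  by rewrite lerBlDr -lerBlDl le_max lexx.
by lra.
Qed.

Lemma measurable_quantile : measurable_fun [set: TR] (quantile : TR -> TR).
Proof.
exact: (@nondecreasing_measurable R setT quantile measurableT quantile_mono).
Qed.

Lemma integral_itg a b (f : R -> R) : a <= b -> L1 a b f ->
  (\int[mu]_(x in `]a, b]) (f x)%:E)%E = (itg a b f)%:E.
Proof.
move=> ab Lf; rewrite (@integral_itv_obnd_cbnd R a (BRight b) (EFin \o f)); last first.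
  by apply: measurable_funS (measurable_int mu Lf) => //; exact: subset_itv_oc_cc.
by rewrite /itg /Rintegral fineK//; exact: integrable_fin_num.
Qed.

(** The push-forward of Lebesgue measure on ]0, M] is n dx. Both are finite, hence it suffices to
    compare them on the half-lines ]a, +oo[, where for a between x0 and x1 both give M - F a. *)
Lemma quantile_pushforward (E : set TR) : measurable E ->
  mu (quantile @^-1` E `&` `]0, M]) = (\int[mu]_(x in E `&` `]x0, x1]) (n x)%:E)%E.
Proof.
move=> mE; have mq := measurable_quantile.
pose m1 : {measure set TR -> \bar R} :=
  pushforward (mrestr mu (measurable_itv `]0, M])) (quantile : TR -> TR).
pose g x := (n \_ `]x0, x1]) x.
have mg : measurable_fun [set: TR] (EFin \o g).
  apply/measurable_EFinP; apply/(measurable_restrictT _ _).1 => //.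
  by apply: measurable_funS (L1_measurable Ln) => //; exact: subset_itv_oc_cc.
have g0 x : (0 <= (g x)%:E)%E.
  rewrite lee_fin /g patchE; case: ifPn => //; rewrite inE/= in_itv/= => /andP[a b].
  by rewrite n0// (ltW a).
pose nu := fun A : set TR => (\int[mu]_(x in A) (g x)%:E)%E.
have nu0 : nu set0 = 0%E by rewrite /nu integral_set0.
have nu_ge0 A : (0 <= nu A)%E by apply: integral_ge0.
have nu_sa := semi_sigma_additive_nng_induced (mu := mu) mg g0.
pose nuM := isMeasure.Build _ _ _ nu nu0 nu_ge0 nu_sa.
pose m2 : {measure set TR -> \bar R} := HB.pack nu nuM.
have nuE A : nu A = (\int[mu]_(x in A `&` `]x0, x1]) (n x)%:E)%E.
  rewrite [RHS]integral_mkcondr; apply: eq_integral => x _.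
  by rewrite restrict_EFin.
rewrite -nuE -[LHS]/(m1 mq E) -[RHS]/(m2 E).
apply: (@measure_unique _ R TR (@RGenOInfty.G R) (fun k : nat => `](- k%:R : R), +oo[%classic) _ _ _ _ (m1 mq) m2) => //.
- exact: RGenOInfty.measurableE.
- move=> _ _ [a ->] [b ->]; exists (Num.max a b); apply/seteqP; split => x /=.
    by rewrite !in_itv/= !andbT gt_max => -[-> ->].
  by rewrite !in_itv/= !andbT gt_max => /andP[].
- by move=> k; exists (- k%:R).
- apply/seteqP; split => // x _; exists (Num.truncn `|x|).+1 => //=.
  rewrite in_itv/= andbT ltrNl; apply: le_lt_trans (truncnS_gt _).
  by rewrite -normrN ler_norm.
- move=> _ [a ->]; rewrite -[m2 _]/(nu _) nuE.
  transitivity (mu (quantile @^-1` `]a, +oo[ `&` `]0, M])); first by [].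
  have [ax|xa] := ltP a x0.
    rewrite (_ : _ `&` `]0, M] = `]0, M]%classic); last first.
      apply/seteqP; split => t /=; first by case.
      move=> tt; split => //; rewrite in_itv/= andbT.
      by apply: (lt_le_trans ax); have /andP[] := quantile_itv t.
    rewrite (_ : _ `&` `]x0, x1] = `]x0, x1]%classic); last first.
      apply/seteqP; split => t /=; first by case.
      by rewrite !in_itv/= andbT => /andP[t0 ->]; rewrite t0 (lt_trans ax t0).
    rewrite integral_itg// lebesgue_measure_itv/= lte_fin oppr0 adde0.
    case: ifPn => //; rewrite -leNgt => M0.
    congr EFin; apply/eqP; rewrite eq_le M0 andbT.
    exact: itg_ge0.
  have [ax|x1a] := ltP a x1; last first.
    rewrite (_ : _ `&` `]0, M] = set0); last first.
      apply/seteqP; split => t //= -[]; rewrite in_itv/= andbT => aq.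
      have /andP[_ q1] := quantile_itv t.
      by have := lt_le_trans aq (le_trans q1 x1a); rewrite ltxx.
    rewrite (_ : _ `&` `]x0, x1] = set0) ?integral_set0 ?measure0//.
    apply/seteqP; split => t //= -[]; rewrite !in_itv/= andbT => aq /andP[_ tx].
    by have := lt_le_trans aq (le_trans tx x1a); rewrite ltxx.
  have xax : x0 <= a < x1 by rewrite xa.
  rewrite (_ : _ `&` `]0, M] = `]F a, M]%classic); last first.
    apply/seteqP; split => t /=; rewrite !in_itv/= andbT.
      by move=> [aq tt]; rewrite -(lt_quantile tt xax) aq; case/andP: tt.
    move=> /andP[Fat tM]; have tt : 0 < t <= M.
      by rewrite tM andbT; apply: le_lt_trans Fat; rewrite -(itgxx x0 n) primitive_le// ltW.
    by rewrite (lt_quantile tt xax) Fat.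
  rewrite (_ : _ `&` `]x0, x1] = `]a, x1]%classic); last first.
    apply/seteqP; split => t /=; rewrite !in_itv/= andbT.
      by move=> [-> /andP[]].
    by move=> /andP[at' ->]; rewrite at' (le_lt_trans xa at').
  rewrite integral_itg ?(ltW ax)//; last by apply: L1S Ln.
  have FM : F a <= M by apply: primitive_le => //; exact: ltW.
  have ME := primitive_cat xa (ltW ax) (lexx x1).
  rewrite lebesgue_measure_itv/= lte_fin; case: ltgtP FM => // [_ _|FME _].
    by rewrite -EFinB ME; congr EFin; ring.
  by congr EFin; move: ME; rewrite FME; lra.
- move=> k; apply: (@le_lt_trans _ _ (mu `]0, M])).
    apply: le_measure; rewrite ?inE//.
    by apply: measurableI => //; rewrite -[X in measurable X]setTI; exact: mq.
  by rewrite lebesgue_measure_itv/= lte_fin; case: ifP => _; rewrite ?ltry.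
Qed.

(** The null set where [P] fails and the set of zeros of [n] both have mass zero for n dx, so their
    preimages under the quantile are null. Nonvanishing of [n] at the quantile thus comes for
    free. *)
Lemma ae_quantile (P : R -> Prop) :
  {ae mu, forall x, x0 < x <= x1 -> n x != 0 -> P x} ->
  {ae mu, forall t, 0 < t <= M -> n (quantile t) != 0 /\ P (quantile t)}.
Proof.
move=> [N [mN N0 NP]].
pose n' := n \_ `]x0, x1].
have mn' : measurable_fun [set: TR] n'.
  apply/(measurable_restrictT _ _).1 => //.
  by apply: measurable_funS (L1_measurable Ln) => //; exact: subset_itv_oc_cc.
pose Z := [set x : TR | n' x = 0].
have mZ : measurable Z.
  by rewrite -[X in measurable X]setTI; exact: (mn' measurableT _ (measurable_set1 0)).
have mE : measurable (N `|` Z) by exact: measurableU.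
have E0 : mu (quantile @^-1` (N `|` Z) `&` `]0, M]) = 0%E.
  rewrite quantile_pushforward// -[RHS](@integral0 _ _ _ mu ((N `|` Z) `&` `]x0, x1])).
  apply: ae_eq_integral => //.
  - exact: measurableI.
  - apply: measurable_funS (measurable_int mu Ln) => //.
    by move=> x [_] /=; rewrite !in_itv/= => /andP[a ->]; rewrite (ltW a).
  exists N; split => // x /= H; apply: contrapT => xN; apply: H => -[[//|Zx] xx].
  by move: Zx; rewrite /Z/= /n' patchE mem_set// => ->.
exists (quantile @^-1` (N `|` Z) `&` `]0, M]); split => //.
  by apply: measurableI => //; rewrite -[X in measurable X]setTI; exact: measurable_quantile.
move=> t /= H; apply: contrapT => tN; apply: H => tt.
have /andP[t0 tM] := tt.
have qN : ~ (N `|` Z) (quantile t).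
  by move=> qE; apply: tN; split => //=; rewrite in_itv.
have qq : x0 < quantile t <= x1.
  have /andP[q0 ->] := quantile_itv t; rewrite andbT lt_neqAle q0 andbT.
  by apply/eqP => qE; move: t0; rewrite -(quantileP tt) -qE itgxx ltxx.
have nq : n (quantile t) != 0.
  apply/eqP => nq; apply: qN; right; rewrite /Z/= /n' patchE; case: ifP => //.
split => //; apply: contrapT => nP; apply: qN; left; apply: NP => /= H.
exact/nP/H.
Qed.

(** The converse direction: a set that the quantile avoids has mass zero for n dx. *)
Lemma quantile_ae (E : set TR) : measurable E ->
  {ae mu, forall t, 0 < t <= M -> ~ E (quantile t)} ->
  {ae mu, forall x, x0 < x <= x1 -> E x -> n x = 0}.
Proof.
move=> mE [N [mN N0 NP]].
have mD : measurable (E `&` `]x0, x1] : set TR) by exact: measurableI.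
have mn : measurable_fun (E `&` `]x0, x1] : set TR) (EFin \o n).
  apply: measurable_funS (measurable_int mu Ln) => //.
  by move=> x [_] /=; rewrite !in_itv/= => /andP[a ->]; rewrite (ltW a).
have I0 : (\int[mu]_(x in E `&` `]x0, x1]) (n x)%:E)%E = 0%E.
  rewrite -quantile_pushforward//; apply: (@subset_measure0 _ _ _ mu _ N) => //.
    by apply: measurableI => //; rewrite -[X in measurable X]setTI; exact: measurable_quantile.
  by move=> t [/= Et tt]; apply: NP => /= /(_ _)/wrap[]; rewrite in_itv/= in tt.
have [+ _] := ae_eq_integral_abs mu mD mn.
rewrite (_ : (\int[mu]_(x in E `&` `]x0, x1]) `|(EFin \o n) x|)%E = 0%E); last first.
  rewrite -[RHS]I0; apply: eq_integral => x; rewrite inE/= in_itv/= => -[_ /andP[a b]].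
  by rewrite ger0_norm// n0// (ltW a).
move=> /(_ erefl); apply: aeS => x H xx Ex.
have /= := H; rewrite in_itv/= => /(_ (conj Ex xx)).
by move=> [].
Qed.

End quantile.

(** * Solutions in characteristic variables *)

Section characteristic_solutions.
Variable R : realType.
Local Notation mu := (@lebesgue_measure R).
Implicit Types U V P : R -> R -> R.

Definition swap (f : R -> R -> R) x y := f y x.

(** For smooth U this is the integral of U_{xi eta} over the rectangle, half the mass that box u
    gives to it. *)
Definition rect_inc U a b c d := U b d - U a d - U b c + U a c.

(* The line eta = y is good if, above the initial line xi + eta = 0, [U] has there
   the locally square integrable derivative [V]. *)
Definition good U V y := forall a b, a <= b -> 0 < a + y ->
  [/\ L1 a b (fun s => V s y), L1 a b (fun s => V s y ^+ 2) &
      U b y - U a y = itg a b (fun s => V s y)].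

Definition line_energy V e a b r := itg a (b + e) (fun s => V s r ^+ 2 * plateau e a b s).

(** Since [plateau'] is a probability density on [c, c + e] minus one on [d, d + e], this is a mean
    energy at the bottom minus a mean energy at the top. *)
Definition energy_flux V e a b c d :=
  itg c (d + e) (fun r => line_energy V e a b r * plateau' e c d r).

Definition half_continuous U := forall x y, 0 <= x + y -> forall e, 0 < e -> exists2 d, 0 < d &
  forall x' y', 0 <= x' + y' -> `|x' - x| <= d -> `|y' - y| <= d ->
    `|U x' y' - U x y| <= e.

(* The solution in the characteristic variables (xi, eta), with V = U_xi and
   P = U_eta.  As box u = 2 U_{xi eta}, the fields [char_inc] and [char_free] say
   box u >= 0 and box u = 0 in {u > 0}; [char_energy] is the conservation law
   (V^2)_eta + (P^2)_xi = 0 tested against a product of two plateaus. *)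
Record char_solution U V P : Prop := CharSolution {
  char_cont : half_continuous U;
  char_ge0 : forall x y, 0 <= x + y -> 0 <= U x y;
  char_inc : forall a b c d, a <= b -> c <= d -> 0 < a + c -> 0 <= rect_inc U a b c d;
  char_free : forall a b c d, a <= b -> c <= d -> 0 < a + c ->
    (forall x y, a <= x <= b -> c <= y <= d -> 0 < U x y) -> rect_inc U a b c d = 0;
  char_goodV : {ae mu, forall y, good U V y};
  char_goodP : {ae mu, forall x, good (swap U) (swap P) x};
  char_L1V : forall e a b c d, 0 < e -> a <= b -> c <= d -> 0 < a + c ->
    L1 c (d + e) (line_energy V e a b);
  char_L1P : forall e a b c d, 0 < e -> a <= b -> c <= d -> 0 < a + c ->
    L1 a (b + e) (line_energy (swap P) e c d);
  char_energy : forall e a b c d, 0 < e -> a + e <= b -> c + e <= d -> 0 < a + c ->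
    energy_flux V e a b c d + energy_flux (swap P) e c d a b = 0 }.

(** The reflection x -> - x. Whatever is shown for V holds for P. *)
Lemma char_solution_swap U V P : char_solution U V P ->
  char_solution (swap U) (swap P) (swap V).
Proof.
case=> H1 H2 H3 H4 H5 H6 H7 H8 H9; constructor.
- move=> x y xy e e0; rewrite addrC in xy; have [d d0 H] := H1 y x xy e e0.
  by exists d => // x' y' xy' xd yd; apply: H => //; rewrite addrC.
- by move=> x y; rewrite addrC; exact: H2.
- move=> a b c d ab cd ac; have := H3 c d a b cd ab; rewrite addrC => /(_ ac).
  by congr (_ <= _); rewrite /rect_inc /swap; ring.
- move=> a b c d ab cd ac Upos; have := H4 c d a b cd ab; rewrite addrC => /(_ ac) H.
  have <- : rect_inc U c d a b = rect_inc (swap U) a b c d by rewrite /rect_inc /swap; ring.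
  by apply: H => x y xab ycd; apply: Upos.
- exact: H6.
- exact: H5.
- by move=> e a b c d e0 ab cd ac; apply: H8 => //; rewrite addrC.
- by move=> e a b c d e0 ab cd ac; apply: H7 => //; rewrite addrC.
- by move=> e a b c d e0 ab cd ac; rewrite addrC H9// addrC.
Qed.

Lemma good_dlim U V y a b : good U V y -> 0 < a + y ->
  {ae mu, forall s, a < s < b -> dlim (fun x => U x y) s (V s y)}.
Proof.
move=> gy ay; have [ab|ba] := leP a b; last first.
  by apply: aeW => s /andP[as_ sb]; have := lt_trans as_ (lt_trans sb ba); rewrite ltxx.
have [L _ _] := gy a b ab ay.
apply: aeS (itg_dlim L) => s H sab; have := H sab; have /andP[as_ sb] := sab.
apply: (@dlim_local _ _ _ _ _ (U a y) (Num.min (s - a) (b - s))).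
  by rewrite lt_min !subr_gt0 as_.
move=> x; rewrite le_min => /andP[]; rewrite !ler_norml => /andP[A1 A2] /andP[B1 B2].
have ax : a <= x by lra.
by have [_ _ <-] := gy a x ax ay; rewrite subrK.
Qed.

(** By compactness of the segment, positivity of U on it spreads to a neighbourhood, to which
    [char_free] applies. *)
Lemma tube U V P s c d : char_solution U V P -> c <= d -> 0 < s + c ->
  (forall t, c <= t <= d -> 0 < U s t) ->
  exists2 h, 0 < h & forall s' t, `|s' - s| <= h -> c <= t <= d ->
    0 < s' + c /\ 0 < U s' t.
Proof.
move=> S cd sc Upos.
pose Q (s' t : R) := 0 < s' + c -> c <= t -> 0 < U s' t.
have /compact_near_coveringP/(_ R (nbhs s) Q _) : compact `[c, d] by exact: segment_compact.
have /[swap]/[apply] : forall t, `[c, d]%classic t -> \near t & s, Q s t.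
  move=> t /=; rewrite in_itv/= => tcd; have Ust := Upos t tcd; have /andP[ct td] := tcd.
  have e0 : 0 < U s t / 2 by rewrite divr_gt0.
  have st : 0 <= s + t by rewrite (le_trans (ltW sc))// lerD2l.
  have [h h0 H] := char_cont S st e0.
  exists (ball t h, ball s h); first by split; exact: nbhsx_ballx.
  move=> [t' s'] /= [tt ss] sc' ct'; have /= := H s' t'.
  rewrite (distrC s') (distrC t') => /(_ _ (ltW ss) (ltW tt))/wrap[].
    by rewrite (le_trans (ltW sc'))// lerD2l.
  by rewrite ler_norml => /andP[+ _]; lra.
move=> /nbhs_ballP [h /= h0 H].
pose k := Num.min (h / 2) ((s + c) / 2).
have k0 : 0 < k by rewrite lt_min !divr_gt0.
exists k => // s' t; rewrite le_min => /andP[k1 k2] tcd.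
have sc' : 0 < s' + c by move: k2; rewrite ler_norml => /andP[+ _]; lra.
split => //; apply: (H s' _ t) => //.
  rewrite /ball/= distrC; apply: (le_lt_trans k1).
  by rewrite ltr_pdivrMr// ltr_pMr// ltr1n.
by have /andP[] := tcd.
Qed.

Section vanishing.
Variables (U V P : R -> R -> R) (x0 x y0 y : R).
Hypotheses (S : char_solution U V P) (xx : x0 < x) (yy : y0 < y) (xy0 : 0 < x0 + y0).
Hypothesis Uxy : U x y = 0.

Lemma good_le_ae r r' a b : good U V r -> good U V r' -> r <= r' -> 0 < a + r ->
  {ae mu, forall s, a < s < b -> V s r <= V s r'}.
Proof.
move=> gr gr' rr ar; have ar' : 0 < a + r' by rewrite (lt_le_trans ar)// lerD2l.
apply: aeS (aeI (good_dlim b gr ar) (good_dlim b gr' ar')) => s [H1 H2] sab.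
have /andP[as_ sb] := sab.
apply: (dlim_le_left (d := s - a) (H1 sab) (H2 sab)); first by rewrite subr_gt0.
move=> t /andP[t1 t2]; have ta : 0 < t + r by apply: (lt_le_trans ar); rewrite lerD2r; lra.
by have := char_inc S t2 rr ta; rewrite /rect_inc; lra.
Qed.

(** If U(s, y) = 0, the nonnegative increment over [t, s] x [r', y] gives U(s, r') <= U(t, r') -
    U(t, y) <= U(t, r'), so V(s, r') <= 0. If U(s, y) > 0, then U(s, .) > 0 on [y0, y], since a zero
    at (s, t) would make the increment over [s, x] x [t, y] negative; around this segment box u = 0,
    and V(s, .) does not change between r and r'. *)
Lemma vanishing_dichotomy r r' : good U V r -> good U V r' ->
  y0 <= r -> r <= r' -> r' <= y ->
  {ae mu, forall s, x0 < s < x -> V s r <= V s r' /\ (V s r' <= 0 \/ V s r = V s r')}.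
Proof.
move=> gr gr' yr rr ry.
have ar : 0 < x0 + r by rewrite (lt_le_trans xy0)// lerD2l.
have ar' : 0 < x0 + r' by rewrite (lt_le_trans ar)// lerD2l.
have := aeI (good_le_ae x gr gr' rr ar) (aeI (good_dlim x gr ar) (good_dlim x gr' ar')).
apply: aeS => s [H [H1 H2]] sxx; split; first exact: H.
have := H1 sxx; have := H2 sxx; have /andP[xs sx] := sxx => D2 D1.
have pos t r1 : x0 <= t -> y0 <= r1 -> 0 < t + r1.
  by move=> h1 h2; apply: (lt_le_trans xy0); apply: lerD.
have [Us|Us] := leP (U s y) 0; [left|right].
  apply: (dlim_le_left (d := s - x0) D2 (dlim_cst 0 s)); first by rewrite subr_gt0.
  move=> t /andP[t1 t2].
  have ta : 0 < t + r' by apply: pos; lra.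
  have := char_inc S t2 ry ta; have : 0 <= U t y by apply/(char_ge0 S)/ltW/pos; lra.
  by rewrite /rect_inc; lra.
have Upos t : y0 <= t <= y -> 0 < U s t.
  move=> /andP[t1 t2]; rewrite lt_neqAle (char_ge0 S) ?andbT; last by apply/ltW/pos; lra.
  apply/eqP => Ut.
  have := char_inc S (ltW sx) t2 (pos s t (ltW xs) t1).
  have : 0 <= U x t by apply/(char_ge0 S)/ltW/pos; lra.
  by rewrite /rect_inc Uxy -Ut; lra.
have [h h0 H3] := tube S (ltW yy) (pos s y0 (ltW xs) (lexx _)) Upos.
have E t : s - h <= t <= s -> U s r - U t r = U s r' - U t r'.
  move=> /andP[t1 t2].
  have ty0 : 0 < t + y0 by apply: (H3 t y _ _).1; rewrite ?ler_norml ?lexx ?(ltW yy)//; lra.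
  have tr : 0 < t + r by apply: (lt_le_trans ty0); rewrite lerD2l.
  suff : rect_inc U t s r r' = 0 by rewrite /rect_inc; lra.
  apply: (char_free S) => // s' r1 /andP[s1 s2] /andP[r2 r3].
  by apply: (H3 s' r1 _ _).2; rewrite ?ler_norml; lra.
apply/eqP; rewrite eq_le; apply/andP; split.
  by apply: (dlim_le_left D1 D2 h0) => t /E ->.
by apply: (dlim_le_left D2 D1 h0) => t /E ->.
Qed.

Lemma line_energy_integrable e a b r : 0 < e -> a <= b -> good U V r -> 0 < a + r ->
  L1 a (b + e) (fun s => V s r ^+ 2 * plateau e a b s).
Proof.
move=> e0 ab gr ar; apply: L1_Mplateau => //.
by have [] := gr a (b + e) _ ar => //; rewrite (le_trans ab)// lerDl ltW.
Qed.

Lemma line_energy_le e a b r r' : 0 < e -> x0 <= a -> a <= b -> b + e <= x ->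
  good U V r -> good U V r' -> y0 <= r -> r <= r' -> r' <= y ->
  line_energy V e a b r' <= line_energy V e a b r.
Proof.
move=> e0 xa ab bx gr gr' yr rr ry.
have ar : 0 < a + r by apply: (lt_le_trans xy0); apply: lerD.
have ar' : 0 < a + r' by rewrite (lt_le_trans ar)// lerD2l.
apply: le_itg_ae; try exact: line_energy_integrable.
apply: aeS (vanishing_dichotomy gr gr' yr rr ry) => s H /andP[as_ sb].
have [sE|sx] := leP s a; first by rewrite !(plateau_eq0 e0 ab) ?mulr0//; left.
have [sE|sx'] := leP (b + e) s; first by rewrite !(plateau_eq0 e0 ab) ?mulr0//; right.
have /H [H1 H2] : x0 < s < x by rewrite (le_lt_trans xa sx) (lt_le_trans sx' bx).
rewrite ler_wpM2r//; first by have /andP[] := plateau_itv s e0 ab.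
case: H2 => [H2|->//]; rewrite -[leRHS]sqrrN -[leLHS]sqrrN ler_sqr ?nnegrE ?lerN2//.
  by rewrite oppr_ge0.
by rewrite oppr_ge0 (le_trans H1).
Qed.

Lemma ae_good_itv a b : a < b -> exists2 r, a < r < b & good U V r.
Proof. by move=> ab; apply: ae_itv_ex ab (char_goodV S). Qed.

Lemma energy_fluxE e a b c d : 0 < e -> a <= b -> c <= d -> 0 < a + c ->
  energy_flux V e a b c d =
  itg c (d + e) (fun r => line_energy V e a b r * ramp' e c r) -
  itg c (d + e) (fun r => line_energy V e a b r * ramp' e d r).
Proof.
move=> e0 ab cd ac; have L := char_L1V S e0 ab cd ac.
rewrite -itgB; try exact: L1_Mramp'.
by apply: eq_itg => r _; rewrite /plateau' mulrBr.
Qed.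

End vanishing.

(** Below a zero of U the line energy is nonincreasing in r, hence the sign. If the flux is zero,
    two lines r < r' have the same energy, so V(., r)^2 = V(., r')^2 almost everywhere between a + e
    and b. By [vanishing_dichotomy] this gives V(., r) = V(., r'): when V(s, r) <= V(s, r') <= 0,
    opposite values must both be 0. *)
Lemma energy_flux_vanishing U V P x0 x y0 y e a b c d : char_solution U V P ->
  x0 < x -> y0 < y -> 0 < x0 + y0 -> U x y = 0 ->
  0 < e -> x0 <= a -> a + e <= b -> b + e <= x ->
  y0 <= c -> c + e + e <= d -> d + e <= y ->
  0 <= energy_flux V e a b c d /\
  (energy_flux V e a b c d = 0 -> exists r r', [/\ c < r < c + e, d - e < r' < d &
     rect_inc U (a + e) b r r' = 0]).
Proof.
move=> S xx yy xy0 Uxy e0 xa ab bx yc cd dy.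
have ab' : a <= b by lra.
have cd' : c <= d by lra.
have ac : 0 < a + c by apply: (lt_le_trans xy0); apply: lerD.
have L := char_L1V S e0 ab' cd' ac.
have [r' /andP[r1 r2] gr'] : exists2 r, d - e < r < d & good U V r by apply: (ae_good_itv S); lra.
have A1 : {ae mu, forall r, c < r < c + e -> line_energy V e a b r' <= line_energy V e a b r}.
  apply: aeS (char_goodV S) => r gr /andP[cr rc].
  by apply: (line_energy_le S yy xy0 Uxy) => //; lra.
have A2 : {ae mu, forall r, d < r < d + e -> line_energy V e a b r <= line_energy V e a b r'}.
  apply: aeS (char_goodV S) => r gr /andP[dr rd].
  by apply: (line_energy_le S yy xy0 Uxy) => //; lra.
have cde : c + e <= d + e by lra.
have B1 := ramp_mean_ge e0 (lexx c) cde L A1.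
have B2 := ramp_mean_le e0 cd' (lexx (d + e)) L A2.
rewrite (energy_fluxE S e0 ab' cd' ac); split; first by rewrite subr_ge0 (le_trans B2).
move=> /eqP; rewrite subr_eq0 => /eqP E0.
have B3 : itg c (d + e) (fun r => line_energy V e a b r * ramp' e c r) = line_energy V e a b r'.
  by apply/eqP; rewrite eq_le B1 andbT E0.
have A3 := ramp_mean_eq e0 (lexx c) cde L A1 B3.
have ce : c < c + e by rewrite ltrDl.
have [r /andP[cr rc] [gr Er]] := ae_itv_ex ce (aeI (char_goodV S) A3).
have {}Er : line_energy V e a b r = line_energy V e a b r' by apply: Er; rewrite cr.
exists r, r'; split; [by rewrite cr|by rewrite r1|].
have [ar [ar' [rr' [aer [aer' yr']]]]] : 0 < a + r /\ 0 < a + r' /\ r <= r' /\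
    0 < a + e + r /\ 0 < a + e + r' /\ r' <= y.
  by move: e0 cd dy ac r1 r2 cr rc; clear; lra.
have dich := vanishing_dichotomy S yy xy0 Uxy gr gr' (ltW (le_lt_trans yc cr)) rr' yr'.
have L1r := line_energy_integrable e0 ab' gr ar.
have L1r' := line_energy_integrable e0 ab' gr' ar'.
have V2 : {ae mu, forall s, a <= s <= b + e ->
    V s r ^+ 2 * plateau e a b s = V s r' ^+ 2 * plateau e a b s}.
  apply: (itg_eq_ae L1r L1r' _ Er).
  apply: aeS dich => s H _.
  have [sE|sx] := leP s a; first by rewrite !(plateau_eq0 e0 ab') ?mulr0//; left.
  have [sE|sx'] := leP (b + e) s; first by rewrite !(plateau_eq0 e0 ab') ?mulr0//; right.
  have /H [H1 H2] : x0 < s < x by rewrite (le_lt_trans xa sx) (lt_le_trans sx' bx).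
  rewrite ler_wpM2r//; first by have /andP[] := plateau_itv s e0 ab'.
  case: H2 => [H2|->//]; rewrite -[leRHS]sqrrN -[leLHS]sqrrN ler_sqr ?nnegrE ?lerN2//.
    by rewrite oppr_ge0.
  by rewrite oppr_ge0 (le_trans H1).
have [Lr _ Ur] := gr _ _ ab aer; have [Lr' _ Ur'] := gr' _ _ ab aer'.
suff E : itg (a + e) b (fun s => V s r) = itg (a + e) b (fun s => V s r').
  by move: E; rewrite -Ur -Ur' /rect_inc; clear; lra.
apply: itg_ae => //; apply: aeS (aeI dich V2) => s [H1 H2] sab.
have /andP[as_ sb] := sab.
have /H1 [H3 H4] : x0 < s < x.
  by apply/andP; split; move: xa e0 bx as_ sb; clear; lra.
have /H2 : a <= s <= b + e.
  by apply/andP; split; move: e0 as_ sb; clear; lra.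
rewrite !plateau_eq1// !mulr1 => /eqP; case: H4 => // H4.
rewrite eqf_sqr => /orP[/eqP//|/eqP E]; apply/eqP; rewrite eq_le H3/=.
by move: E H3 H4; clear; lra.
Qed.


(* In a rectangle below a zero of U, V(s, .) is either constant or increasing and
   nonpositive, so V^2 decreases in eta; likewise P^2 decreases in xi.  The
   conservation law then forces both to be constant. *)
Lemma vanishing U V P x0 x y0 y : char_solution U V P ->
  x0 <= x -> y0 <= y -> 0 < x0 + y0 -> U x y = 0 -> rect_inc U x0 x y0 y = 0.
Proof.
move=> S; rewrite le_eqVlt => /predU1P[->|xx]; first by rewrite /rect_inc; lra.
rewrite le_eqVlt => /predU1P[->|yy]; first by rewrite /rect_inc; lra.
move=> xy0 Uxy; apply/eqP; rewrite eq_le (char_inc S (ltW xx) (ltW yy) xy0) andbT.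
apply/ler_addgt0Pr => k k0; rewrite add0r.
have k4 : 0 < k / 4 by rewrite divr_gt0.
have pos s r : x0 <= s -> y0 <= r -> 0 <= s + r.
  by move=> h1 h2; apply/ltW/(lt_le_trans xy0)/lerD.
have [d1 d10 H1] := char_cont S (pos x y (ltW xx) (ltW yy)) k4.
have [d2 d20 H2] := char_cont S (pos x0 y (lexx _) (ltW yy)) k4.
have [d3 d30 H3] := char_cont S (pos x y0 (ltW xx) (lexx _)) k4.
have [d4 d40 H4] := char_cont S (pos x0 y0 (lexx _) (lexx _)) k4.
(* The corners will be moved by at most 2 e, each at a cost of at most k / 4 in U; the last two
   conditions make room for the transition zones. *)
have [e [e0 [e1 [e2 [e3 [e4 [e5 e6]]]]]]] : exists e, 0 < e /\ 4 * e <= d1 /\ 4 * e <= d2 /\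
    4 * e <= d3 /\ 4 * e <= d4 /\ 4 * e <= x - x0 /\ 4 * e <= y - y0.
  pose m := Num.min (Num.min (Num.min d1 d2) (Num.min d3 d4)) (Num.min (x - x0) (y - y0)).
  exists (m / 4); have -> : 4 * (m / 4) = m by field.
  by rewrite divr_gt0 ?lt_min ?d10 ?d20 ?d30 ?d40 ?subr_gt0 ?xx ?yy// /m !ge_min !lexx !orbT.
have F1 : 0 <= energy_flux V e x0 (x - e) y0 (y - e) /\
    (energy_flux V e x0 (x - e) y0 (y - e) = 0 ->
     exists r r', [/\ y0 < r < y0 + e, y - e - e < r' < y - e & rect_inc U (x0 + e) (x - e) r r' = 0]).
  by apply: (energy_flux_vanishing S xx yy xy0 Uxy e0); move: e0 e5 e6; clear; lra.
have yx0 : 0 < y0 + x0 by rewrite addrC.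
have F2 : 0 <= energy_flux (swap P) e y0 (y - e) x0 (x - e).
  by apply: (energy_flux_vanishing (char_solution_swap S) yy xx yx0 Uxy e0 _ _ _ _ _ _).1;
    move: e0 e5 e6; clear; lra.
have F3 : energy_flux V e x0 (x - e) y0 (y - e) + energy_flux (swap P) e y0 (y - e) x0 (x - e) = 0.
  by apply: (char_energy S) => //; move: e0 e5 e6; clear; lra.
have [|r [r' [/andP[r1 r2] /andP[r3 r4] E]]] := F1.2.
  apply/eqP; rewrite eq_le F1.1 andbT -F3 lerDl; exact: F2.
have G1 : `|U (x - e) r' - U x y| <= k / 4 
  by apply: H1; rewrite ?pos// ?ler_norml; move: e0 e1 e2 e3 e4 e5 e6 r1 r2 r3 r4; clear; lra.
have G2 : `|U (x0 + e) r' - U x0 y| <= k / 4 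
  by apply: H2; rewrite ?pos// ?ler_norml; move: e0 e1 e2 e3 e4 e5 e6 r1 r2 r3 r4; clear; lra.
have G3 : `|U (x - e) r - U x y0| <= k / 4 
  by apply: H3; rewrite ?pos// ?ler_norml; move: e0 e1 e2 e3 e4 e5 e6 r1 r2 r3 r4; clear; lra.
have G4 : `|U (x0 + e) r - U x0 y0| <= k / 4 
  by apply: H4; rewrite ?pos// ?ler_norml; move: e0 e1 e2 e3 e4 e5 e6 r1 r2 r3 r4; clear; lra.
move: E G1 G2 G3 G4; rewrite /rect_inc !ler_norml.
by clear; move=> E /andP[a1 a2] /andP[b1 b2] /andP[c1 c2] /andP[f1 f2]; lra.
Qed.

End characteristic_solutions.

(** * Conservation of the energy on characteristics *)

Section collision.
Variable R : realType.
Local Notation mu := (@lebesgue_measure R).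
Implicit Types (U V P : R -> R -> R) (a b c d e h k r s t x y z : R).

(** Almost every line is good, so a frame can be fitted around any bounded part of the open
    half-plane. On its sides V or P is square integrable, which makes F and K below absolutely
    continuous. *)
Record frame U V P x0 x1 y0 y1 : Prop := Frame {
  frame_sol : char_solution U V P;
  frame_x : x0 < x1;
  frame_y : y0 < y1;
  frame_pos : 0 < x0 + y0;
  frame_y0 : good U V y0;
  frame_y1 : good U V y1;
  frame_x0 : good (swap U) (swap P) x0;
  frame_x1 : good (swap U) (swap P) x1 }.

Lemma frame_swap U V P x0 x1 y0 y1 : frame U V P x0 x1 y0 y1 ->
  frame (swap U) (swap P) (swap V) y0 y1 x0 x1.
Proof.
case=> S xx yy xy g0 g1 h0 h1; constructor => //.
  exact: char_solution_swap.
by rewrite addrC.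
Qed.

Lemma rect_inc_swap U a b c d : rect_inc (swap U) c d a b = rect_inc U a b c d.
Proof. by rewrite /rect_inc /swap; ring. Qed.

Section frame_facts.
Variables (U V P : R -> R -> R) (x0 x1 y0 y1 : R).
Hypothesis W : frame U V P x0 x1 y0 y1.
Local Notation F x := (rect_inc U x0 x y0 y1).
Local Notation K y := (rect_inc U x0 x1 y0 y).
Local Notation M := (rect_inc U x0 x1 y0 y1).

Lemma frame_itg x x' : x0 <= x -> x <= x' -> x' <= x1 ->
  L1 x x' (fun s => V s y0) /\ L1 x x' (fun s => V s y1) /\
  F x' - F x = itg x x' (fun s => V s y1 - V s y0).
Proof.
move=> xx xx' xx1; have xy := frame_pos W.
have xy0 : 0 < x + y0 by rewrite (lt_le_trans xy)// lerD2r.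
have xy1 : 0 < x + y1 by rewrite (lt_le_trans xy0)// lerD2l ltW// (frame_y W).
have [L0 _ E0] := frame_y0 W xx' xy0; have [L1 _ E1] := frame_y1 W xx' xy1.
by split => //; split => //; rewrite itgB// -E0 -E1 /rect_inc; ring.
Qed.

Lemma frame_F_le x x' : x0 <= x -> x <= x' -> x' <= x1 -> F x <= F x'.
Proof.
move=> xx xx' xx1; have := char_inc (frame_sol W) xx' (ltW (frame_y W)).
have -> : rect_inc U x x' y0 y1 = F x' - F x by rewrite /rect_inc; ring.
by rewrite subr_ge0; apply; rewrite (lt_le_trans (frame_pos W))// lerD2r.
Qed.

(* F + K - M is the increment minus that of the opposite rectangle [x, x1] x [y, y1].
   If the former is positive, then by [vanishing] U has no zero in the opposite
   rectangle, whose increment is then 0.  So inside the frame the jumps of V and P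
   take place on the curve F + K = M. *)
Lemma frame_increment x y : x0 <= x <= x1 -> y0 <= y <= y1 ->
  rect_inc U x0 x y0 y = Num.max 0 (F x + K y - M).
Proof.
move=> /andP[xx0 xx1] /andP[yy0 yy1]; have S := frame_sol W; have xy := frame_pos W.
have pos s r : x0 <= s -> y0 <= r -> 0 < s + r.
  by move=> h1 h2; apply/(lt_le_trans xy)/lerD.
have E : F x + K y - M = rect_inc U x0 x y0 y - rect_inc U x x1 y y1.
  by rewrite /rect_inc; ring.
have D1 : 0 <= rect_inc U x x1 y y1 by apply: (char_inc S) => //; exact: pos.
have D0 : 0 <= rect_inc U x0 x y0 y by apply: (char_inc S).
have [N0|N0] := eqVneq (rect_inc U x0 x y0 y) 0.
  by rewrite N0 max_l// E N0 sub0r oppr_le0.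
have D2 : rect_inc U x x1 y y1 = 0.
  apply: (char_free S) => //; first exact: pos.
  move=> s r /andP[s1 s2] /andP[r1 r2].
  have s0 := le_trans xx0 s1; have r0 := le_trans yy0 r1.
  rewrite lt_neqAle (char_ge0 S) ?andbT; last by apply/ltW/pos.
  apply/eqP => /esym Usr; move/eqP: N0; apply.
  have V0 := vanishing S s0 r0 xy Usr.
  have A1 : 0 <= rect_inc U x0 x y r by apply: (char_inc S) => //; exact: pos.
  have A2 : 0 <= rect_inc U x s y0 r by apply: (char_inc S) => //; exact: pos.
  move: V0 A1 A2 D0; rewrite /rect_inc; lra.
by rewrite E D2 subr0 max_r.
Qed.

(** By [frame_increment], U(t, r) is U(t, y0) plus a constant plus the positive part of F(t) + K(r)
    - M. If the last expression is nonpositive at s, it is so to the left of s and the positive part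
    vanishes there; if it is positive at s, it is so on a left neighbourhood by continuity, and the
    derivative of F turns V(s, y0) into V(s, y1). *)
Lemma velocity_after_before r : good U V r -> y0 < r < y1 ->
  {ae mu, forall s, x0 < s < x1 ->
    V s r = if M < F s + K r then V s y1 else V s y0}.
Proof.
move=> gr /andP[yr ry]; have xy := frame_pos W.
have xr : 0 < x0 + r by rewrite (lt_trans xy)// ltrD2l.
have xy1 : 0 < x0 + y1 by rewrite (lt_trans xr)// ltrD2l.
have := aeI (good_dlim x1 gr xr) (aeI (good_dlim x1 (frame_y0 W) xy) (good_dlim x1 (frame_y1 W) xy1)).
apply: aeS => s [H [H0 H1]] sx; have := H sx; have := H0 sx; have := H1 sx.
move=> {H H0 H1} D1 D0 D; have /andP[xs sx1] := sx.
have yr1 : y0 <= r <= y1 by rewrite !ltW.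
have UE t : x0 <= t <= x1 -> U t r = U t y0 + U x0 r - U x0 y0 + Num.max 0 (F t + K r - M).
  by move=> tx; rewrite -frame_increment// /rect_inc; ring.
have xs1 : x0 <= s <= x1 by rewrite !ltW.
have d0 : 0 < s - x0 by rewrite subr_gt0.
case: ifPn => [FK|]; last first.
  rewrite -leNgt => FK.
  have E t : s - (s - x0) <= t <= s -> U s r - U t r = U s y0 - U t y0.
    rewrite opprB addrC subrK => /andP[t1 t2].
    have tx : x0 <= t <= x1 by rewrite t1 (le_trans t2 (ltW sx1)).
    have Ft := frame_F_le t1 t2 (ltW sx1).
    rewrite (UE s xs1) (UE t tx).
    have -> : Num.max 0 (F s + K r - M) = 0 by rewrite max_l// subr_le0.
    have -> : Num.max 0 (F t + K r - M) = 0.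
      by rewrite max_l// subr_le0 (le_trans _ FK)// lerD2r.
    by ring.
  apply/eqP; rewrite eq_le; apply/andP; split.
    by apply: (dlim_le_left D D0 d0) => t /E ->.
  by apply: (dlim_le_left D0 D d0) => t /E ->.
have [L0 [L1' _]] := frame_itg (lexx x0) (ltW (frame_x W)) (lexx x1).
have Ln := L1B L1' L0.
have e0 : 0 < (F s + K r - M) / 2 by rewrite divr_gt0// subr_gt0.
have [h h0 Hh] := itg_small Ln e0.
have [d [dd0 ds dh]] := ex_min2 d0 h0.
have E t : s - d <= t <= s -> U s r - U t r = U s y1 - U t y1.
  move=> /andP[t1 t2].
  have [t3 t4] : x0 <= t /\ s - t <= h.
    by move: t1 ds dh; lra.
  have tx : x0 <= t <= x1 by rewrite t3 (le_trans t2 (ltW sx1)).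
  have [Lt0 [Lt1 FE]] := frame_itg t3 t2 (ltW sx1).
  have Ft : F s - F t <= (F s + K r - M) / 2.
    rewrite FE; apply: (le_trans (ler_norm _)); apply: (le_trans (itg_norm (L1B Lt1 Lt0))).
    exact: (Hh t s t3 t2 (ltW sx1) t4).
  rewrite (UE s xs1) (UE t tx).
  have -> : Num.max 0 (F s + K r - M) = F s + K r - M by rewrite max_r// subr_ge0 ltW.
  have -> : Num.max 0 (F t + K r - M) = F t + K r - M.
    by rewrite max_r//; move: Ft FK; generalize (F t) (F s) (K r) M; move=> ? ? ? ?; lra.
  by rewrite /rect_inc; ring.
apply/eqP; rewrite eq_le; apply/andP; split.
  by apply: (dlim_le_left D D1 dd0) => t /E ->.
by apply: (dlim_le_left D1 D dd0) => t /E ->.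
Qed.


Definition energy_jump y0 y1 (V : R -> R -> R) s := V s y1 ^+ 2 - V s y0 ^+ 2.

Lemma frame_L1 y : y0 <= y -> good U V y -> L1 x0 x1 (fun s => V s y) /\ L1 x0 x1 (fun s => V s y ^+ 2).
Proof.
move=> yy gy; have xy : 0 < x0 + y by rewrite (lt_le_trans (frame_pos W))// lerD2l.
by have [L0 L2 _] := gy _ _ (ltW (frame_x W)) xy.
Qed.

Lemma energy_jump_L1 : L1 x0 x1 (energy_jump y0 y1 V).
Proof.
have [_ L0] := frame_L1 (lexx y0) (frame_y0 W).
have [_ L1'] := frame_L1 (ltW (frame_y W)) (frame_y1 W).
exact: L1B.
Qed.

Lemma energy_jump_L1S a b : x0 <= a -> b <= x1 -> L1 a b (energy_jump y0 y1 V).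
Proof. by move=> xa bx; apply: L1S energy_jump_L1. Qed.

End frame_facts.

Lemma frame_K_small U V P x0 x1 y0 y1 : frame U V P x0 x1 y0 y1 ->
  forall k, 0 < k -> exists2 h, 0 < h & forall y y', y0 <= y -> y <= y' -> y' <= y1 ->
    y' - y <= h -> rect_inc U x0 x1 y0 y' - rect_inc U x0 x1 y0 y <= k.
Proof.
move=> W k k0; have W' := frame_swap W.
have [L0 [L1' _]] := frame_itg W' (lexx y0) (ltW (frame_y W)) (lexx y1).
have [h h0 H] := itg_small (L1B L1' L0) k0.
exists h => // y y' yy yy' y1' yh.
have [M0 [M1 E]] := frame_itg W' yy yy' y1'.
rewrite -!(rect_inc_swap U x0 x1 y0) E; apply: (le_trans (ler_norm _)).
apply: (le_trans (itg_norm (L1B M1 M0))); exact: H.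
Qed.

Lemma line_energy_after U V P x0 x1 y0 y1 x x' e r : frame U V P x0 x1 y0 y1 ->
  good U V r -> y0 < r < y1 -> x0 < x -> x <= x' -> 0 < e -> x' + e <= x1 ->
  (forall s, x < s -> s <= x1 -> rect_inc U x0 x1 y0 y1 < rect_inc U x0 s y0 y1 + rect_inc U x0 x1 y0 r) ->
  line_energy V e x x' r = line_energy V e x x' y1.
Proof.
move=> W gr yr xx xx' e0 xe1 HM.
have /andP[yr0 yr1] := yr.
have [_ Lr] := frame_L1 W (ltW yr0) gr.
have [_ L1'] := frame_L1 W (ltW (frame_y W)) (frame_y1 W).
apply: itg_ae.
- by apply: L1_Mplateau => //; apply: L1S Lr => //; exact: ltW.
- by apply: L1_Mplateau => //; apply: L1S L1' => //; exact: ltW.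
apply: aeS (velocity_after_before W gr yr) => s H /andP[xs sx].
have [sE|xs'] := leP s x; first by rewrite !(plateau_eq0 e0 xx') ?mulr0//; left.
have [sE|sx'] := leP (x' + e) s; first by rewrite !(plateau_eq0 e0 xx') ?mulr0//; right.
have sx1 := lt_le_trans sx' xe1.
rewrite H; last by rewrite (lt_trans xx xs') sx1.
by rewrite HM// ltW.
Qed.

(** Up to z the jump has not yet occurred on the line r. Between z and x' + e it may or may not have
    occurred; either way the energy density is off by at most the energy jump. *)
Lemma line_energy_before U V P x0 x1 y0 y1 x x' z e r : frame U V P x0 x1 y0 y1 ->
  good U V r -> y0 < r < y1 -> x0 < x -> x <= z -> z <= x' -> 0 < e -> x' + e <= x1 ->
  (forall s, x <= s -> s <= z -> rect_inc U x0 s y0 y1 + rect_inc U x0 x1 y0 r <= rect_inc U x0 x1 y0 y1) ->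
  `|line_energy V e x x' r - line_energy V e x x' y0| <=
  itg z (x' + e) (fun s => `|energy_jump y0 y1 V s|).
Proof.
move=> W gr yr xx xz zx' e0 xe1 HM.
have /andP[yr0 yr1] := yr.
have xx' := le_trans xz zx'.
have [_ Lr] := frame_L1 W (ltW yr0) gr.
have [_ L0] := frame_L1 W (lexx y0) (frame_y0 W).
have xe : x' <= x' + e by rewrite lerDl ltW.
have Lr' : L1 x (x' + e) (fun s => V s r ^+ 2 * plateau e x x' s).
  by apply: L1_Mplateau => //; apply: L1S Lr => //; exact: ltW.
have L0' : L1 x (x' + e) (fun s => V s y0 ^+ 2 * plateau e x x' s).
  by apply: L1_Mplateau => //; apply: L1S L0 => //; exact: ltW.
have Lj := energy_jump_L1S W (le_trans (ltW xx) xz) xe1.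
rewrite /line_energy -itgB// (itg_cat xz (le_trans zx' xe) (L1B Lr' L0')).
have LB := L1B Lr' L0'.
have xx0 := ltW xx.
have -> : itg x z (fun s => V s r ^+ 2 * plateau e x x' s - V s y0 ^+ 2 * plateau e x x' s) = 0.
  rewrite -(itg0 x z); apply: itg_ae; [|exact: L1_cst|].
    by apply: L1S LB => //; exact: le_trans xe.
  apply: aeS (velocity_after_before W gr yr) => s H /andP[xs sz].
  have sx : s <= x' by exact: le_trans zx'.
  rewrite H; last by rewrite (lt_le_trans xx xs) (le_lt_trans sx)// (lt_le_trans _ xe1)// ltrDl.
  by rewrite ltNge (HM s xs sz) subrr.
rewrite add0r; have LBz : L1 z (x' + e) (fun s => V s r ^+ 2 * plateau e x x' s - V s y0 ^+ 2 * plateau e x x' s).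
  by apply: L1S LB.
apply: (le_trans (itg_norm LBz)); apply: le_itg_ae; [exact: L1_norm|exact: L1_norm|].
apply: aeS (velocity_after_before W gr yr) => s H /andP[zs sx].
have [sE|sx'] := leP (x' + e) s.
  by rewrite !(plateau_eq0 e0 xx') ?mulr0 ?subrr ?normr0//; right.
rewrite H; last by rewrite (lt_le_trans (lt_le_trans xx xz) zs) (lt_le_trans sx' xe1).
have /andP[p0 p1] := plateau_itv s e0 xx'.
case: ifP => _; last by rewrite subrr normr0.
by rewrite -mulrBl normrM ler_piMr// ger0_norm.
Qed.

(* On the rectangle between two points of the curve F + K = M the energy flux only
   sees V before the jump at the bottom and V after the jump at the top. *)
Lemma flux_limit U V P x0 x1 y0 y1 x x' y' y (k : R) : frame U V P x0 x1 y0 y1 ->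
  x0 < x -> x < x' -> x' < x1 -> y0 < y' -> y' < y -> y < y1 ->
  (forall s, x < s -> s <= x1 -> rect_inc U x0 x1 y0 y1 < rect_inc U x0 s y0 y1 + rect_inc U x0 x1 y0 y) ->
  (forall s, x <= s -> s < x' -> rect_inc U x0 s y0 y1 + rect_inc U x0 x1 y0 y' < rect_inc U x0 x1 y0 y1) ->
  0 < k -> exists2 h, 0 < h & forall e, 0 < e -> e <= h ->
    `|energy_flux V e x x' y' y + itg x x' (energy_jump y0 y1 V)| <= k.
Proof.
move=> W xx xx' xx1 yy yy' yy1 Hafter Hbefore k0.
have k4 : 0 < k / 4 by rewrite divr_gt0.
have [h1 h10 H1] := itg_small (energy_jump_L1 W) k4.
have h12 : 0 < h1 / 2 by rewrite divr_gt0.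
have xx0 : 0 < x' - x by rewrite subr_gt0.
(* The point z is close enough to x' for the energy jump over [z, x' + e] to be small, yet strictly
   before x': the margin [gap] at z lets K grow over [y', y' + e] without reaching the curve. *)
have [z [xz zx' zh]] : exists z, [/\ x <= z, z < x' & x' - z <= h1 / 2].
  have [d [d0 d1 d2]] := ex_min2 h12 xx0.
  by exists (x' - d); split; [move: d2; clear; lra|rewrite gtrBl|rewrite opprB addrC subrK].
have gap : 0 < rect_inc U x0 x1 y0 y1 - rect_inc U x0 z y0 y1 - rect_inc U x0 x1 y0 y'.
  by have := Hbefore z xz zx'; clear; lra.
have [h2 h20 H2] := frame_K_small W gap.
have a1 : 0 < x1 - x' by rewrite subr_gt0.
have a2 : 0 < y1 - y by rewrite subr_gt0.
have a3 : 0 < y - y' by rewrite subr_gt0.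
have [g1 [g10 g11 g12]] := ex_min2 h12 h20.
have [g2 [g20 g21 g22]] := ex_min2 a1 a2.
have [g3 [g30 g31 g32]] := ex_min2 a3 xx0.
have [g4 [g40 g41 g42]] := ex_min2 g10 g20.
have [h [h0 hh1 hh2]] := ex_min2 g40 g30.
exists h => // e e0 eh.
have [e1 [e2 [e3 [e4 [e5 e6]]]]] : e <= h1 / 2 /\ e <= h2 /\ x' + e <= x1 /\ y + e <= y1 /\
    y' + e <= y /\ x + e <= x'.
  by move: eh hh1 hh2 g41 g42 g31 g32 g21 g22 g11 g12; clear; lra.
have xpos : 0 < x + y' by apply: (lt_trans (frame_pos W)); apply: ltrD.
rewrite (energy_fluxE (frame_sol W) e0 (ltW xx') (ltW yy') xpos).
have LE := char_L1V (frame_sol W) e0 (ltW xx') (ltW yy') xpos.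
set C := line_energy V e x x' y0; set C1 := line_energy V e x x' y1.
pose dlt := itg z (x' + e) (fun s => `|energy_jump y0 y1 V s|).
have dk : dlt <= k / 4.
  by apply: H1 => //; move: xx xz zx' zh e0 e1; clear; lra.
have yye : y' <= y by exact: ltW.
have Ay : {ae mu, forall r, y < r < y + e -> line_energy V e x x' r = C1}.
  apply: aeS (char_goodV (frame_sol W)) => r gr /andP[r1 r2].
  have yr1 : y0 < r < y1 by rewrite (lt_trans (lt_trans yy yy') r1) (lt_le_trans r2 e4).
  apply: (line_energy_after W gr yr1 xx (ltW xx') e0 e3) => s xs sx1.
  apply: (lt_le_trans (Hafter s xs sx1)); rewrite lerD2l.
  rewrite -!(rect_inc_swap U x0 x1 y0); apply: (frame_F_le (frame_swap W)).
  - by rewrite ltW// (lt_trans yy).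
  - exact: ltW.
  - by have /andP[_ /ltW] := yr1.
have Ay' : {ae mu, forall r, y' < r < y' + e -> `|line_energy V e x x' r - C| <= dlt}.
  apply: aeS (char_goodV (frame_sol W)) => r gr /andP[r1 r2].
  have yr1 : y0 < r < y1.
    by rewrite (lt_trans yy r1) (lt_le_trans r2)// (le_trans e5)// ltW.
  apply: (line_energy_before W gr yr1 xx xz (ltW zx') e0 e3) => s xs sz.
  have Fs : rect_inc U x0 s y0 y1 <= rect_inc U x0 z y0 y1.
    apply: (frame_F_le W) => //; first by rewrite (le_trans (ltW xx)).
    by rewrite ltW// (lt_trans zx').
  have Kr : rect_inc U x0 x1 y0 r - rect_inc U x0 x1 y0 y' <=
      rect_inc U x0 x1 y0 y1 - rect_inc U x0 z y0 y1 - rect_inc U x0 x1 y0 y'.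
    apply: H2; [exact: ltW|exact: ltW|by have /andP[_ /ltW] := yr1|].
    by move: r2 e2; clear; lra.
  move: Fs Kr.
  generalize (rect_inc U x0 s y0 y1) (rect_inc U x0 z y0 y1) (rect_inc U x0 x1 y0 r)
    (rect_inc U x0 x1 y0 y1) (rect_inc U x0 x1 y0 y'); clear=> *; lra.
have yeye : y' + e <= y + e by rewrite lerD2r ltW.
have m1 : itg y' (y + e) (fun r => line_energy V e x x' r * ramp' e y r) = C1.
  apply/eqP; rewrite eq_le; apply/andP; split.
    by apply: (ramp_mean_le e0 yye (lexx _) LE); apply: aeS Ay => r H /H ->.
  by apply: (ramp_mean_ge e0 yye (lexx _) LE); apply: aeS Ay => r H /H ->.
have m2 : itg y' (y + e) (fun r => line_energy V e x x' r * ramp' e y' r) <= C + dlt.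
  apply: (ramp_mean_le e0 (lexx y') yeye LE); apply: aeS Ay' => r H /H.
  by rewrite ler_norml => /andP[_]; rewrite lerBlDl.
have m3 : C - dlt <= itg y' (y + e) (fun r => line_energy V e x x' r * ramp' e y' r).
  apply: (ramp_mean_ge e0 (lexx y') yeye LE); apply: aeS Ay' => r H /H.
  by rewrite ler_norml => /andP[+ _]; rewrite lerBrDl.
have [_ L0] := frame_L1 W (lexx y0) (frame_y0 W).
have [_ L1'] := frame_L1 W (ltW (frame_y W)) (frame_y1 W).
have m4 : C1 - C = itg x (x' + e) (fun s => energy_jump y0 y1 V s * plateau e x x' s).
  rewrite /C /C1 /line_energy -itgB.
  - by apply: eq_itg => s _; rewrite /energy_jump mulrBl.
  - by apply: L1_Mplateau => //; [exact: ltW|apply: L1S L1' => //; exact: ltW].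
  - by apply: L1_Mplateau => //; [exact: ltW|apply: L1S L0 => //; exact: ltW].
have m5 := plateau_itg_close e0 e6 (energy_jump_L1S W (ltW xx) e3).
have m6 : itg x (x + e) (fun s => `|energy_jump y0 y1 V s|) <= k / 4.
  by apply: H1; move: xx e0 e1 e6 xx1; clear; lra.
have m7 : itg x' (x' + e) (fun s => `|energy_jump y0 y1 V s|) <= k / 4.
  by apply: H1; move: xx xx' e0 e1 e3; clear; lra.
have arith (m c c1 j i1 i2 d : R) : m <= c + d -> c - d <= m -> `|c1 - c - j| <= i1 + i2 ->
    i1 <= k / 4 -> i2 <= k / 4 -> d <= k / 4 -> `|m - c1 + j| <= k.
  move: k0; clear=> A0 A1 A2; rewrite !ler_norml => /andP[A3 A4] A5 A6 A7.
  by apply/andP; split; lra.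
by rewrite m1; apply: (arith _ _ _ _ _ _ _ m2 m3 _ m6 m7 dk); rewrite m4.
Qed.

(** The positive derivative gives strict inequality near x, and monotonicity carries it to the rest
    of the interval. *)
Lemma dlim_strict (F : R -> R) x0 x1 x n : {in `[x0, x1] &, {homo F : s t / s <= t}} ->
  x0 < x < x1 -> dlim F x n -> 0 < n ->
  (forall s, x < s -> s <= x1 -> F x < F s) /\ (forall s, x0 <= s -> s < x -> F s < F x).
Proof.
move=> Fm /andP[xx xx1] dF n0.
have n2 : 0 < n / 2 by rewrite divr_gt0.
have [d d0 H] := dF _ n2.
have itv u : x0 <= u -> u <= x1 -> u \in `[x0, x1] by move=> ? ?; rewrite in_itv/=; apply/andP.
split=> s xs sx.
  have sx0 : 0 < s - x by rewrite subr_gt0.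
  have [g [g0 g1 g2]] := ex_min2 d0 sx0.
  have := H (x + g); rewrite addrAC subrr add0r gtr0_norm// => /(_ g1).
  rewrite ler_norml => /andP[h1 _].
  have h2 : F (x + g) <= F s.
    by apply: Fm; [apply: itv|apply: itv|]; move: xx g0 g2 sx; clear; lra.
  have : 0 < n / 2 * g by rewrite mulr_gt0.
  by move: h1 h2; generalize (F (x + g)) (F s) (F x); clear=> *; lra.
have sx0 : 0 < x - s by rewrite subr_gt0.
have [g [g0 g1 g2]] := ex_min2 d0 sx0.
have := H (x - g); rewrite addrAC subrr add0r normrN gtr0_norm// => /(_ g1).
rewrite ler_norml => /andP[_ h1].
have h2 : F s <= F (x - g).
  by apply: Fm; [apply: itv|apply: itv|]; move: xx1 g0 g2 xs; clear; lra.
have : 0 < n / 2 * g by rewrite mulr_gt0.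
by move: h1 h2; generalize (F (x - g)) (F s) (F x); clear=> *; lra.
Qed.

Lemma frame_F_homo U V P x0 x1 y0 y1 : frame U V P x0 x1 y0 y1 ->
  {in `[x0, x1] &, {homo (fun x => rect_inc U x0 x y0 y1) : s t / s <= t}}.
Proof.
move=> W s t; rewrite !in_itv/= => /andP[xs sx] /andP[xt tx] st.
exact: (frame_F_le W).
Qed.

(* A rectangle around (x, y) has positive increment, hence meets the contact set. *)
Lemma frame_contact U V P x0 x1 y0 y1 x y : frame U V P x0 x1 y0 y1 ->
  x0 < x < x1 -> y0 < y < y1 ->
  rect_inc U x0 x y0 y1 + rect_inc U x0 x1 y0 y = rect_inc U x0 x1 y0 y1 ->
  (forall s, x < s -> s <= x1 -> rect_inc U x0 x y0 y1 < rect_inc U x0 s y0 y1) ->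
  (forall s, x0 <= s -> s < x -> rect_inc U x0 s y0 y1 < rect_inc U x0 x y0 y1) ->
  (forall r, y < r -> r <= y1 -> rect_inc U x0 x1 y0 y < rect_inc U x0 x1 y0 r) ->
  (forall r, y0 <= r -> r < y -> rect_inc U x0 x1 y0 r < rect_inc U x0 x1 y0 y) ->
  U x y = 0.
Proof.
move=> W /andP[xx xx1] /andP[yy yy1] FK Fr Fl Kr Kl.
have S := frame_sol W; have xy := frame_pos W.
have xy0 : 0 <= x + y by apply/ltW/(lt_trans xy)/ltrD.
apply/eqP; rewrite eq_le (char_ge0 S xy0) andbT leNgt; apply/negP => Upos.
have U2 : 0 < U x y / 2 by rewrite divr_gt0.
have [h h0 H] := char_cont S xy0 U2.
have [g1 [g10 g11 g12]] : exists d, [/\ 0 < d, d <= x - x0 & d <= x1 - x].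
  by apply: ex_min2; rewrite subr_gt0.
have [g2 [g20 g21 g22]] : exists d, [/\ 0 < d, d <= y - y0 & d <= y1 - y].
  by apply: ex_min2; rewrite subr_gt0.
have [g3 [g30 g31 g32]] := ex_min2 g10 g20.
have [d [d0 dh dg]] := ex_min2 h0 g30.
have [i1 [i2 [i3 i4]]] : x0 <= x - d /\ x + d <= x1 /\ y0 <= y - d /\ y + d <= y1.
  by move: g11 g12 g21 g22 g31 g32 dg; clear; lra.
have [j1 j2] : x - d < x /\ y - d < y by rewrite !gtrBl.
have [j3 j4] : x < x + d /\ y < y + d by rewrite !ltrDl.
have pos : 0 < x - d + (y - d) by apply: (lt_le_trans xy); exact: lerD.
have : rect_inc U (x - d) (x + d) (y - d) (y + d) = 0.
  apply: (char_free S) => //; [exact: ltW (lt_trans j1 j3)|exact: ltW (lt_trans j2 j4)|].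
  move=> s r /andP[s1 s2] /andP[r1 r2].
  have sr : 0 <= s + r by rewrite (le_trans (ltW pos))// lerD.
  have sx : `|s - x| <= h by rewrite ler_norml; move: s1 s2 dh; clear; lra.
  have ry : `|r - y| <= h by rewrite ler_norml; move: r1 r2 dh; clear; lra.
  have := H s r sr sx ry; rewrite ler_norml => /andP[+ _].
  by move: Upos; generalize (U x y) (U s r); clear=> *; lra.
rewrite (_ : rect_inc U (x - d) (x + d) (y - d) (y + d) =
  rect_inc U x0 (x + d) y0 (y + d) - rect_inc U x0 (x - d) y0 (y + d) -
  rect_inc U x0 (x + d) y0 (y - d) + rect_inc U x0 (x - d) y0 (y - d)); last first.
  by rewrite /rect_inc; clear; ring.
have xm : x0 <= x - d <= x1 by rewrite i1 ltW// (lt_trans j1).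
have xp : x0 <= x + d <= x1 by rewrite i2 andbT ltW// (lt_trans xx).
have ym : y0 <= y - d <= y1 by rewrite i3 ltW// (lt_trans j2).
have yp : y0 <= y + d <= y1 by rewrite i4 andbT ltW// (lt_trans yy).
(* The increment is now a mixed second difference of the positive part around the value 0. With p,
   p' > 0 the increases of F and q, q' > 0 those of K to the right and left, it equals p + q -
   max(0, q - p') - max(0, p - q'), which is positive. *)
rewrite (frame_increment W xp yp) (frame_increment W xm yp)
  (frame_increment W xp ym) (frame_increment W xm ym).
have := Fr _ j3 i2; have := Fl _ i1 j1; have := Kr _ j4 i4; have := Kl _ i3 j2.
move: FK.
generalize (rect_inc U x0 x y0 y1) (rect_inc U x0 x1 y0 y) (rect_inc U x0 x1 y0 y1)
  (rect_inc U x0 (x + d) y0 y1) (rect_inc U x0 (x - d) y0 y1)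
  (rect_inc U x0 x1 y0 (y + d)) (rect_inc U x0 x1 y0 (y - d)).
clear=> f k m fp fm kp km FK A1 A2 A3 A4.
case: (leP 0 (fp + kp - m)) => B1; case: (leP 0 (fm + kp - m)) => B2;
 case: (leP 0 (fp + km - m)) => B3; case: (leP 0 (fm + km - m)) => B4 => E; lra.
Qed.

(** A point where V jumps and where the three functions of one axis entering [collision_algebra] are
    differentiable: the mass, U along the lower side, and the primitive of the energy jump. *)
Definition regular_point U V x0 x1 y0 y1 x :=
  [/\ x0 < x < x1, 0 < V x y1 - V x y0,
      dlim (fun x => rect_inc U x0 x y0 y1) x (V x y1 - V x y0),
      dlim (fun x => U x y0) x (V x y0) &
      dlim (fun x => itg x0 x (energy_jump y0 y1 V)) x (energy_jump y0 y1 V x)].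

Lemma ae_neq (a : R) : {ae mu, forall x, x != a}.
Proof.
exists [set a]; split => //; first exact: lebesgue_measure_set1.
by move=> x /= /negP; rewrite negbK => /eqP.
Qed.

(* The curve F + K = M is parametrised by t = F, with xi = Q t.  The push-forward
   of dt is the jump of V, so whatever holds for a.e. t holds a.e. on the set of
   the s at which V jumps. *)
Lemma frame_quantile U V P x0 x1 y0 y1 : frame U V P x0 x1 y0 y1 -> exists Q : R -> R,
  {ae mu, forall t, 0 < t < rect_inc U x0 x1 y0 y1 ->
     regular_point U V x0 x1 y0 y1 (Q t) /\ rect_inc U x0 (Q t) y0 y1 = t} /\
  forall E : set (measurableTypeR R), measurable E ->
    {ae mu, forall t, 0 < t < rect_inc U x0 x1 y0 y1 -> ~ E (Q t)} ->
    {ae mu, forall x, x0 < x < x1 -> E x -> V x y1 = V x y0}.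
Proof.
move=> W; have S := frame_sol W; have xx := frame_x W; have xy := frame_pos W.
have xy1 : 0 < x0 + y1 by rewrite (lt_trans xy)// ltrD2l (frame_y W).
have [L0 [L1' _]] := frame_itg W (lexx x0) (ltW xx) (lexx x1).
have Lj := L1B L1' L0.
(* The jump of V is nonnegative only almost everywhere; its positive part satisfies the pointwise
   hypothesis of the quantile lemmas. *)
pose n s := Num.max (V s y1 - V s y0) 0.
have n0 s : x0 <= s <= x1 -> 0 <= n s by rewrite /n le_max lexx orbT.
have mn : measurable_fun `[x0, x1] n.
  by apply: measurable_maxr; [exact: L1_measurable Lj|exact: measurable_cst].
have Ln : L1 x0 x1 n.
  apply: (L1_le mn (L1_norm Lj)) => s _; rewrite /n.
  by case: (leP (V s y1 - V s y0) 0) => _ //; rewrite normr0 normr_ge0.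
have Vle : {ae mu, forall s, x0 < s < x1 -> V s y0 <= V s y1}.
  exact: (good_le_ae S x1 (frame_y0 W) (frame_y1 W) (ltW (frame_y W)) xy).
have FE x : x0 <= x <= x1 -> itg x0 x n = rect_inc U x0 x y0 y1.
  move=> /andP[x0x xx1]; have [M0 [M1 E]] := frame_itg W (lexx x0) x0x xx1.
  rewrite (_ : rect_inc U x0 x y0 y1 = rect_inc U x0 x y0 y1 - rect_inc U x0 x0 y0 y1); last first.
    by rewrite /rect_inc; clear; ring.
  rewrite E; apply: itg_ae; [by apply: L1S Ln|exact: L1B|].
  apply: aeS (aeI Vle (aeI (ae_neq x0) (ae_neq x1))) => s [H [sx0 sx1]] /andP[s1 s2].
  rewrite /n max_l// subr_ge0 H// !lt_neqAle eq_sym sx0 s1/=.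
  by rewrite sx1 (le_trans s2).
have ME : itg x0 x1 n = rect_inc U x0 x1 y0 y1 by rewrite FE// lexx ltW.
exists (quantile x0 x1 n); split.
  have H : {ae mu, forall x, x0 < x <= x1 -> n x != 0 -> regular_point U V x0 x1 y0 y1 x}.
    have := aeI (itg_dlim Lj) (aeI (good_dlim x1 (frame_y0 W) xy)
      (aeI (itg_dlim (energy_jump_L1 W)) (ae_neq x1))).
    apply: aeS => x [H1 [H2 [H3 H4]]] /andP[x0x xx1] nx.
    have xx' : x0 < x < x1 by rewrite x0x lt_neqAle H4.
    have j0 : 0 < V x y1 - V x y0.
      move: nx; rewrite /n; case: (leP (V x y1 - V x y0) 0) => //.
      by rewrite eqxx.
    split => //; [|exact: H2|exact: H3].
    have d0 : 0 < Num.min (x - x0) (x1 - x) by rewrite lt_min !subr_gt0.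
    apply: (dlim_local (c := 0) d0 _ (H1 xx')) => s.
    rewrite le_min !ler_norml => /andP[/andP[s1 _] /andP[_ s2]].
    have x0s : x0 <= s by move: s1; clear; lra.
    have sx1 : s <= x1 by move: s2; clear; lra.
    have [_ [_ E]] := frame_itg W (lexx x0) x0s sx1.
    by rewrite addr0 -E /rect_inc; clear; ring.
  apply: aeS (ae_quantile (ltW xx) Ln n0 H) => t Ht /andP[t0 tM].
  have tt : 0 < t <= itg x0 x1 n by rewrite t0 ME ltW.
  have [_ reg] := Ht tt; split => //.
  by rewrite -[RHS](quantileP (ltW xx) Ln n0 tt) FE// quantile_itv// ltW.
move=> E mE HE.
have := @quantile_ae _ _ _ _ (ltW xx) Ln n0 E mE; rewrite ME => /(_ _)/wrap[].
  apply: aeS (aeI HE (ae_neq (rect_inc U x0 x1 y0 y1))) => t [Ht tM] /andP[t0 tM'].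
  by apply: Ht; rewrite t0 lt_neqAle tM.
move=> H; apply: aeS (aeI Vle H) => x [H1 H2] xx' Ex; have /andP[x0x xx1] := xx'.
have := H2 _ Ex; rewrite x0x ltW// => /(_ isT); have := H1 xx'; rewrite /n.
by case: (leP (V x y1 - V x y0) 0); clear; lra.
Qed.

(* With r = n / k the relations give v = r p and n (n + 2 v) = - r k (k + 2 p).
   The left-hand side is also r^2 k (k + 2 p), hence k + 2 p = 0. *)
Lemma collision_algebra (F a A K b B : R -> R) (x y n v k p : R) :
  dlim F x n -> dlim a x v -> dlim A x (n * (n + 2 * v)) ->
  dlim K y k -> dlim b y p -> dlim B y (k * (k + 2 * p)) ->
  0 < n -> 0 < k ->
  (forall d, 0 < d -> exists x' y', [/\ x' != x, `|x' - x| <= d, `|y' - y| <= d &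
     [/\ F x' - F x = - (K y' - K y), a x' - a x = - (b y' - b y) &
         A x' - A x = B y' - B y]]) ->
  n * (n + 2 * v) = 0.
Proof.
move=> dF da dA dK db dB n0 k0 H.
(* The bound |n h + k t| <= e (|h| + |t|) with e <= k / 2 gives (k / 2) |t| <= (n + k / 2) |h|, that
   is |t| <= c |h|. All errors can then be measured by |h|. *)
pose c := (2 * n + k) / k; have c0 : 0 <= c by rewrite divr_ge0 ?addr_ge0 ?mulr_ge0 ?ltW.
have k2 : 0 < k / 2 by rewrite divr_gt0.
have core e (h t dKy dby dBy : R) : 0 < e -> e <= k / 2 -> h != 0 ->
    `|- dKy - n * h| <= e * `|h| -> `|- dby - v * h| <= e * `|h| ->
    `|dBy - n * (n + 2 * v) * h| <= e * `|h| -> `|dKy - k * t| <= e * `|t| ->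
    `|dby - p * t| <= e * `|t| -> `|dBy - k * (k + 2 * p) * t| <= e * `|t| ->
    exists h t, [/\ h != 0, `|n * h + k * t| <= e * (1 + c) * `|h|,
      `|v * h + p * t| <= e * (1 + c) * `|h| &
      `|n * (n + 2 * v) * h - k * (k + 2 * p) * t| <= e * (1 + c) * `|h|].
  move=> e0 ek h0 X1 X2 X3 X4 X5 X6; exists h, t.
  have tr (X Y : R) : `|X| <= e * `|h| -> `|Y| <= e * `|t| -> `|X + Y| <= e * (`|h| + `|t|).
    by move=> XX YY; apply: (le_trans (ler_normD _ _)); rewrite mulrDr lerD.
  have Z1 : `|n * h + k * t| <= e * (`|h| + `|t|).
    have := tr _ _ X1 X4; rewrite -normrN; congr (`|_| <= _); clear; ring.
  have Z2 : `|v * h + p * t| <= e * (`|h| + `|t|).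
    have := tr _ _ X2 X5; rewrite -normrN; congr (`|_| <= _); clear; ring.
  have Z3 : `|n * (n + 2 * v) * h - k * (k + 2 * p) * t| <= e * (`|h| + `|t|).
    have X6' : `|- (dBy - k * (k + 2 * p) * t)| <= e * `|t| by rewrite normrN.
    have := tr _ _ X3 X6'; rewrite -normrN; congr (`|_| <= _); clear; ring.
  have tc : `|t| <= c * `|h|.
    have T1 : k * `|t| <= n * `|h| + e * (`|h| + `|t|).
      rewrite -(gtr0_norm k0) -normrM.
      have -> : k * t = (n * h + k * t) - n * h by ring.
      apply: (le_trans (ler_normB _ _)).
      by rewrite [`|n * h|]normrM (gtr0_norm n0) addrC lerD2l.
    have T2 : e * (`|h| + `|t|) <= k / 2 * (`|h| + `|t|).
      by rewrite ler_wpM2r// addr_ge0.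
    rewrite /c mulrAC ler_pdivlMr//.
    by move: T1 T2; rewrite !mulrDr; clear; lra.
  have T3 : e * (`|h| + `|t|) <= e * (1 + c) * `|h|.
    by rewrite -mulrA ler_wpM2l ?(ltW e0)// mulrDl mul1r lerD2l.
  by split => //; exact: le_trans T3.
have ex e : 0 < e -> e <= k / 2 -> exists h t, [/\ h != 0, `|n * h + k * t| <= e * (1 + c) * `|h|,
    `|v * h + p * t| <= e * (1 + c) * `|h| &
    `|n * (n + 2 * v) * h - k * (k + 2 * p) * t| <= e * (1 + c) * `|h|].
  move=> e0 ek.
  have [d1 d10 H1] := dF _ e0; have [d2 d20 H2] := da _ e0; have [d3 d30 H3] := dA _ e0.
  have [d4 d40 H4] := dK _ e0; have [d5 d50 H5] := db _ e0; have [d6 d60 H6] := dB _ e0.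
  have [g1 [g10 g11 g12]] := ex_min2 d10 d20.
  have [g2 [g20 g21 g22]] := ex_min2 d30 d40.
  have [g3 [g30 g31 g32]] := ex_min2 d50 d60.
  have [g4 [g40 g41 g42]] := ex_min2 g10 g20.
  have [d [d0 g51 g52]] := ex_min2 g40 g30.
  have [x' [y' [xx' xd yd [EF Ea EA]]]] := H d d0.
  have X1 := H1 x' (le_trans xd (le_trans g51 (le_trans g41 g11))).
  have X2 := H2 x' (le_trans xd (le_trans g51 (le_trans g41 g12))).
  have X3 := H3 x' (le_trans xd (le_trans g51 (le_trans g42 g21))).
  have X4 := H4 y' (le_trans yd (le_trans g51 (le_trans g42 g22))).
  have X5 := H5 y' (le_trans yd (le_trans g52 g31)).
  have X6 := H6 y' (le_trans yd (le_trans g52 g32)).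
  rewrite EF in X1; rewrite Ea in X2; rewrite EA in X3.
  have h0 : x' - x != 0 by rewrite subr_eq0.
  exact: (core e _ _ _ _ _ e0 ek h0 X1 X2 X3 X4 X5 X6).
have small (X C : R) : 0 <= C -> (forall e, 0 < e -> e <= k / 2 -> `|X| <= C * e) -> X = 0.
  move=> C0 HX; apply/eqP; rewrite -normr_le0; apply/ler_addgt0Pr => e e0; rewrite add0r.
  have e1 : 0 < e / (C + 1) by rewrite divr_gt0// ltr_wpDl.
  have [g [g0 g1 g2]] := ex_min2 k2 e1.
  apply: (le_trans (HX g g0 g1)); apply: (@le_trans _ _ (C * (e / (C + 1)))).
    by rewrite ler_wpM2l.
  by rewrite mulrCA ler_piMr ?(ltW e0)// ler_pdivrMr ?ltr_wpDl// mul1r lerDl.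
have E1 : v * k - p * n = 0.
  apply: (small _ ((k + `|p|) * (1 + c))).
    by rewrite mulr_ge0 ?addr_ge0// ltW.
  move=> e e0 ek; have [h [t [h0 Z1 Z2 _]]] := ex e e0 ek.
  have h1 : 0 < `|h| by rewrite normr_gt0.
  rewrite -(ler_pM2r h1) -normrM.
  have -> : (v * k - p * n) * h = k * (v * h + p * t) - p * (n * h + k * t) by ring.
  apply: (le_trans (ler_normB _ _)); rewrite !normrM (gtr0_norm k0).
  have -> : (k + `|p|) * (1 + c) * e * `|h| = k * (e * (1 + c) * `|h|) + `|p| * (e * (1 + c) * `|h|).
    by ring.
  by apply: lerD; apply: ler_wpM2l => //; exact: ltW.
have E2 : n * (n + 2 * v) * k + k * (k + 2 * p) * n = 0.
  apply: (small _ ((k + `|k * (k + 2 * p)|) * (1 + c))).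
    by rewrite mulr_ge0 ?addr_ge0// ltW.
  move=> e e0 ek; have [h [t [h0 Z1 _ Z3]]] := ex e e0 ek.
  have h1 : 0 < `|h| by rewrite normr_gt0.
  rewrite -(ler_pM2r h1) -normrM.
  have -> : (n * (n + 2 * v) * k + k * (k + 2 * p) * n) * h =
      k * (n * (n + 2 * v) * h - k * (k + 2 * p) * t) + (k * (k + 2 * p)) * (n * h + k * t) by ring.
  apply: (le_trans (ler_normD _ _)); rewrite ![`|_ * (_ - _)|]normrM ![`|_ * (_ + k * t)|]normrM (gtr0_norm k0).
  have -> : (k + `|k * (k + 2 * p)|) * (1 + c) * e * `|h| =
      k * (e * (1 + c) * `|h|) + `|k * (k + 2 * p)| * (e * (1 + c) * `|h|) by ring.
  by apply: lerD; apply: ler_wpM2l => //; exact: ltW.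
have E3 : (k + 2 * p) * (n + k) = 0.
  have nk : n != 0 by rewrite gt_eqF.
  apply: (mulfI nk); rewrite mulr0 -[RHS]E2.
  have vk : v * k = p * n by apply/eqP; rewrite -subr_eq0 E1.
  have -> : n * (n + 2 * v) * k = n * (n * k + 2 * (v * k)) by ring.
  by rewrite vk; ring.
have E4 : k + 2 * p = 0.
  by move/eqP: E3; rewrite mulf_eq0 (gt_eqF (addr_gt0 n0 k0)) orbF => /eqP.
have kn : k != 0 by rewrite gt_eqF.
apply: (mulIf kn); rewrite mul0r.
have -> : n * (n + 2 * v) * k = n * (2 * (v * k - p * n) + n * (k + 2 * p)) by ring.
by rewrite E1 E4 !mulr0 addr0 mulr0.
Qed.

(** At both points U vanishes by [frame_contact], and so does the increment from the lower left
    corner, since F + K = M; this gives the first two identities. The third is the conservation law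
    on the rectangle with opposite corners (x, y) and (x', y'), in the limit given by [flux_limit]
    for V and, after swapping, for P. *)
Lemma frame_pair U V P x0 x1 y0 y1 x x' y y' : frame U V P x0 x1 y0 y1 ->
  regular_point U V x0 x1 y0 y1 x -> regular_point U V x0 x1 y0 y1 x' ->
  regular_point (swap U) (swap P) y0 y1 x0 x1 y -> regular_point (swap U) (swap P) y0 y1 x0 x1 y' ->
  rect_inc U x0 x y0 y1 + rect_inc U x0 x1 y0 y = rect_inc U x0 x1 y0 y1 ->
  rect_inc U x0 x' y0 y1 + rect_inc U x0 x1 y0 y' = rect_inc U x0 x1 y0 y1 ->
  x < x' -> y' < y ->
  [/\ U x y0 + U x0 y = U x0 y0, U x' y0 + U x0 y' = U x0 y0 &
      itg x x' (energy_jump y0 y1 V) + itg y' y (energy_jump x0 x1 (swap P)) = 0].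
Proof.
move=> W r1 r2 q1 q2 FK FK' xx' yy'; have W' := frame_swap W; have S := frame_sol W.
have [x01 n0 dF _ _] := r1; have [x01' n0' dF' _ _] := r2.
have [y01 k0 dK _ _] := q1; have [y01' k0' dK' _ _] := q2.
have [Fr Fl] := dlim_strict (frame_F_homo W) x01 dF n0.
have [Fr' Fl'] := dlim_strict (frame_F_homo W) x01' dF' n0'.
have [Kr Kl] := dlim_strict (frame_F_homo W') y01 dK k0.
have [Kr' Kl'] := dlim_strict (frame_F_homo W') y01' dK' k0'.
have {}Kr r : y < r -> r <= y1 -> rect_inc U x0 x1 y0 y < rect_inc U x0 x1 y0 r.
  by move=> h1 h2; rewrite -!(rect_inc_swap U x0 x1 y0); exact: Kr.
have {}Kl r : y0 <= r -> r < y -> rect_inc U x0 x1 y0 r < rect_inc U x0 x1 y0 y.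
  by move=> h1 h2; rewrite -!(rect_inc_swap U x0 x1 y0); exact: Kl.
have {}Kr' r : y' < r -> r <= y1 -> rect_inc U x0 x1 y0 y' < rect_inc U x0 x1 y0 r.
  by move=> h1 h2; rewrite -!(rect_inc_swap U x0 x1 y0); exact: Kr'.
have {}Kl' r : y0 <= r -> r < y' -> rect_inc U x0 x1 y0 r < rect_inc U x0 x1 y0 y'.
  by move=> h1 h2; rewrite -!(rect_inc_swap U x0 x1 y0); exact: Kl'.
have contact u z : x0 < u < x1 -> y0 < z < y1 -> U u z = 0 ->
    rect_inc U x0 u y0 y1 + rect_inc U x0 x1 y0 z = rect_inc U x0 x1 y0 y1 -> U u y0 + U x0 z = U x0 y0.
  move=> /andP[u0 u1] /andP[z0 z1] Uz E.
  have uu : x0 <= u <= x1 by rewrite !ltW.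
  have zz : y0 <= z <= y1 by rewrite !ltW.
  have := frame_increment W uu zz; rewrite E subrr maxxx /rect_inc Uz.
  by generalize (U u y0) (U x0 z) (U x0 y0); clear=> *; lra.
have U0 := frame_contact W x01 y01 FK Fr Fl Kr Kl.
have U0' := frame_contact W x01' y01' FK' Fr' Fl' Kr' Kl'.
split; [exact: contact|exact: contact|].
have [xx xx1] := andP x01; have [xx0' xx1'] := andP x01'.
have [yy yy1] := andP y01; have [yy0' yy1'] := andP y01'.
apply/eqP; rewrite -normr_le0; apply/ler_addgt0Pr => k kp; rewrite add0r.
have k2 : 0 < k / 2 by rewrite divr_gt0.
have A1 s : x < s -> s <= x1 -> rect_inc U x0 x1 y0 y1 < rect_inc U x0 s y0 y1 + rect_inc U x0 x1 y0 y.
  by move=> xs sx; rewrite -FK ltrD2r; exact: Fr.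
have A2 s : x <= s -> s < x' -> rect_inc U x0 s y0 y1 + rect_inc U x0 x1 y0 y' < rect_inc U x0 x1 y0 y1.
  by move=> xs sx; rewrite -FK' ltrD2r; apply: Fl' => //; exact: le_trans (ltW xx) xs.
have A3 r : y' < r -> r <= y1 -> rect_inc (swap U) y0 y1 x0 x1 <
    rect_inc (swap U) y0 r x0 x1 + rect_inc (swap U) y0 y1 x0 x'.
  move=> yr ry; rewrite (rect_inc_swap U x0 x1 y0 y1) (rect_inc_swap U x0 x1 y0 r) (rect_inc_swap U x0 x' y0 y1).
  by rewrite -FK' [ltRHS]addrC ltrD2l; exact: Kr'.
have A4 r : y' <= r -> r < y -> rect_inc (swap U) y0 r x0 x1 + rect_inc (swap U) y0 y1 x0 x <
    rect_inc (swap U) y0 y1 x0 x1.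
  move=> yr ry; rewrite (rect_inc_swap U x0 x1 y0 y1) (rect_inc_swap U x0 x1 y0 r) (rect_inc_swap U x0 x y0 y1).
  by rewrite -FK [ltLHS]addrC ltrD2l; apply: Kl => //; exact: le_trans (ltW yy0') yr.
have [h1 h10 H1] := flux_limit W xx xx' xx1' yy0' yy' yy1 A1 A2 k2.
have [h2 h20 H2] := flux_limit W' yy0' yy' yy1 xx xx' xx1' A3 A4 k2.
have xxp : 0 < x' - x by rewrite subr_gt0.
have yyp : 0 < y - y' by rewrite subr_gt0.
have [g1 [g10 g11 g12]] := ex_min2 h10 h20.
have [g2 [g20 g21 g22]] := ex_min2 xxp yyp.
have [e [e0 e1 e2]] := ex_min2 g10 g20.
have B1 := H1 e e0 (le_trans e1 g11); have B2 := H2 e e0 (le_trans e1 g12).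
have B3 : energy_flux V e x x' y' y + energy_flux (swap P) e y' y x x' = 0.
  apply: (char_energy S) => //; first by move: e2 g21; clear; lra.
    by move: e2 g22; clear; lra.
  by apply: (lt_trans (frame_pos W)); exact: ltrD.
have arith (X Y I J : R) : `|X + I| <= k / 2 -> `|Y + J| <= k / 2 -> X + Y = 0 -> `|I + J| <= k.
  clear; rewrite !ler_norml => /andP[C1 C2] /andP[C3 C4] C5; apply/andP; split; lra.
exact: arith B1 B2 B3.
Qed.

(** The curve passes through the points (Q t, Q' (M - t)), where F = t and K = M - t. For almost
    every t both coordinates are regular, and nearby regular parameters supply the increments for
    [collision_algebra]. Points that Q misses are harmless, because V does not jump there. *)
Lemma frame_energy U V P x0 x1 y0 y1 : frame U V P x0 x1 y0 y1 ->
  {ae mu, forall s, x0 < s < x1 -> V s y1 ^+ 2 = V s y0 ^+ 2}.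
Proof.
move=> W; have W' := frame_swap W.
have [Q [HQ HQE]] := frame_quantile W; have [Q' [HQ' _]] := frame_quantile W'.
rewrite (rect_inc_swap U x0 x1 y0 y1) in HQ'.
set M := rect_inc U x0 x1 y0 y1 in HQ HQE HQ'.
pose reg t := 0 < t < M -> [/\ regular_point U V x0 x1 y0 y1 (Q t), rect_inc U x0 (Q t) y0 y1 = t,
  regular_point (swap U) (swap P) y0 y1 x0 x1 (Q' (M - t)) & rect_inc U x0 x1 y0 (Q' (M - t)) = M - t].
have aereg : {ae mu, forall t, reg t}.
  have := ae_affine (- M) ltr01 (ae_opp HQ').
  move=> /(aeI HQ); apply: aeS => t [H1 H2] tM.
  have [R1 E1] := H1 tM; have := H2; rewrite mul1r opprB => /(_ _)/wrap[].
    by move: tM => /andP[t0 tM]; rewrite subr_gt0 tM/= gtrBl.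
  by rewrite (rect_inc_swap U x0 x1 y0) => -[R2 E2].
have jump0 t : 0 < t < M -> reg t -> energy_jump y0 y1 V (Q t) = 0.
  move=> tM rt; have [R1 E1 R2 E2] := rt tM; have [t0 tM'] := andP tM.
  set x := Q t in R1 E1 *; set y := Q' (M - t) in R2 E2.
  have [x01 n0 dF da dA] := R1; have [y01 k0 dK db dB] := R2.
  have jE (a b : R) : b ^+ 2 - a ^+ 2 = (b - a) * ((b - a) + 2 * a) by ring.
  rewrite /energy_jump jE in dA *; rewrite {2}/energy_jump jE in dB.
  apply: (collision_algebra dF da dA dK db dB n0 k0) => d d0.
  have [Fr Fl] := dlim_strict (frame_F_homo W) x01 dF n0.
  have [Kr Kl] := dlim_strict (frame_F_homo W') y01 dK k0.
  have [x0x xx1] := andP x01; have [y0y yy1] := andP y01.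
  have d1 : 0 < x1 - x by rewrite subr_gt0.
  have d2 : 0 < y - y0 by rewrite subr_gt0.
  have [d3 [d30 d31 d32]] := ex_min2 d1 d2.
  have [g [g0 gd g3]] := ex_min2 d0 d30.
  have xg : x + g <= x1 by move: d31 g3; clear; lra.
  have yg : y0 <= y - g by move: d32 g3; clear; lra.
  (* By strict monotonicity at regular points, F(x + g) > t and K(y - g) < M - t. Any t' > t close
     to t therefore has its point of the curve within g of (x, y), and almost every such t' is
     regular. *)
  have F1 : t < rect_inc U x0 (x + g) y0 y1 by rewrite -{1}E1; apply: Fr => //; rewrite ltrDl.
  have K1 : rect_inc U x0 x1 y0 (y - g) < M - t.
    rewrite -E2 -!(rect_inc_swap U x0 x1 y0); apply: Kl => //; by rewrite gtrBl.
  have b1 : 0 < rect_inc U x0 (x + g) y0 y1 - t by rewrite subr_gt0.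
  have b2 : 0 < M - t - rect_inc U x0 x1 y0 (y - g) by rewrite subr_gt0.
  have b3 : 0 < M - t by rewrite subr_gt0.
  have [c1 [c10 c11 c12]] := ex_min2 b1 b2.
  have [c2 [c20 c21 c22]] := ex_min2 c10 b3.
  have tc : t < t + c2 by rewrite ltrDl.
  have [t' /andP[tt' t'c] rt'] := ae_itv_ex tc aereg.
  have t'M : 0 < t' < M by rewrite (lt_trans t0 tt')/=; move: t'c c22; clear; lra.
  have [R1' E1' R2' E2'] := rt' t'M.
  set x' := Q t' in R1' E1'; set y' := Q' (M - t') in R2' E2'.
  have [x01' _ _ _ _] := R1'; have [y01' _ _ _ _] := R2'.
  have [x0x' x'x1] := andP x01'; have [y0y' y'y1] := andP y01'.
  have xx' : x < x'.
    rewrite ltNge; apply/negP => x'x.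
    by have := frame_F_le W (ltW x0x') x'x (ltW xx1); rewrite E1 E1' leNgt tt'.
  have y'y : y' < y.
    rewrite ltNge; apply/negP => yy'.
    have := frame_F_le W' (ltW y0y) yy' (ltW y'y1).
    by rewrite !(rect_inc_swap U x0 x1 y0) E2 E2' lerD2l lerN2 leNgt tt'.
  have x'g : x' <= x + g.
    rewrite leNgt; apply/negP => H.
    have := frame_F_le W (ltW (lt_trans x0x (ltr_pwDr g0 (lexx x)))) (ltW H) (ltW x'x1).
    by rewrite E1'; move: t'c c21 c11; clear; lra.
  have y'g : y - g <= y'.
    rewrite leNgt; apply/negP => H.
    have yg1 : y - g <= y1 by rewrite (le_trans _ (ltW yy1))// gerBl ltW.
    have := frame_F_le W' (ltW y0y') (ltW H) yg1.
    rewrite (rect_inc_swap U x0 x1 y0 y') (rect_inc_swap U x0 x1 y0 (y - g)) E2'.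
    by move: t'c c21 c12; clear; lra.
  have FK : rect_inc U x0 x y0 y1 + rect_inc U x0 x1 y0 y = M by rewrite E1 E2 addrC subrK.
  have FK' : rect_inc U x0 x' y0 y1 + rect_inc U x0 x1 y0 y' = M by rewrite E1' E2' addrC subrK.
  have [a1 a2 a3] := frame_pair W R1 R1' R2 R2' FK FK' xx' y'y.
  exists x', y'; split.
  - by rewrite gt_eqF.
  - by rewrite ger0_norm ?subr_ge0 ?(ltW xx')//; move: x'g gd; clear; lra.
  - by rewrite distrC ger0_norm ?subr_ge0 ?(ltW y'y)//; move: y'g gd; clear; lra.
  split.
  - rewrite (rect_inc_swap U x0 x1 y0 y') (rect_inc_swap U x0 x1 y0 y) E1 E1' E2 E2'.
    by clear; ring.
  - have arith (A B C D E : R) : A + B = E -> C + D = E -> C - A = - (D - B) by clear; lra.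
    exact: (arith _ _ _ _ _ a1 a2).
  - have LA : L1 x0 x' (energy_jump y0 y1 V).
      by apply: (energy_jump_L1S W) => //; exact: ltW.
    have LB : L1 y0 y (energy_jump x0 x1 (swap P)).
      by apply: (energy_jump_L1S W') => //; exact: ltW.
    rewrite (itg_cat (ltW x0x) (ltW xx') LA) (itg_cat (ltW y0y') (ltW y'y) LB).
    have arith (A B C D : R) : C + D = 0 -> A + C - A = B - (B + D) by clear; lra.
    exact: arith a3.
(* The intersection with [x0, x1] is there because V(., y0) and V(., y1) are known to be measurable
   only on that interval. *)
have mE : measurable [set s | `[x0, x1]%classic s /\ energy_jump y0 y1 V s != 0].
  have mJ := L1_measurable (energy_jump_L1 W).
  rewrite (_ : [set s | _] = `[x0, x1]%classic `&` energy_jump y0 y1 V @^-1` (~` [set 0])); last first.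
    by apply/seteqP; split => s /= -[h1 h2]; split => //; apply/eqP.
  by apply: mJ => //; apply: measurableC; exact: measurable_set1.
(* Almost every Q t avoids the set where the energy jumps, so V(., y1) = V(., y0) almost everywhere
   on that set, which makes the energies equal there too. *)
have HE := HQE _ mE; have {HE} := HE _.
move=> /(_ _)/wrap[].
  apply: aeS aereg => t rt tM -[_]; by rewrite (jump0 t tM rt) eqxx.
apply: aeS => s Hs sx.
have [|j] := eqVneq (energy_jump y0 y1 V s) 0.
  by move=> /eqP; rewrite subr_eq0 => /eqP.
have sI : `[x0, x1]%classic s by rewrite /= in_itv/=; move: sx => /andP[s0 s1]; rewrite !ltW.
by rewrite (Hs sx (conj sI j)).
Qed.

End collision.

(** * Traces on the initial line *)

Section traces.
Variable R : realType.
Local Notation mu := (@lebesgue_measure R).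
Implicit Types (U V P : R -> R -> R) (a b c d e h k r s t x y z : R).

Lemma ex_nat_inv x : 0 < x -> exists n : nat, n.+1%:R^-1 < x.
Proof.
move=> x0; exists (Num.bound x^-1).
rewrite invf_plt ?posrE// (lt_le_trans (archi_boundP _)) ?invr_ge0 ?(ltW x0)//.
by rewrite ler_nat.
Qed.

Lemma ae_exhaust (Q : R -> Prop) a :
  (forall b c, a < b -> b < c -> {ae mu, forall s, b < s < c -> Q s}) ->
  {ae mu, forall s, a < s -> Q s}.
Proof.
move=> H.
have : {ae mu, forall s, forall n : nat, a + n.+1%:R^-1 < s < a + n.+1%:R -> Q s}.
  apply: ae_allC => -[|n]; first by apply: aeW => s /andP[/lt_trans/[apply]]; rewrite invr1 ltxx.
  apply: H; first by rewrite ltrDl invr_gt0.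
  rewrite ltrD2l; apply: (@lt_trans _ _ 1); last by rewrite ltr1n.
  by rewrite invf_lt1 ?ltr1n.
apply: aeS => s Hs as_; have sa : 0 < s - a by rewrite subr_gt0.
have [n n1] := ex_nat_inv sa.
pose m := (n + Num.bound (s - a))%N; apply: (Hs m); apply/andP; split.
  rewrite addrC -ltrBrDr; apply: le_lt_trans n1.
  by rewrite lef_pV2 ?posrE// ler_nat ltnS leq_addr.
rewrite addrC -ltrBlDr; apply: (lt_le_trans (archi_boundP (ltW sa))).
by rewrite ler_nat (leq_trans (leq_addl n _)).
Qed.

Lemma energy_const U V P y0 y1 : char_solution U V P -> good U V y0 -> good U V y1 ->
  y0 < y1 -> {ae mu, forall s, - y0 < s -> V s y1 ^+ 2 = V s y0 ^+ 2 /\ V s y0 <= V s y1}.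
Proof.
move=> S g0 g1 yy; apply: ae_exhaust => b c yb bc.
have [x0 /andP[yx xb] gx0] := ae_itv_ex yb (char_goodP S).
have cc : c < c + 1 by rewrite ltrDl.
have [x1 /andP[cx xc] gx1] := ae_itv_ex cc (char_goodP S).
have xy : 0 < x0 + y0 by rewrite -ltrBlDr sub0r.
have xx : x0 < x1 by apply: (lt_trans xb); apply: (lt_trans bc).
have W : frame U V P x0 x1 y0 y1 by constructor.
apply: aeS (aeI (frame_energy W) (good_le_ae S x1 g0 g1 (ltW yy) xy)) => s [H1 H2] /andP[bs sc].
have sx : x0 < s < x1 by rewrite (lt_trans xb bs) (lt_trans sc cx).
by split; [exact: H1|exact: H2].
Qed.

Lemma good_measurable U V y : good U V y -> measurable_fun `]- y, +oo[ (fun s => V s y).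
Proof.
move=> gy; rewrite (_ : `]- y, +oo[%classic = \bigcup_n `[- y + n.+1%:R^-1, - y + n.+1%:R]%classic); last first.
  apply/seteqP; split => s /=; rewrite in_itv/= ?andbT.
    move=> ys; have sa : 0 < s + y by rewrite -ltrBlDr sub0r.
    have [n n1] := ex_nat_inv sa.
    exists (n + Num.bound (s + y))%N => //=; rewrite in_itv/=; apply/andP; split.
      rewrite addrC lerBlDr; apply: (le_trans _ (ltW n1)).
      by rewrite lef_pV2 ?posrE// ler_nat ltnS leq_addr.
    rewrite addrC lerBrDr; apply: (le_trans (ltW (archi_boundP (ltW sa)))).
    by rewrite ler_nat (leq_trans (leq_addl n _)).
  move=> [n _] /=; rewrite in_itv/= => /andP[ys _].
  by apply: lt_le_trans ys; rewrite ltrDl invr_gt0.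
apply/measurable_fun_bigcup => // n.
have [nn|nn] := leP (n.+1%:R^-1 : R) n.+1%:R.
  apply: L1_measurable.
  have [] // := gy (- y + n.+1%:R^-1) (- y + n.+1%:R).
    by rewrite lerD2l.
  by rewrite addrAC addNr add0r invr_gt0.
rewrite set_itv_ge; first exact: measurable_fun_set0.
by rewrite bnd_simp -ltNge ltrD2l.
Qed.

Lemma lt_double_third h k : 0 < h -> h <= k / 3 -> h + h < k.
Proof. by lra. Qed.

Lemma itg_dlim_sides f a b s l e : L1 a b f -> a < s < b -> dlim (fun y => itg a y f) s l ->
  0 < e -> exists2 d, 0 < d & forall h, 0 < h <= d -> [/\ a <= s - h, s + h <= b,
    `|itg s (s + h) f - l * h| <= e * h & `|itg (s - h) s f - l * h| <= e * h].
Proof.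
move=> Lf /andP[as_ sb] fl e0; have [d1 d10 H] := fl _ e0.
have sa0 : 0 < s - a by rewrite subr_gt0.
have sb0 : 0 < b - s by rewrite subr_gt0.
have [d2 [d20 d21 d22]] := ex_min2 sa0 sb0.
have [d [d0 dd1 dd2]] := ex_min2 d10 d20.
exists d => // h /andP[h0 hd].
have A1 : a <= s - h by move: hd dd2 d21; clear; lra.
have A2 : s + h <= b by move: hd dd2 d22; clear; lra.
split => //.
  have := H (s + h); rewrite (_ : s + h - s = h); last by ring.
  rewrite gtr0_norm// => /(_ (le_trans hd dd1)).
  have sh : s <= s + h by rewrite lerDl ltW.
  rewrite (itg_cat (ltW as_) sh (L1S _ A2 Lf))//.
  by congr (`|_| <= _); ring.
have := H (s - h); rewrite (_ : s - h - s = - h); last by ring.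
rewrite normrN gtr0_norm// => /(_ (le_trans hd dd1)).
have hs : s - h <= s by rewrite gerBl ltW.
rewrite (itg_cat A1 hs (L1S _ (ltW sb) Lf))//.
rewrite -normrN; congr (`|_| <= _); ring.
Qed.

(* One-sided limits, at the point [(s, - s)] of the initial line, of the
   difference quotients of [U] in its first variable. *)
Definition trace U s v := forall e, 0 < e -> exists2 d, 0 < d & forall h, 0 < h <= d ->
  [/\ `|U (s + h) (- s + h) - U s (- s + h) - v * h| <= e * h,
      `|U (s + h) (- s) - U s (- s) - v * h| <= e * h &
      `|U s (- s + h) - U (s - h) (- s + h) - v * h| <= e * h].

Section lines.
Variables (U V P : R -> R -> R) (th : R).
Hypothesis S : char_solution U V P.
Hypothesis gY : forall q : rat, good U V (th + ratr q).
Local Notation Y q := (th + ratr q).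

Definition regular_lines s := forall q q' : rat, Y q < Y q' -> - Y q < s ->
  V s (Y q') ^+ 2 = V s (Y q) ^+ 2 /\ V s (Y q) <= V s (Y q').

Lemma ae_regular_lines : {ae mu, forall s, regular_lines s}.
Proof.
apply: (@ae_allC _ _ _ _ rat) => q; apply: (@ae_allC _ _ _ _ rat) => q'.
have [_|qq] := leP (Y q') (Y q); first exact: aeW.
by apply: aeS (energy_const S (@gY q) (@gY q') qq) => s H _; exact: H.
Qed.

Lemma regular_lines_norm s q q' : regular_lines s -> - Y q < s -> - Y q' < s ->
  `|V s (Y q)| = `|V s (Y q')|.
Proof.
move=> G qs qs'; apply/eqP; rewrite -(@eqrXn2 _ 2) ?normr_ge0// !real_normK ?num_real//.
case: (ltgtP (Y q) (Y q')) => [qq|qq|->//].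
  by have [-> _] := G q q' qq qs.
by have [-> _] := G q' q qq qs'.
Qed.

(* On the countable dense family of good lines, V(s, .) is increasing with constant
   modulus.  Its limit at the initial line is thus negative exactly if s belongs
   to [neg_lines]; outside [late_neg m] that limit is attained on all the lines
   at distance less than 1/(m+1). *)
Definition neg_line q : set R := [set s | - Y q < s /\ V s (Y q) < 0].
Definition neg_lines : set R := \bigcup_q neg_line q.
Definition late_neg (m : nat) : set R :=
  neg_lines `\` \bigcup_q (neg_line q `&` [set s | - Y q + m.+1%:R^-1 <= s]).

Lemma measurable_neg_line q : measurable (neg_line q : set (measurableTypeR R)).
Proof.
rewrite (_ : neg_line q = `]- Y q, +oo[%classic `&` (fun s => V s (Y q)) @^-1` `]-oo, 0[%classic).
  by apply: (good_measurable (@gY q)) => //; exact: measurable_itv.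
by apply/seteqP; split => s /=; rewrite !in_itv/= andbT.
Qed.

Lemma measurable_neg_lines : measurable (neg_lines : set (measurableTypeR R)).
Proof. by apply: bigcupT_measurable_rat => q; exact: measurable_neg_line. Qed.

Lemma measurable_late_neg m : measurable (late_neg m : set (measurableTypeR R)).
Proof.
apply: measurableD; first exact: measurable_neg_lines.
apply: bigcupT_measurable_rat => q; apply: measurableI; first exact: measurable_neg_line.
rewrite (_ : [set s | _] = `[- Y q + m.+1%:R^-1, +oo[%classic); first exact: measurable_itv.
by apply/seteqP; split => s /=; rewrite in_itv/= andbT.
Qed.

Lemma late_neg_ex s : exists m, ~ late_neg m s.
Proof.
have [[q _ [qs Vq]]|sN] := pselect (neg_lines s); last by exists 0%N => -[].
have /ex_nat_inv[m mq] : 0 < s + Y q by rewrite -ltrBlDr sub0r.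
exists m => -[_]; apply; exists q => //; split => //=.
by rewrite addrC lerBlDr ltW.
Qed.

Variable q0 : rat.

(** The modulus can be read on any line; [q0] is chosen so that its line lies above the initial line
    over all of [a, b]. The factor is the limiting sign, -1 on [neg_lines] and 1 elsewhere. The
    defect below bounds the deviation of V from this value on the lines at distance less than
    1/(m+1): V can differ only by its sign, and only on [late_neg m]. *)
Definition trace_velocity s : R := `|V s (Y q0)| * (1 - 2 * \1_neg_lines s).
Definition trace_defect m s : R := 2 * (`|V s (Y q0)| * \1_(late_neg m) s).

Lemma trace_velocity_norm s : `|trace_velocity s| = `|V s (Y q0)|.
Proof.
rewrite /trace_velocity normrM normr_id indicE; case: (s \in neg_lines); last first.
  by rewrite mulr0 subr0 normr1 mulr1.
by rewrite mulr1 (_ : 1 - 2 = -1 :> R) ?normrN1 ?mulr1//; ring.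
Qed.

Lemma trace_velocity_defect m s q : regular_lines s -> - Y q0 < s -> - s < Y q ->
  Y q < - s + m.+1%:R^-1 -> `|V s (Y q) - trace_velocity s| <= trace_defect m s.
Proof.
move=> G s0 sq qm; have qs : - Y q < s by rewrite ltrNl.
have E := regular_lines_norm G qs s0.
rewrite /trace_velocity /trace_defect -E !indicE.
have [sN|sN] := boolP (s \in neg_lines); last first.
  have -> : s \in late_neg m = false.
    by apply/negP; rewrite inE => -[H _]; move: sN; rewrite notin_setE.
  have V0 : 0 <= V s (Y q).
    rewrite leNgt; apply/negP => V0; move: sN; rewrite notin_setE; apply.
    by exists q.
  by rewrite (ger0_norm V0) (_ : false%:R = 0 :> R)// !mulr0 subr0 mulr1 subrr normr0.
rewrite (_ : 1 - 2 * true%:R = -1 :> R) ?mulrN1 ?opprK; last by rewrite mulr1; ring.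
have [sB|sB] := boolP (s \in late_neg m).
  rewrite mulr1; apply: (le_trans (ler_normD _ _)); rewrite normr_id.
  by rewrite mulr_natl mulr2n.
suff V0 : V s (Y q) < 0 by rewrite (ltr0_norm V0) subrr normr0 mulr_ge0// mulr_ge0// oppr_ge0 ltW.
move: sB; rewrite notin_setE => sB.
have [q' _ [[qs' V0'] /= sq']] : (\bigcup_q (neg_line q `&` [set s | - Y q + m.+1%:R^-1 <= s])) s.
  by apply: contrapT => H; apply: sB; split => //; rewrite inE in sN.
apply: le_lt_trans V0'; have qq : Y q < Y q'.
  by apply: (lt_le_trans qm); rewrite addrC lerBlDl -lerBlDr addrC.
by have [] := G q q' qq qs.
Qed.

Variables a b : R.
Hypothesis ab : a <= b.
Hypothesis aq0 : - Y q0 < a.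

Let aY : 0 < a + Y q0. Proof. by rewrite -ltrBlDr sub0r. Qed.

Lemma L1_trace_velocity : L1 a b trace_velocity.
Proof.
have [L _ _] := @gY q0 a b ab aY.
apply: (L1_le _ (L1_norm L)) => [|s _]; last by rewrite trace_velocity_norm.
apply: measurable_funM; first exact: L1_measurable (L1_norm L).
apply: measurable_funB => //; apply: measurable_funM => //.
by apply: measurable_indic; exact: measurable_neg_lines.
Qed.

Lemma L1_trace_defect m : L1 a b (trace_defect m).
Proof.
have [L _ _] := @gY q0 a b ab aY; apply: L1Z.
apply: (@L1M _ a b _ (\1_(late_neg m)) 1 (L1_norm L)).
  by apply: measurable_indic; exact: measurable_late_neg.
by move=> s _; rewrite indicE; case: (s \in _); rewrite ?normr1 ?normr0 ?ler01.
Qed.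

Lemma trace_bound_line m x x' q : a <= x -> x <= x' -> x' <= b -> - x < Y q ->
  Y q < - x' + m.+1%:R^-1 ->
  `|U x' (Y q) - U x (Y q) - itg x x' trace_velocity| <= itg x x' (trace_defect m).
Proof.
move=> ax xx xb qx qx'.
have xY : 0 < x + Y q by rewrite -ltrBlDl sub0r.
have [L _ ->] := @gY q x x' xx xY.
have Lv := L1S ax xb L1_trace_velocity; have Lw := L1S ax xb (L1_trace_defect m).
rewrite -itgB//; apply: (le_trans (itg_norm (L1B L Lv))).
apply: le_itg_ae => //; first by apply: L1_norm; exact: L1B.
apply: aeS ae_regular_lines => s G /andP[xs sx]; apply: trace_velocity_defect => //.
- by apply: lt_le_trans aq0 _; rewrite (le_trans ax).
- by apply: le_lt_trans qx; rewrite lerN2.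
- by apply: (lt_le_trans qx'); rewrite lerD2r lerN2.
Qed.

(** Approximating y from above by good lines extends the bound, by continuity of U, to every height,
    including one at which (x, y) lies on the initial line. *)
Lemma trace_bound m x x' y : a <= x -> x <= x' -> x' <= b -> - x <= y ->
  y < - x' + m.+1%:R^-1 ->
  `|U x' y - U x y - itg x x' trace_velocity| <= itg x x' (trace_defect m).
Proof.
move=> ax xx xb xy yx; apply/ler_addgt0Pr => e e0.
have e2 : 0 < e / 2 by rewrite divr_gt0.
have xy0 : 0 <= x + y by rewrite -lerBlDl sub0r.
have xy0' : 0 <= x' + y by rewrite (le_trans xy0)// lerD2r.
have [d1 d10 H1] := char_cont S xy0 e2; have [d2 d20 H2] := char_cont S xy0' e2.
have [d3 [d30 d31 d32]] := ex_min2 d10 d20.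
have y0 : 0 < - x' + m.+1%:R^-1 - y by rewrite subr_gt0.
have [d [d0 dd3 dy]] := ex_min2 d30 y0.
have ydt : y - th < y + d - th by rewrite ltrD2r ltrDl.
have [q] := rat_in_itvoo ydt; rewrite in_itv/= => /andP[q1 q2].
have yq : y < Y q by rewrite -ltrBlDl.
have qy : Y q < y + d by rewrite -ltrBrDl.
have qd : `|Y q - y| <= d3.
  rewrite ger0_norm; last by rewrite subr_ge0 ltW.
  by rewrite lerBlDl (le_trans (ltW qy))// lerD2l.
have := trace_bound_line (m := m) ax xx xb (le_lt_trans xy yq).
move=> /(_ _)/wrap[]; first by rewrite (lt_le_trans qy)// -lerBrDl.
have := H1 x (Y q); rewrite subrr normr0 => /(_ _ (ltW d10) (le_trans qd d31))/wrap[].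
  by rewrite (le_trans xy0)// lerD2l ltW.
have := H2 x' (Y q); rewrite subrr normr0 => /(_ _ (ltW d20) (le_trans qd d32))/wrap[].
  by rewrite (le_trans xy0')// lerD2l ltW.
move: (itg x x' trace_velocity) (itg x x' (trace_defect m)) => I J; clear.
by rewrite !ler_norml => /andP[A1 A2] /andP[B1 B2] /andP[C1 C2]; apply/andP; split; lra.
Qed.

(** The point s is taken where [trace_velocity] and all the defects are derivatives of their
    primitives. It lies outside some [late_neg m], so that this defect is 0 at s and its integral
    over an interval of length h at s is o(h). No uniformity in neighbouring points is required. *)
Lemma trace_ae :
  {ae mu, forall s, a < s < b -> trace U s (trace_velocity s)}.
Proof.
have H m := itg_dlim (L1_trace_defect m).
apply: aeS (aeI (itg_dlim L1_trace_velocity) (ae_allC H)) => s [H1 H2] sab e e0.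
have [m sm] := late_neg_ex s.
have e2 : 0 < e / 2 by rewrite divr_gt0.
have [d1 d10 {}H1] := itg_dlim_sides L1_trace_velocity sab (H1 sab) e2.
have [d2 d20 {}H2] := itg_dlim_sides (L1_trace_defect m) sab (H2 m sab) e2.
have w0 : trace_defect m s = 0.
  by rewrite /trace_defect indicE memNset// mulr0 mulr0.
rewrite w0 in H2.
(* On the line eta = - s + h the point with xi = s + h is at distance 2 h from the initial line,
   which must stay below 1/(m+1). *)
have m0 : 0 < (m.+1%:R^-1 : R) / 3 by rewrite divr_gt0 ?invr_gt0.
have [d3 [d30 d31 d32]] := ex_min2 d10 d20.
have [d [d0 dd3 dm]] := ex_min2 d30 m0.
exists d => // h /andP[h0 hd].
have hm : h <= m.+1%:R^-1 / 3 := le_trans hd dm.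
have h1 : 0 < h <= d1 by rewrite h0 (le_trans hd (le_trans dd3 d31)).
have h2 : 0 < h <= d2 by rewrite h0 (le_trans hd (le_trans dd3 d32)).
have [ash shb v1 v2] := H1 h h1; have [_ _ w1 w2] := H2 h h2.
have sh : s <= s + h by rewrite lerDl ltW.
have hs : s - h <= s by rewrite gerBl ltW.
have /andP[/ltW as_ /ltW sb] := sab.
rewrite mul0r subr0 in w1; rewrite mul0r subr0 in w2.
have comb (X I J : R) : `|X - I| <= J -> `|I - trace_velocity s * h| <= e / 2 * h ->
    `|J| <= e / 2 * h -> `|X - trace_velocity s * h| <= e * h.
  move=> XI IJ JJ; have -> : X - trace_velocity s * h = (X - I) + (I - trace_velocity s * h) by ring.
  apply: (le_trans (ler_normD _ _)); rewrite [leRHS](_ : _ = e / 2 * h + e / 2 * h); last by field.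
  by apply: lerD => //; apply: (le_trans XI); exact: le_trans (ler_norm _) JJ.
have hm' : h + h < m.+1%:R^-1 := lt_double_third h0 hm.
have hm2 : h < m.+1%:R^-1 by rewrite (le_lt_trans _ hm')// lerDl ltW.
split.
- apply: comb (trace_bound as_ sh shb _ _) v1 w1; first by rewrite lerDl ltW.
  by rewrite opprD -addrA ltrD2l -ltrBlDl opprK.
- apply: comb (trace_bound as_ sh shb _ _) v1 w1; first exact: lexx.
  by rewrite opprD -addrA ltrDl -ltrBlDl add0r opprK.
- apply: comb (trace_bound ash hs sb _ _) v2 w2; first by rewrite opprB addrC.
  by rewrite ltrD2l.
Qed.

End lines.

(** As almost every line is good, almost every [th] makes all its rational translates good. This
    countable dense family of lines allows statements about all of them to hold for almost every
    s. *)
Lemma trace_ex U V P : char_solution U V P -> exists2 th : R,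
  (forall q : rat, good U V (th + ratr q)) &
  {ae mu, forall s, exists2 v, trace U s v &
    forall q : rat, - s < th + ratr q -> `|V s (th + ratr q)| = `|v|}.
Proof.
move=> S.
have := ae_allC (fun q : rat => ae_affine (ratr q) ltr01 (char_goodV S)).
move=> /(ae_itv_ex ltr01) [th _ gY]; exists th => [q|].
  by have := gY q; rewrite mul1r addrC.
have {}gY q : good U V (th + ratr q) by have := gY q; rewrite mul1r addrC.
suff : {ae mu, forall s, forall n : nat, - n%:R < s -> exists2 v, trace U s v &
    forall q : rat, - s < th + ratr q -> `|V s (th + ratr q)| = `|v|}.
  apply: aeS => s H; apply: (H (Num.bound (- s))); rewrite ltrNl.
  have [s0|s0] := leP 0 (- s); first exact: archi_boundP.
  by apply: (lt_le_trans s0); exact: ler0n.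
apply: ae_allC => n; apply: ae_exhaust => a b na ab.
have nn : - a - th < - a - th + 1 by rewrite ltrDl.
have [q0] := rat_in_itvoo nn; rewrite in_itv/= => /andP[q1 _].
have aq0 : - (th + ratr q0) < a by rewrite ltrNl -ltrBlDl.
apply: aeS (aeI (ae_regular_lines S gY) (trace_ae S gY (ltW ab) aq0)) => s [H1 H2] sab.
exists (trace_velocity V th q0 s); first exact: H2.
move=> q sq; rewrite trace_velocity_norm; apply: regular_lines_norm => //.
  by rewrite ltrNl.
by have /andP[sa _] := sab; apply: lt_trans sa.
Qed.

(** The value [V0 s] is chosen for each s separately, so as not to depend on the bounded interval or
    the reference line of [trace_ae]; its link with measurable functions comes from
    [initial_velocities]. *)
Lemma trace_good U V P : char_solution U V P -> exists V0 : R -> R,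
  [/\ {ae mu, forall s, trace U s (V0 s)} &
  forall y, good U V y -> {ae mu, forall s, - y < s -> `|V s y| = `|V0 s|}].
Proof.
move=> S; have [th gY H] := trace_ex S.
pose Tr s v := trace U s v /\ forall q : rat, - s < th + ratr q -> `|V s (th + ratr q)| = `|v|.
have ex s : exists v, (exists v', Tr s v') -> Tr s v.
  by have [[v ?]|] := pselect (exists v', Tr s v'); [exists v|exists 0].
pose V0 s := projT1 (cid (ex s)).
have {}H : {ae mu, forall s, Tr s (V0 s)}.
  apply: aeS H => s [v v1 v2]; rewrite /V0; case: cid => /= w; apply.
  by exists v.
exists V0; split; first by apply: aeS H => s [].
move=> y gy.
have E q : {ae mu, forall s, - y < s -> - s < th + ratr q -> `|V s y| = `|V s (th + ratr q)|}.
  have sq (c d : R) : c ^+ 2 = d ^+ 2 -> `|c| = `|d|.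
    by move=> cd; apply/eqP; rewrite -(@eqrXn2 _ 2) ?normr_ge0// !real_normK ?num_real// cd.
  have [yq|yq|<-] := ltgtP y (th + ratr q); last by apply: aeW.
    by apply: aeS (energy_const S gy (gY q) yq) => s Hs /Hs[/sq ->].
  by apply: aeS (energy_const S (gY q) gy yq) => s Hs _; rewrite ltrNl => /Hs[/sq ->].
apply: aeS (aeI H (ae_allC E)) => s [[_ H1] H2] ys.
have nn : - s - th < - s - th + 1 by rewrite ltrDl.
have [q] := rat_in_itvoo nn; rewrite in_itv/= => /andP[q1 _].
have sq : - s < th + ratr q by rewrite -ltrBlDl.
by rewrite (H2 q ys sq) H1.
Qed.

End traces.

(** * From the weak formulation to characteristic variables *)

Section weak_derivatives.
Variable R : realType.
Local Notation mu := (@lebesgue_measure R).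
Implicit Types (a b c d e h k r s t x y z : R) (f g w : R -> R).

Lemma ramp_mean_near a c d e k l w : 0 < e -> c <= a -> a + e <= d -> L1 c d w ->
  (forall r, a < r < a + e -> `|w r - l| <= k) ->
  `|itg c d (fun r => w r * ramp' e a r) - l| <= k.
Proof.
move=> e0 ca ad Lw H; rewrite ler_distl; apply/andP; split.
  by apply: ramp_mean_ge => //; apply: aeW => r /H; rewrite ler_distl => /andP[].
by apply: ramp_mean_le => //; apply: aeW => r /H; rewrite ler_distl => /andP[].
Qed.

(** Letting the plateaus tend to the indicator of [a, b]. Only the widths 1/(n+1) occur: countably
    many, so that null sets of lines can be united in [weak_increment_ae]. The ramps sit to the
    right of a and b, hence continuity from the right suffices, and [a, b + 1] contains all their
    supports. *)
Lemma weak_increment a b w g : a < b -> L1 a (b + 1) w -> L1 a (b + 1) g ->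
  (forall k, 0 < k -> exists2 h, 0 < h & forall r, a < r < a + h -> `|w r - w a| <= k) ->
  (forall k, 0 < k -> exists2 h, 0 < h & forall r, b < r < b + h -> `|w r - w b| <= k) ->
  (forall n : nat, itg a (b + 1) (fun x => w x * plateau' n.+1%:R^-1 a b x) =
     - itg a (b + 1) (fun x => g x * plateau n.+1%:R^-1 a b x)) ->
  w b - w a = itg a b g.
Proof.
move=> ab Lw Lg wa wb H; apply/eqP; rewrite -subr_eq0; apply/eqP.
apply: (@eq0_small _ 4) => // k k0.
have [h1 h10 A1] := wa k k0; have [h2 h20 A2] := wb k k0.
have [h3 h30 A3] := itg_small Lg k0.
have ab0 : 0 < b - a by rewrite subr_gt0.
have [h4 [h40 h41 h42]] := ex_min2 h10 h20; have [h5 [h50 h53 h5b]] := ex_min2 h30 ab0.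
have [h [h0 h4h h5h]] := ex_min2 h40 h50.
have [n nh] := ex_nat_inv h0; have {H} := H n.
have n1 : (n.+1%:R^-1 : R) <= 1 by rewrite invf_le1// ler1n.
have e0 : 0 < (n.+1%:R^-1 : R) by rewrite invr_gt0.
move: n1 nh e0; move: (n.+1%:R^-1 : R) => e e1 eh e0 H.
have eh1 := le_trans (ltW eh) (le_trans h4h h41); have eh2 := le_trans (ltW eh) (le_trans h4h h42).
have eh3 := le_trans (ltW eh) (le_trans h5h h53); have ehb := le_trans (ltW eh) (le_trans h5h h5b).
have aeb : a + e <= b by rewrite -lerBrDl.
have be : b + e <= b + 1 by rewrite lerD2l.
have ae1 : a + e <= b + 1 by rewrite (le_trans aeb)// lerDl.
have ab' := ltW ab.
have B1 : `|itg a (b + 1) (fun r => w r * ramp' e a r) - w a| <= k.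
  apply: ramp_mean_near => // r /andP[r1 r2]; apply: A1; rewrite r1 (lt_le_trans r2)//.
  by rewrite lerD2l.
have B2 : `|itg a (b + 1) (fun r => w r * ramp' e b r) - w b| <= k.
  apply: ramp_mean_near => // r /andP[r1 r2]; apply: A2; rewrite r1 (lt_le_trans r2)//.
  by rewrite lerD2l.
have B3 : `|itg a (b + e) (fun x => g x * plateau e a b x) - itg a b g| <= k + k.
  apply: (le_trans (plateau_itg_close e0 aeb (L1S (lexx a) be Lg))).
  apply: lerD; apply: A3 => //.
  - by rewrite lerDl ltW.
  - by rewrite addrC addKr.
  - by rewrite lerDl ltW.
  - by rewrite addrC addKr.
have E1 : itg a (b + 1) (fun x => w x * plateau' e a b x) =
    itg a (b + 1) (fun r => w r * ramp' e a r) - itg a (b + 1) (fun r => w r * ramp' e b r).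
  rewrite -itgB; [|exact: L1_Mramp'|exact: L1_Mramp'].
  by apply: eq_itg => x _; rewrite /plateau' mulrBr.
have E2 : itg a (b + 1) (fun x => g x * plateau e a b x) = itg a (b + e) (fun x => g x * plateau e a b x).
  apply: itg_supp => //; first by rewrite (le_trans ab')// lerDl ltW.
    exact: L1_Mplateau.
  by move=> x xx; rewrite plateau_eq0 ?mulr0.
rewrite E1 E2 in H.
have arith (X Y Z A B C : R) : `|X - A| <= k -> `|Y - B| <= k -> `|Z - C| <= k + k ->
    X - Y = - Z -> `|B - A - C| <= 4 * k.
  by clear; rewrite !ler_norml => /andP[a1 a2] /andP[b1 b2] /andP[c1 c2] H; apply/andP; split; lra.
exact: arith B1 B2 B3 H.
Qed.

Lemma smooth1_plateau e a b : smooth1 (plateau e a b).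
Proof.
rewrite (_ : plateau e a b = fun x => step (e^-1 * (x - a)) + (-1) * step (e^-1 * (x - b))).
  by apply: smooth1D; [exact: smooth1_step|apply: smooth1Z; exact: smooth1_step].
by apply/funext => x; rewrite mulN1r.
Qed.

Lemma is_derive_plateau e a b x : is_derive x 1 (plateau e a b) (plateau' e a b x).
Proof. exact: is_deriveB (is_derive_ramp e a x) (is_derive_ramp e b x). Qed.

Lemma plateau_supp e a b d x : 0 < e -> a <= b -> b + e <= d -> ~ (a <= x <= d) ->
  plateau e a b x = 0 /\ plateau' e a b x = 0.
Proof.
move=> e0 ab bd /negP; rewrite negb_and -!ltNge => /orP[/ltW xa|/ltW dx].
  split; first by rewrite plateau_eq0//; left.
  by rewrite /plateau' !ramp'_eq0 ?subrr//; left => //; exact: le_trans ab.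
have bx := le_trans bd dx; split; first by rewrite plateau_eq0//; right.
by rewrite /plateau' !ramp'_eq0 ?subrr//; right => //; apply: le_trans bx; rewrite lerD2r.
Qed.

Lemma W12loc_increment (u du : R -> R) a b : W12loc u du -> continuous u -> a < b ->
  u b - u a = itg a b du.
Proof.
move=> [_ Ldu H] cu ab; have Ldu1 := L2loc_L1 a (b + 1) Ldu.
have cc x k : 0 < k -> exists2 h, 0 < h & forall r, x < r < x + h -> `|u r - u x| <= k.
  move=> k0; have /cvgrPdist_le/(_ k k0)[h /= h0 Hh] := cu x.
  exists h => // r /andP[xr rx]; rewrite distrC; apply: Hh; rewrite /= distrC gtr0_norm ?subr_gt0//.
  by rewrite ltrBlDl.
apply: weak_increment => //.
- by apply: L1_continuous; exact: continuous_subspaceT.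
- exact: cc.
- exact: cc.
move=> n.
set e := n.+1%:R^-1; have e0 : 0 < e by rewrite invr_gt0.
have e1 : e <= 1 by rewrite invf_le1// ler1n.
have ab' := ltW ab.
have be : b + e <= b + 1 by rewrite lerD2l.
have tp : test_function setT (plateau e a b).
  split; first by apply: smooth1_smooth; exact: smooth1_plateau.
  exists `[a, b + 1]%classic; split => //; first exact: segment_compact.
  by move=> x; rewrite /= in_itv/= => xab; have [] := plateau_supp e0 ab' be xab.
have dp x : 'D_1 (plateau e a b) x = plateau' e a b x by have := is_derive_plateau e a b x => -[_].
have out f x : ~ `[a, b + 1]%classic x -> f x * plateau e a b x = 0 /\ f x * plateau' e a b x = 0.
  by rewrite /= in_itv/= => xab; have [-> ->] := plateau_supp e0 ab' be xab; rewrite mulr0.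
have Rs (F : R -> R) : (forall x, ~ `[a, b + 1]%classic x -> F x = 0) ->
    \int[leb]_x F x = itg a (b + 1) F.
  move=> F0; rewrite /itg [RHS]Rintegral_mkcond; apply: eq_Rintegral => x _.
  by rewrite patchE; case: ifPn => //; rewrite notin_setE => /F0.
have := H _ tp; rewrite (Rs (fun x => u x * 'D_1 (plateau e a b) x)); last first.
  by move=> x /(out u)[_]; rewrite dp.
rewrite (Rs (fun x => du x * plateau e a b x)); last by move=> x /(out du)[].
by move=> <-; apply: eq_itg => x _; rewrite dp.
Qed.

End weak_derivatives.

(** * Fubini's theorem on rectangles *)

Section rectangles.
Variable R : realType.
Local Notation mu := (@lebesgue_measure R).
Local Notation T2 := (measurableTypeR R * measurableTypeR R)%type.
Implicit Types (W : T2 -> R) (a b c d : R).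

Definition rect a b c d : set T2 := `[a, b]%classic `*` `[c, d]%classic.
Definition rectL W a b c d := leb2.-integrable (rect a b c d) (EFin \o W).

Lemma measurable_rect a b c d : measurable (rect a b c d).
Proof. by apply: measurableX; exact: measurable_itv. Qed.

Lemma rectE a b c d x y : rect a b c d (x, y) <-> (a <= x <= b) /\ (c <= y <= d).
Proof. by rewrite /rect/= !in_itv/=. Qed.

Lemma rectL_patch W a b c d : rectL W a b c d -> leb2.-integrable setT (EFin \o (W \_ (rect a b c d))).
Proof.
move=> L; rewrite -restrict_EFin; apply/integrable_restrict => //=.
  exact: measurable_rect.
by rewrite setTI.
Qed.

(** The inner integral in Fubini's theorem is extended-real and finite only almost everywhere;
    [fine] makes it a real function with the same integral. *)
Lemma integrable_fine (f : R -> \bar R) : mu.-integrable setT f ->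
  mu.-integrable setT (fun x => (fine (f x))%:E) /\
  (\int[mu]_x f x = \int[mu]_x (fine (f x))%:E)%E.
Proof.
move=> Lf; have mf := measurable_int mu Lf.
have mg : measurable_fun setT (fun x => (fine (f x))%:E).
  by apply/measurable_EFinP; apply: measurableT_comp => //; exact: measurable_fine.
split.
  apply: le_integrable Lf => // x _; case: (f x) => [r| |] //=; rewrite normr0 ?leey//.
apply: ae_eq_integral => //.
have := integrable_ae measurableT Lf; apply: aeS => x fx _.
by rewrite fineK//; exact: fx.
Qed.

Lemma rect_fubini1 W a b c d : rectL W a b c d ->
  [/\ {ae mu, forall x, a <= x <= b -> L1 c d (fun y => W (x, y))},
      L1 a b (fun x => itg c d (fun y => W (x, y))) &
      \int[leb2]_(z in rect a b c d) W z = itg a b (fun x => itg c d (fun y => W (x, y)))].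
Proof.
move=> L; have LT := rectL_patch L; set WR := W \_ (rect a b c d) in LT.
have WE x : a <= x <= b -> (fun y => WR (x, y)) = (fun y => W (x, y)) \_ `[c, d].
  move=> xab; apply/funext => y; rewrite /WR !patchE.
  have [ycd|ycd] := boolP (y \in `[c, d]%classic).
    by rewrite mem_set//; apply/rectE; split=> //; move: ycd; rewrite inE/= in_itv.
  rewrite memNset// => /rectE[_ H]; move: ycd; rewrite notin_setE/= in_itv/=; exact.
have W0 x y : ~ (a <= x <= b) -> WR (x, y) = 0.
  by move=> xab; rewrite /WR patchE memNset// => /rectE[].
have GE x : a <= x <= b -> \int[mu]_y WR (x, y) = itg c d (fun y => W (x, y)).
  by move=> xab; rewrite (WE x xab) -Rintegral_mkcond.
have [Lg gE] := integrable_fine (integrable_fubini_F LT).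
have Lab : L1 a b (fun x => itg c d (fun y => W (x, y))).
  apply: (@eq_L1 _ a b (fun x => fine (fubini_F mu (EFin \o WR) x))); last first.
    exact: integrableS Lg.
  by move=> x xab; rewrite -GE.
split => //.
  have := ae_integrable1 LT; apply: aeS => x Hx xab.
  have := Hx; rewrite (_ : (fun y => _) = EFin \o (fun y => W (x, y)) \_ `[c, d]); last first.
    by apply/funext => y; rewrite /= -WE.
  by rewrite -restrict_EFin => /integrable_restrict -/(_ (measurable_itv _) measurableT); rewrite setTI.
rewrite Rintegral_mkcond; rewrite /Rintegral.
rewrite -[LHS]/(fine (\int[leb2]_z (EFin \o WR) z)%E).
rewrite /leb2 -(integral12_prod_meas1 LT) gE.
rewrite /itg [RHS]Rintegral_mkcond /Rintegral; congr fine; apply: eq_integral => x _.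
rewrite patchE; case: ifPn => [|xn].
  by rewrite inE/= in_itv/= => /GE E; congr EFin; exact: E.
rewrite /fubini_F (_ : (fun y => (EFin \o WR) (x, y)) = (fun=> 0%E)) ?integral0//.
apply/funext => y; rewrite /= W0//; move: xn.
by rewrite notin_setE/= in_itv/=.
Qed.

Lemma rectL_swap W a b c d : rectL W a b c d ->
  rectL (fun z => W (z.2, z.1)) c d a b /\
  \int[leb2]_(z in rect a b c d) W z = \int[leb2]_(z in rect c d a b) W (z.2, z.1).
Proof.
move=> L; have LT := rectL_patch L; set WR := W \_ (rect a b c d) in LT.
pose WS : T2 -> R := (fun z : T2 => W (z.2, z.1)) \_ (rect c d a b).
have WSE x y : WS (x, y) = WR (y, x).
  rewrite /WS /WR !patchE/=; have [H|H] := pselect (rect a b c d (y, x)).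
    by rewrite !mem_set//; move: H => /rectE[? ?]; exact/rectE.
  by rewrite !memNset// => /rectE[? ?]; apply: H; exact/rectE.
have mWS : measurable_fun setT (EFin \o WS).
  rewrite (_ : EFin \o WS = (EFin \o WR) \o (fun z : T2 => (z.2, z.1) : T2)).
    apply: measurableT_comp (measurable_int _ LT) _.
    by apply/measurable_fun_pairP; split; [exact: measurable_snd|exact: measurable_fst].
  by apply/funext => -[x y]; rewrite /= WSE.
have LS : leb2.-integrable setT (EFin \o WS).
  apply/integrable12ltyP => //; have := (integrable21ltyP mu mu (measurable_int _ LT)).1 LT.
  have e : (\int[mu]_x \int[mu]_y `|(EFin \o WS) (x, y)| =
      \int[mu]_y \int[mu]_x `|(EFin \o WR) (x, y)|)%E.
    by apply: eq_integral => x _; apply: eq_integral => y _; rewrite /= WSE.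
  by apply: le_lt_trans; rewrite e.
split.
  move: LS; rewrite -restrict_EFin => /integrable_restrict.
  by move=> /(_ (measurable_rect _ _ _ _) measurableT); rewrite setTI.
rewrite [LHS]Rintegral_mkcond [RHS]Rintegral_mkcond /Rintegral.
rewrite -[LHS]/(fine (\int[leb2]_z (EFin \o WR) z)%E) -[RHS]/(fine (\int[leb2]_z (EFin \o WS) z)%E).
have e : (\int[leb2]_z (EFin \o WR) z = \int[leb2]_z (EFin \o WS) z)%E.
  rewrite -[LHS](integral21_prod_meas1 LT) -[RHS](integral12_prod_meas1 LS).
  by apply: eq_integral => x _; apply: eq_integral => y _; rewrite /= WSE.
exact: (congr1 fine e).
Qed.

Lemma rect_fubini2 W a b c d : rectL W a b c d ->
  [/\ {ae mu, forall y, c <= y <= d -> L1 a b (fun x => W (x, y))},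
      L1 c d (fun y => itg a b (fun x => W (x, y))) &
      \int[leb2]_(z in rect a b c d) W z = itg c d (fun y => itg a b (fun x => W (x, y)))].
Proof. by move=> /rectL_swap[/rect_fubini1[H1 H2 H3] ->]. Qed.

End rectangles.

(** * Test functions in characteristic variables *)

Section characteristic_test_functions.
Variable R : realType.
Implicit Types (f g : R -> R) (a b c d : R).

Local Notation s2 := (Num.sqrt 2 : R).
Definition xi_form : R * R := (s2^-1, s2^-1).
Definition eta_form : R * R := (- s2^-1, s2^-1).

Definition char_tensor f g (z : R * R) := f (lform xi_form z) * g (lform eta_form z).

Lemma xi_formE z : lform xi_form z = (to_char z).1.
Proof. by rewrite /lform/= mulrDl ![_^-1 * _]mulrC. Qed.

Lemma eta_formE z : lform eta_form z = (to_char z).2.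
Proof. by rewrite /lform/= mulrBl mulNr ![_^-1 * _]mulrC addrC. Qed.

Lemma char_tensorE f g (c : R * R) : char_tensor f g (of_char c) = f c.1 * g c.2.
Proof. by rewrite /char_tensor xi_formE eta_formE of_charK. Qed.

Lemma lform_dir : [/\ lform xi_form (dir_x R) = s2^-1, lform eta_form (dir_x R) = - s2^-1,
  lform xi_form (dir_t R) = s2^-1 & lform eta_form (dir_t R) = s2^-1].
Proof. by rewrite /lform/= !mulr0 !mulr1 !addr0 !add0r. Qed.

Section derivatives.
Variables (f f' g g' : R -> R).
Hypotheses (ff' : forall x : R, is_derive x 1 f (f' x)) (gg' : forall x : R, is_derive x 1 g (g' x)).

Lemma char_tensor_dx z :
  'D_(dir_x R) (char_tensor f g) z = (char_tensor f' g z - char_tensor f g' z) / s2.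
Proof.
have [e1 e2 _ _] := lform_dir.
by rewrite (derive_tensor xi_form eta_form (dir_x R) z ff' gg').2 e1 e2 mulNr -mulrBr mulrC.
Qed.

Lemma char_tensor_dt z :
  'D_(dir_t R) (char_tensor f g) z = (char_tensor f' g z + char_tensor f g' z) / s2.
Proof.
have [_ _ e1 e2] := lform_dir.
by rewrite (derive_tensor xi_form eta_form (dir_t R) z ff' gg').2 e1 e2 -mulrDr mulrC.
Qed.

End derivatives.

Lemma smooth1_derivative f f' : smooth1 f -> (forall x : R, is_derive x 1 f (f' x)) -> smooth1 f'.
Proof.
move=> /smooth1_derive[h sh fh] ff'; rewrite (_ : f' = h)//; apply/funext => x.
by have := ff' x => -[_ <-]; have := fh x => -[_ <-].
Qed.

Lemma differentiable_char_tensor f g z : smooth1 f -> smooth1 g -> differentiable (char_tensor f g) z.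
Proof.
move=> /smooth1_derive[f' _ ff'] /smooth1_derive[g' _ gg'].
exact: (derive_tensor xi_form eta_form 0 z ff' gg').1.
Qed.

Lemma dalembertian_char_tensor f f' g g' z : smooth1 f -> smooth1 g ->
  (forall x : R, is_derive x 1 f (f' x)) -> (forall x : R, is_derive x 1 g (g' x)) ->
  dalembertian (char_tensor f g) z = 2 * char_tensor f' g' z.
Proof.
move=> sf sg ff' gg'.
have sf' := smooth1_derivative sf ff'; have sg' := smooth1_derivative sg gg'.
have [f'' _ ff''] := smooth1_derive sf'; have [g'' _ gg''] := smooth1_derive sg'.
have d1 v : derivable (char_tensor f' g) z v by exact/diff_derivable/differentiable_char_tensor.
have d2 v : derivable (char_tensor f g') z v by exact/diff_derivable/differentiable_char_tensor.
have Ex : 'D_(dir_x R) (char_tensor f g) = s2^-1 *: (char_tensor f' g - char_tensor f g').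
  by apply/funext => y; rewrite (char_tensor_dx ff' gg') mulrC.
have Et : 'D_(dir_t R) (char_tensor f g) = s2^-1 *: (char_tensor f' g + char_tensor f g').
  by apply/funext => y; rewrite (char_tensor_dt ff' gg') mulrC.
rewrite /dalembertian Ex Et.
rewrite deriveZ; last exact: derivableD.
rewrite deriveZ; last exact: derivableB.
rewrite deriveD// deriveB// /GRing.scale/=.
rewrite (char_tensor_dx ff'' gg') (char_tensor_dx ff' gg'') (char_tensor_dt ff'' gg') (char_tensor_dt ff' gg'').
transitivity (4 * char_tensor f' g' z / (s2 * s2)); first by field; exact: sqrt2_neq0.
by rewrite sqr_sqrt2; field.
Qed.

Lemma of_char_continuous : continuous (@of_char R).
Proof.
move=> z.
have h1 : (fun y : R * R => (y.1 - y.2) / s2) y @[y --> z] --> (z.1 - z.2) / s2.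
  by apply: cvgM; [apply: cvgB; [exact: cvg_fst|exact: cvg_snd]|exact: cvg_cst].
have h2 : (fun y : R * R => (y.1 + y.2) / s2) y @[y --> z] --> (z.1 + z.2) / s2.
  by apply: cvgM; [apply: cvgD; [exact: cvg_fst|exact: cvg_snd]|exact: cvg_cst].
exact: (cvg_pair h1 h2).
Qed.

Lemma char_tensor_test f g a b c d (Omega : set (R * R)) : smooth1 f -> smooth1 g ->
  (forall x, ~ (a <= x <= b) -> f x = 0) -> (forall y, ~ (c <= y <= d) -> g y = 0) ->
  (forall x y, a <= x <= b -> c <= y <= d -> Omega (of_char (x, y))) ->
  test_function Omega (char_tensor f g).
Proof.
move=> sf sg f0 g0 HO; split.
  by apply: smooth2_smooth; exact: smooth2M.
exists (@of_char R @` (`[a, b]%classic `*` `[c, d]%classic)); split.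
- apply: continuous_compact; last by apply: compact_setX; exact: segment_compact.
  by apply: continuous_subspaceT; exact: of_char_continuous.
- by move=> _ [[x y] /= [xab ycd] <-]; apply: HO; [move: xab|move: ycd]; rewrite in_itv.
move=> z Kz; rewrite /char_tensor xi_formE eta_formE.
have [xab|/f0 ->] := pselect (a <= (to_char z).1 <= b); last by rewrite mul0r.
have [ycd|/g0 ->] := pselect (c <= (to_char z).2 <= d); last by rewrite mulr0.
exfalso; apply: Kz; exists (to_char z); last exact: to_charK.
by split; rewrite /= in_itv.
Qed.

End characteristic_test_functions.

(** * From weak derivatives to derivatives on almost every line *)

Section tensor_integrals.
Variable R : realType.
Local Notation mu := (@lebesgue_measure R).
Local Notation T2 := (measurableTypeR R * measurableTypeR R)%type.
Implicit Types (W : T2 -> R) (a b c d e k x y : R) (f g : R -> R) (U V : R -> R -> R).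

Definition bounded_measurable f := measurable_fun [set: R] f /\ exists C, forall x, `|f x| <= C.

Lemma bounded_plateau e a b : 0 < e -> a <= b -> bounded_measurable (plateau e a b).
Proof.
move=> e0 ab; split; first exact: measurable_plateau.
by exists 1 => x; have /andP[p0 p1] := plateau_itv x e0 ab; rewrite ger0_norm.
Qed.

Lemma bounded_plateau' e a b : 0 < e -> bounded_measurable (plateau' e a b).
Proof.
move=> e0; split.
  by apply: measurable_funB; apply: continuous_measurable_fun; exact: continuous_ramp'.
have [C1 H1] := ramp'_bounded a e0; have [C2 H2] := ramp'_bounded b e0.
by exists (C1 + C2) => x; apply: (le_trans (ler_normB _ _)); apply: lerD.
Qed.

Lemma bounded_cst1 : bounded_measurable (fun=> 1 : R).
Proof. by split; [exact: measurable_cst|exists 1 => x; rewrite normr1]. Qed.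

Lemma L1_Mbounded a b h f : L1 a b h -> bounded_measurable f -> L1 a b (fun x => h x * f x).
Proof. by move=> Lh [mf [C HC]]; apply: (@L1M _ _ _ _ _ C Lh) => //; exact: measurable_funTS. Qed.

Lemma rectL_tensor W a b c d f g : rectL W a b c d -> bounded_measurable f -> bounded_measurable g ->
  rectL (fun z => W z * (f z.1 * g z.2)) a b c d.
Proof.
move=> L [mf [C HC]] [mg [D HD]].
have L' : leb2.-integrable (rect a b c d) (fun z => ((C * D)%:E * (EFin \o W) z)%E).
  by apply: integrableZl => //; exact: measurable_rect.
apply: le_integrable L' => //; first exact: measurable_rect.
- apply/measurable_EFinP; apply: measurable_funM.
    by have /measurable_EFinP := measurable_int _ L.
  apply: measurable_funTS; apply: measurable_funM.
    by apply: measurableT_comp mf _; exact: measurable_fst.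
  by apply: measurableT_comp mg _; exact: measurable_snd.
- move=> z _ /=; rewrite lee_fin !normrM mulrC ler_wpM2r//.
  rewrite -normrM -[leRHS]normrM !normrM; apply: ler_pM => //.
    by apply: (le_trans (HC _)); exact: ler_norm.
  by apply: (le_trans (HD _)); exact: ler_norm.
Qed.

Lemma rect_tensor W a b c d f g : rectL W a b c d -> bounded_measurable f -> bounded_measurable g ->
  L1 c d (fun y => itg a b (fun x => W (x, y) * f x)) /\
  \int[leb2]_(z in rect a b c d) (W z * (f z.1 * g z.2)) =
    itg c d (fun y => itg a b (fun x => W (x, y) * f x) * g y).
Proof.
move=> L bf bg.
have [H1 H2 _] := rect_fubini2 (rectL_tensor L bf bounded_cst1).
have [_ H3 ->] := rect_fubini2 (rectL_tensor L bf bg).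
have {}H2 : L1 c d (fun y => itg a b (fun x => W (x, y) * f x)).
  by apply: eq_L1 H2 => y _; apply: eq_itg => x _; rewrite /= mulr1.
split => //; apply: itg_ae => //; first exact: L1_Mbounded.
apply: aeS H1 => y Hy /Hy/= Ly.
rewrite [RHS]mulrC -itgZ; first by apply: eq_itg => x _; rewrite mulrA mulrC.
by apply: eq_L1 Ly => x _; rewrite mulr1.
Qed.

Lemma dlim0 x l d : 0 < d -> dlim (fun=> 0) x l -> l = 0.
Proof.
move=> d0 H; apply: (@eq0_small _ 1) => // e e0; have [h h0 Hh] := H e e0.
have := Hh (x + h); rewrite (addrC x) addrK gtr0_norm// => /(_ (lexx _)).
by rewrite subrr sub0r normrN normrM (gtr0_norm h0) ler_pM2r// mul1r.
Qed.

Lemma itg_zero_ae f a : (forall p q, a < p -> p < q -> L1 p q f /\ itg p q f = 0) ->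
  {ae mu, forall y, a < y -> f y = 0}.
Proof.
move=> H; apply: ae_exhaust => b c ab bc.
have [Lf _] := H b c ab bc.
apply: aeS (itg_dlim Lf) => y Hy byc; have /andP[by_ yc] := byc.
have y0 : 0 < y - b by rewrite subr_gt0.
apply: (dlim0 y0 (x := y)); apply: (dlim_local (c := 0) y0 _ (Hy byc)) => z zy.
rewrite addr0; have : b <= z by move: zy; rewrite ler_norml => /andP[+ _]; clear; lra.
by rewrite le_eqVlt => /predU1P[<-|bz]; rewrite ?itgxx// (H _ _ ab bz).2.
Qed.

Local Notation E n := ((n : nat).+1%:R^-1 : R).

Lemma inv_nat_gt0 n : 0 < E n. Proof. by rewrite invr_gt0. Qed.

Lemma inv_nat_le1 n : E n <= 1. Proof. by rewrite invf_le1// ler1n. Qed.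

Section weak_good.
Variables U V : R -> R -> R.
Hypothesis cU : half_continuous U.
Hypothesis LU : forall a b c d, 0 < a + c -> rectL (fun z => U z.1 z.2) a b c d.
Hypothesis LV : forall a b c d, 0 < a + c -> rectL (fun z => V z.1 z.2) a b c d.
Hypothesis LV2 : forall a b c d, 0 < a + c -> rectL (fun z => V z.1 z.2 ^+ 2) a b c d.
Hypothesis weakV : forall a b c d n m, a < b -> c < d -> 0 < a + c ->
  \int[leb2]_(z in rect a (b + 1) c (d + 1))
     (U z.1 z.2 * (plateau' (E n) a b z.1 * plateau (E m) c d z.2)) =
  - \int[leb2]_(z in rect a (b + 1) c (d + 1))
     (V z.1 z.2 * (plateau (E n) a b z.1 * plateau (E m) c d z.2)).

(** The difference of the two sides, as a function of y, is orthogonal to all plateaus in y.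
    Applying [weak_increment] with w = 0 shows that its integral over every interval vanishes. *)
Lemma weak_line a b n : a < b -> {ae mu, forall y, - a < y ->
  itg a (b + 1) (fun x => U x y * plateau' (E n) a b x) =
  - itg a (b + 1) (fun x => V x y * plateau (E n) a b x)}.
Proof.
move=> ab; have ab' := ltW ab; have n0 := inv_nat_gt0 n.
pose f y := itg a (b + 1) (fun x => U x y * plateau' (E n) a b x) +
  itg a (b + 1) (fun x => V x y * plateau (E n) a b x).
suff H : {ae mu, forall y, - a < y -> f y = 0}.
  by apply: aeS H => y Hy /Hy/eqP; rewrite addr_eq0 => /eqP.
apply: itg_zero_ae => c d ac cd.
have ac0 : 0 < a + c by rewrite -ltrBlDl sub0r.
have H m := rect_tensor (LU (b + 1) (d + 1) ac0) (bounded_plateau' a b n0)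
   (bounded_plateau (inv_nat_gt0 m) (ltW cd)).
have H' m := rect_tensor (LV (b + 1) (d + 1) ac0) (bounded_plateau n0 ab')
   (bounded_plateau (inv_nat_gt0 m) (ltW cd)).
have Lf : L1 c (d + 1) f by apply: L1D; [exact: (H 0%N).1|exact: (H' 0%N).1].
split; first by apply: L1S Lf => //; rewrite lerDl.
have R0 x k : 0 < k -> exists2 h, 0 < h & forall r, x < r < x + h -> `|0 - 0 : R| <= k.
  by move=> k0; exists 1 => // r _; rewrite subrr normr0 ltW.
suff H0 m : itg c (d + 1) (fun y => 0 * plateau' (E m) c d y) =
    - itg c (d + 1) (fun y => f y * plateau (E m) c d y).
  by rewrite -(weak_increment cd (L1_cst c (d + 1) 0) Lf (R0 c) (R0 d) H0) subrr.
have [L1 E1] := H m; have [L2 E2] := H' m.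
  have bm := bounded_plateau (inv_nat_gt0 m) (ltW cd).
  transitivity (0 : R); first by rewrite -[RHS](itg0 c (d + 1)); apply: eq_itg => x _; rewrite mul0r.
  have := weakV n m ab cd ac0; rewrite E1 E2 => W.
  rewrite /f (_ : itg _ _ _ = itg c (d + 1) (fun y =>
     itg a (b + 1) (fun x => U x y * plateau' (E n) a b x) * plateau (E m) c d y +
     itg a (b + 1) (fun x => V x y * plateau (E n) a b x) * plateau (E m) c d y)).
    by rewrite itgD ?W ?addNr ?oppr0//; exact: L1_Mbounded.
  by apply: eq_itg => y _; rewrite mulrDl.
Qed.

Lemma weak_increment_ae a b : a < b -> {ae mu, forall y, - a < y ->
  [/\ L1 a b (fun s => V s y), L1 a b (fun s => V s y ^+ 2) &
      U b y - U a y = itg a b (fun s => V s y)]}.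
Proof.
move=> ab; have bb : b <= b + 1 by rewrite lerDl.
have HL (W : T2 -> R) : (forall a b c d, 0 < a + c -> rectL W a b c d) ->
    {ae mu, forall y, - a < y -> L1 a (b + 1) (fun s => W (s, y))}.
  move=> LW; apply: ae_exhaust => c d ac cd.
  have ac0 : 0 < a + c by rewrite -ltrBlDl sub0r.
  have [H _ _] := rect_fubini2 (LW a (b + 1) c d ac0).
  by apply: aeS H => y Hy /andP[cy yd]; apply: Hy; rewrite !ltW.
have := aeI (HL _ LU) (aeI (HL _ LV) (aeI (HL _ LV2) (ae_allC (fun n => weak_line n ab)))).
apply: aeS => y [H1 [H2 [H3 H4]]] ay.
have ay0 : 0 < a + y by rewrite -ltrBlDl sub0r.
have LVy : L1 a (b + 1) (fun s => V s y) := H2 ay.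
have LV2y : L1 a (b + 1) (fun s => V s y ^+ 2) := H3 ay.
split; [by apply: L1S LVy|by apply: L1S LV2y|].
have right x : a <= x -> forall k, 0 < k -> exists2 h, 0 < h &
    forall r, x < r < x + h -> `|U r y - U x y| <= k.
  move=> ax k k0; have xy0 : 0 <= x + y by rewrite (le_trans (ltW ay0))// lerD2r.
  have [h h0 Hh] := cU xy0 k0; exists h => // r /andP[xr rx]; apply: Hh.
  - by rewrite (le_trans xy0)// lerD2r ltW.
  - by rewrite gtr0_norm ?subr_gt0// lerBlDl ltW.
  - by rewrite subrr normr0 ltW.
apply: (@weak_increment _ a b (fun s => U s y)) => //; first exact: H1.
- exact: right.
- by apply: right; exact: ltW.
- by move=> n; exact: H4.
Qed.

(** Rational end points are treated together outside one null set of lines; other end points follow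
    by continuity of U and of the integral in its upper limit. *)
Lemma weak_good : {ae mu, forall y, good U V y}.
Proof.
have H (p : rat * rat) : {ae mu, forall y, ratr p.1 < ratr p.2 :> R -> - ratr p.1 < y ->
   [/\ L1 (ratr p.1) (ratr p.2) (fun s => V s y), L1 (ratr p.1) (ratr p.2) (fun s => V s y ^+ 2) &
      U (ratr p.2) y - U (ratr p.1) y = itg (ratr p.1) (ratr p.2) (fun s => V s y)]}.
  have [pp|pp] := ltP (ratr p.1 : R) (ratr p.2); last exact: aeW.
  by apply: aeS (weak_increment_ae pp) => y Hy _; exact: Hy.
apply: aeS (ae_allC H) => y {}H a b ab ay.
have ya : - y < a by rewrite -subr_gt0 opprK.
have [p] := rat_in_itvoo ya; rewrite in_itv/= => /andP[yp pa].
have b1 : b < b + 1 by rewrite ltrDl.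
have [q] := rat_in_itvoo b1; rewrite in_itv/= => /andP[bq _].
have yp' : - ratr p < y by rewrite ltrNl.
have pq : ratr p < ratr q :> R by rewrite (lt_le_trans pa)// (le_trans ab)// ltW.
have [L L2 _] := H (p, q) pq yp'; rewrite /= in L L2.
split; [by apply: L1S L; exact: ltW|by apply: L1S L2; exact: ltW|].
have inc x : ratr p < x -> x <= b -> U x y - U (ratr p) y = itg (ratr p) x (fun s => V s y).
  move=> px xb; apply/eqP; rewrite -subr_eq0; apply/eqP; apply: (@eq0_small _ 2) => // e e0.
  have xy0 : 0 <= x + y by rewrite -lerBlDr sub0r (le_trans (ltW yp))// ltW.
  have [d1 d10 H1] := cU xy0 e0; have [d2 d20 H2] := itg_small L e0.
  have qb : 0 < ratr q - x by rewrite subr_gt0 (le_lt_trans xb).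
  have [d3 [d30 d31 d32]] := ex_min2 d10 d20; have [d [d0 dd3 dq]] := ex_min2 d30 qb.
  have xd : x < x + d by rewrite ltrDl.
  have [r] := rat_in_itvoo xd; rewrite in_itv/= => /andP[xr rd].
  have rq : ratr r <= ratr q :> R by rewrite (le_trans (ltW rd))// -lerBrDl.
  have rx : ratr r - x <= d by rewrite lerBlDl ltW.
  have pr : ratr p < ratr r :> R := lt_trans px xr.
  have [Lr _ /= Er] := H (p, r) pr yp'; rewrite /= in Lr.
  have A1 : `|U (ratr r) y - U x y| <= e.
    apply: H1; [by rewrite (le_trans xy0)// lerD2r ltW| |by rewrite subrr normr0 ltW].
    by rewrite gtr0_norm ?subr_gt0// (le_trans rx)// (le_trans dd3).
  have A2 : `|itg x (ratr r) (fun s => V s y)| <= e.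
    apply: (le_trans (itg_norm (L1S (ltW px) rq L))); apply: H2 => //.
    + exact: ltW.
    + exact: ltW.
    + by rewrite (le_trans rx)// (le_trans dd3).
  rewrite (itg_cat (ltW px) (ltW xr) Lr) in Er.
  have arith (A B C D F : R) : `|A - B| <= e -> `|D| <= e -> A - C = F + D -> `|B - C - F| <= 2 * e.
    clear; rewrite !ler_norml => /andP[h1 h2] /andP[h3 h4] h5; apply/andP; split; lra.
  exact: arith A1 A2 Er.
have Lb : L1 (ratr p) b (fun s => V s y) by apply: L1S L => //; exact: ltW.
have := inc b (lt_le_trans pa ab) (lexx b); rewrite (itg_cat (ltW pa) ab Lb) -(inc a pa ab).
by clear; lra.
Qed.

End weak_good.

End tensor_integrals.

(** * Rectangle increments from mixed second derivatives *)

Section corners.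
Variable R : realType.
Local Notation mu := (@lebesgue_measure R).
Local Notation T2 := (measurableTypeR R * measurableTypeR R)%type.
Variable U : R -> R -> R.
Hypothesis cU : half_continuous U.
Hypothesis LU : forall a b c d, 0 < a + c -> rectL (fun z : T2 => U z.1 z.2) a b c d.

Lemma L1_section a b y : 0 < a + y -> L1 a b (fun x => U x y).
Proof.
move=> ay; apply: L1_continuous; apply/subspace_continuousP => x /=.
rewrite in_itv/= => /andP[ax xb]; apply/cvgrPdist_le => e e0.
have xy0 : 0 <= x + y by rewrite (le_trans (ltW ay))// lerD2r.
have [d d0 H] := cU xy0 e0.
rewrite near_withinE; near=> z => /=; rewrite in_itv/= => /andP[az zb].
rewrite distrC; apply: H; [by rewrite (le_trans (ltW ay))// lerD2r| |by rewrite subrr normr0 ltW].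
by rewrite distrC; near: z; exact: (@cvgr_dist_le _ R^o _ _ _ id x cvg_id d d0).
Unshelve. all: by end_near. Qed.

(** The product of the two [plateau'] is a combination of four smoothed point masses at the corners,
    with the signs of [rect_inc]. The descending ramps start at b - e and d - e so that the support
    stays inside the rectangle, the only place where [char_free] supposes U > 0. *)
Lemma corner_limit a b c d k : a < b -> c < d -> 0 < a + c -> 0 < k -> exists2 e, 0 < e &
  [/\ a + e <= b, c + e <= d &
    `|\int[leb2]_(z in rect a b c d)
       (U z.1 z.2 * (plateau' e a (b - e) z.1 * plateau' e c (d - e) z.2)) - rect_inc U a b c d|
    <= 4 * k].
Proof.
move=> ab cd ac k0.
have bc : 0 < b + c by rewrite (lt_trans ac)// ltrD2r.
have ad : 0 < a + d by rewrite (lt_trans ac)// ltrD2l.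
have bd : 0 < b + d by rewrite (lt_trans bc)// ltrD2l.
have [d1 d10 H1] := cU (ltW ac) k0; have [d2 d20 H2] := cU (ltW bc) k0.
have [d3 d30 H3] := cU (ltW ad) k0; have [d4 d40 H4] := cU (ltW bd) k0.
have ba0 : 0 < b - a by rewrite subr_gt0.
have dc0 : 0 < d - c by rewrite subr_gt0.
have [g1 [g10 g11 g12]] := ex_min2 d10 d20; have [g2 [g20 g21 g22]] := ex_min2 d30 d40.
have [g3 [g30 g31 g32]] := ex_min2 g10 g20; have [g4 [g40 g41 g42]] := ex_min2 ba0 dc0.
have [e [e0 e3 e4]] := ex_min2 g30 g40.
have ee1 := le_trans e3 (le_trans g31 g11); have ee2 := le_trans e3 (le_trans g31 g12).
have ee3 := le_trans e3 (le_trans g32 g21); have ee4 := le_trans e3 (le_trans g32 g22).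
have eab := le_trans e4 g41; have ecd := le_trans e4 g42.
have aeb : a + e <= b by rewrite -lerBrDl.
have ced : c + e <= d by rewrite -lerBrDl.
have abe : a <= b - e by rewrite lerBrDr.
have cde : c <= d - e by rewrite lerBrDr.
exists e => //; split => //.
have [LJ ->] := rect_tensor (LU b d ac) (bounded_plateau' a (b - e) e0) (bounded_plateau' c (d - e) e0).
move: LJ => /=; set J := fun y => itg a b _ => LJ.
have near_itv x r : x < r < x + e -> `|r - x| <= e.
  by move=> /andP[h1 h2]; rewrite gtr0_norm ?subr_gt0// lerBlDl ltW.
have near_itv' x r : x - e < r < x - e + e -> `|r - x| <= e.
  move=> /andP[h1 h2]; rewrite ler_norml; move: h1 h2; clear => h1 h2; apply/andP; split; lra.
have JE y (l m : R) : c <= y -> (forall x, a < x < a + e -> `|U x y - l| <= k) ->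
    (forall x, b - e < x < b - e + e -> `|U x y - m| <= k) -> `|J y - (l - m)| <= k + k.
  move=> cy Hl Hm; have Ly : L1 a b (fun x => U x y).
    by apply: L1_section; rewrite (lt_le_trans ac)// lerD2l.
  have -> : J y = itg a b (fun x => U x y * ramp' e a x) - itg a b (fun x => U x y * ramp' e (b - e) x).
    by rewrite -itgB; [apply: eq_itg => x _; rewrite mulrBr|exact: L1_Mramp'|exact: L1_Mramp'].
  have arith2 (X Y : R) : `|X - l| <= k -> `|Y - m| <= k -> `|X - Y - (l - m)| <= k + k.
    move=> X1 X2; have -> : X - Y - (l - m) = (X - l) - (Y - m) by ring.
    by apply: (le_trans (ler_normB _ _)); exact: lerD.
  apply: arith2; first exact: ramp_mean_near.
  by apply: ramp_mean_near => //; rewrite subrK.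
have -> : itg c d (fun y => J y * plateau' e c (d - e) y) =
    itg c d (fun y => J y * ramp' e c y) - itg c d (fun y => J y * ramp' e (d - e) y).
  by rewrite -itgB; [apply: eq_itg => y _; rewrite mulrBr|exact: L1_Mramp'|exact: L1_Mramp'].
have A1 : `|itg c d (fun y => J y * ramp' e c y) - (U a c - U b c)| <= k + k.
  apply: ramp_mean_near => // y yc; have /andP[cy yce] := yc.
  have yd := near_itv _ _ yc.
  apply: JE => [|x xa|x xb]; first exact: ltW.
    apply: H1; [|exact: le_trans (near_itv _ _ xa) ee1|exact: le_trans yd ee1].
    by apply: (le_trans (ltW ac)); apply: lerD; apply: ltW => //; case/andP: xa.
  apply: H2; [|exact: le_trans (near_itv' _ _ xb) ee2|exact: le_trans yd ee2].
  apply: (le_trans (ltW ac)); apply: lerD; apply: ltW => //; case/andP: xb => xb _.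
  exact: le_lt_trans xb.
have A2 : `|itg c d (fun y => J y * ramp' e (d - e) y) - (U a d - U b d)| <= k + k.
  apply: ramp_mean_near => //; first by rewrite subrK.
  move=> y yc; have yd := near_itv' _ _ yc; have /andP[cy yce] := yc.
  have {}cy := le_lt_trans cde cy.
  apply: JE => [|x xa|x xb]; first exact: ltW.
    apply: H3; [|exact: le_trans (near_itv _ _ xa) ee3|exact: le_trans yd ee3].
    by apply: (le_trans (ltW ac)); apply: lerD; apply: ltW => //; case/andP: xa.
  apply: H4; [|exact: le_trans (near_itv' _ _ xb) ee4|exact: le_trans yd ee4].
  apply: (le_trans (ltW ac)); apply: lerD; apply: ltW => //; case/andP: xb => xb _.
  exact: le_lt_trans xb.
rewrite /rect_inc.
have arith (X Y p q r s : R) : `|X - (p - q)| <= k + k -> `|Y - (r - s)| <= k + k ->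
    `|X - Y - (s - r - q + p)| <= 4 * k.
  clear; rewrite !ler_norml => /andP[a1 a2] /andP[b1 b2]; apply/andP; split; lra.
exact: arith A1 A2.
Qed.

End corners.

(** * Transfer of integrals and continuity to characteristic rectangles *)

Section interface.
Variable R : realType.
Local Notation mu := (@lebesgue_measure R).
Local Notation T2 := (measurableTypeR R * measurableTypeR R)%type.
Implicit Types (a b c d e k x y : R) (f g : R -> R).

Lemma of_char_upper x y : upper (of_char (x, y)) <-> 0 < x + y.
Proof. by rewrite /upper/= pmulr_lgt0// invr_gt0 sqrt2_gt0. Qed.

Lemma of_char_cupper x y : cupper (of_char (x, y)) <-> 0 <= x + y.
Proof. by rewrite /cupper/= pmulr_lge0// invr_gt0 sqrt2_gt0. Qed.

Lemma within_continuous_char (u : R * R -> R) : {within @cupper R, continuous u} ->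
  half_continuous (fun x y => u (of_char (x, y))).
Proof.
move=> /subspace_continuousP cu x y xy e e0.
have := cu (of_char (x, y)) ((of_char_cupper x y).2 xy).
move=> /cvgrPdist_le/(_ e e0); rewrite near_withinE => H.
have /nbhs_ballP[d /= d0 Hd] := @of_char_continuous R (x, y) _ H.
have d2 : 0 < d / 2 by rewrite divr_gt0.
have lt2 (r : R) : r <= d / 2 -> r < d by move=> h; apply: (le_lt_trans h); rewrite ltr_pdivrMr// ltr_pMr// ltr1n.
exists (d / 2) => // x' y' xy' xx yy; rewrite distrC; apply: (Hd (x', y')).
  by split; rewrite /ball/= distrC; exact: lt2.
exact/of_char_cupper.
Qed.

Lemma open_measurable2 (A : set (R * R)) : open A -> measurable (A : set T2).
Proof.
move=> oA.
pose box (p q r s : rat) : set T2 := `]ratr p, ratr q[%classic `*` `]ratr r, ratr s[%classic.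
pose F p q r s : set T2 := if `[< box p q r s `<=` A >] then box p q r s else set0.
rewrite (_ : A = \bigcup_p \bigcup_q \bigcup_r \bigcup_s F p q r s).
  apply: bigcupT_measurable_rat => p; apply: bigcupT_measurable_rat => q.
  apply: bigcupT_measurable_rat => r; apply: bigcupT_measurable_rat => s.
  rewrite /F; case: ifP => _; last exact: measurable0.
  by apply: measurableX; exact: measurable_itv.
apply/seteqP; split => [[x y] Axy|z [p _ [q _ [r _ [s _]]]]]; last first.
  by rewrite /F; case: asboolP => // H; exact: H.
have /nbhs_ballP[e /= e0 He] := open_nbhs_nbhs (conj oA Axy).
have l z : z - e < z by rewrite gtrBl.
have u z : z < z + e by rewrite ltrDl.
have [p] := rat_in_itvoo (l x); rewrite in_itv/= => /andP[p1 p2].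
have [q] := rat_in_itvoo (u x); rewrite in_itv/= => /andP[q1 q2].
have [r] := rat_in_itvoo (l y); rewrite in_itv/= => /andP[r1 r2].
have [s] := rat_in_itvoo (u y); rewrite in_itv/= => /andP[s1 s2].
exists p => //; exists q => //; exists r => //; exists s => //.
rewrite /F asboolT; first by split; rewrite /= in_itv/= ?p2 ?q1 ?r2 ?s1.
move=> [x' y'] [] /=; rewrite !in_itv/= => /andP[px xq] /andP[ry ys]; apply: He.
split; rewrite /ball/= ltr_distlC; apply/andP; split.
- exact: lt_trans px.
- exact: lt_trans xq _.
- exact: lt_trans ry.
- exact: lt_trans ys _.
Qed.

Lemma continuous_measurable2 (f : R * R -> R) : continuous f ->
  measurable_fun [set: T2] (f : T2 -> R).
Proof.
move=> /continuousP cf; apply: (measurability _ (RGenOpens.measurableE R)).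
move=> _ [_ [a [b ->] <-]]; rewrite setTI; apply: open_measurable2; apply: cf; exact: interval_open.
Qed.

Lemma max_dist (x y k : R) : `|Num.max x k - Num.max y k| <= `|x - y|.
Proof.
have := ler_norm (x - y); have := ler_norm (y - x); rewrite distrC.
by case: (leP x k); case: (leP y k) => h1 h2; rewrite ?subrr ?normr0 ?normr_ge0// => h3 h4;
  rewrite ler_norml; apply/andP; split; lra.
Qed.

Lemma leb2_rect a b c d : (leb2 (rect a b c d) < +oo)%E.
Proof.
have -> : leb2 (rect a b c d) = (mu `[a, b] * mu `[c, d])%E.
  by apply: product_measure1E; exact: measurable_itv.
by apply: lte_mul_pinfty; rewrite ?measure_ge0// ?ge0_fin_numE// ?lebesgue_measure_itv//=; case: ifP => _; rewrite ?ltry// -EFinB ltry.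
Qed.

Section continuous_part.
Variable U : R -> R -> R.
Hypothesis cU : half_continuous U.

Lemma rectL_continuous a b c d : 0 < a + c -> rectL (fun z : T2 => U z.1 z.2) a b c d.
Proof.
(* Clamping the coordinates from below extends U from the rectangle to a continuous function on the
   whole plane, as a + c > 0. *)
move=> ac; pose f (z : R * R) := U (Num.max z.1 a) (Num.max z.2 c).
have cf : continuous f.
  move=> z; apply/cvgrPdist_le => e e0.
  have pos (z' : R * R) : 0 <= Num.max z'.1 a + Num.max z'.2 c.
    by apply: (le_trans (ltW ac)); apply: lerD; rewrite le_max lexx orbT.
  have [h h0 H] := cU (pos z) e0.
  near=> z'; rewrite distrC; apply: H => //.
  - apply: (le_trans (max_dist _ _ _)); rewrite distrC; near: z'.
    exact: (@cvgr_dist_le _ R^o _ _ _ fst z.1 cvg_fst h h0).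
  - apply: (le_trans (max_dist _ _ _)); rewrite distrC; near: z'.
    exact: (@cvgr_dist_le _ R^o _ _ _ snd z.2 cvg_snd h h0).
have L : rectL f a b c d.
  apply: measurable_bounded_integrable.
  - exact: measurable_rect.
  - exact: leb2_rect.
  - by apply: measurable_funTS; exact: continuous_measurable2.
  - have cK : compact (f @` (`[a, b]%classic `*` `[c, d]%classic)).
      apply: continuous_compact; first exact: continuous_subspaceT.
      by apply: compact_setX; exact: segment_compact.
    have [M [Mr HM]] := compact_bounded cK.
    by exists M; split => // C MC z zr; apply: HM MC _ _; exists z.
apply: eq_integrable L; first exact: measurable_rect.
move=> [x y]; rewrite inE => /rectE[/andP[ax _] /andP[cy _]].
by rewrite /= /f/= !max_l.
Unshelve. all: by end_near. Qed.

End continuous_part.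

Lemma upper_to_rect (h : R * R -> R) (K : T2 -> R) a b c d : 0 < a + c -> rectL K a b c d ->
  (forall x y, a <= x <= b -> c <= y <= d -> h (of_char (x, y)) = K (x, y)) ->
  (forall x y, 0 < x + y -> ~ (a <= x <= b /\ c <= y <= d) -> h (of_char (x, y)) = 0) ->
  \int[leb2]_(z in @upper R) h z = \int[leb2]_(z in rect a b c d) K z.
Proof.
move=> ac LK hK h0.
have E (z : T2) : (h \_ (@upper R)) (of_char z) = (K \_ (rect a b c d)) z.
  case: z => x y; rewrite !patchE; have [/rectE xy|nxy] := pselect (rect a b c d (x, y)).
    rewrite (mem_set (A := rect a b c d)); last exact/rectE.
    have [xab ycd] := xy; rewrite mem_set ?hK//; apply/of_char_upper.
    move: xab ycd => /andP[ax _] /andP[cy _].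
    by apply: (lt_le_trans ac); exact: lerD.
  rewrite (memNset nxy); case: ifPn => //; rewrite inE => /of_char_upper xy.
  by apply: h0 => // H; apply: nxy; exact/rectE.
rewrite [LHS]Rintegral_mkcond [RHS]Rintegral_mkcond /Rintegral; congr fine.
rewrite -(@integral_of_char _ (EFin \o (h \_ (@upper R)))).
  by apply: eq_integral => z _; rewrite /= E.
rewrite (_ : h \_ (@upper R) = (K \_ (rect a b c d)) \o @to_char R).
  apply/measurable_EFinP; apply: measurableT_comp (@measurable_to_char R).
  by have /measurable_EFinP := measurable_int _ (rectL_patch LK).
by apply/funext => z; rewrite /= -E to_charK.
Qed.

End interface.

(** * Integrability of the energy on characteristic rectangles *)

Section solution.
Variable R : realType.
Local Notation mu := (@lebesgue_measure R).
Local Notation TR := (measurableTypeR R).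
Local Notation T2 := (TR * TR)%type.
Implicit Types (a b c d e k x y : R) (f g : R -> R).
Local Notation s2 := (Num.sqrt 2 : R).

Lemma measurable_upper : measurable (@upper R : set T2).
Proof.
rewrite (_ : @upper R = [set: TR] `*` `]0, +oo[%classic); first by apply: measurableX => //; exact: measurable_itv.
by apply/seteqP; split => -[x y] /=; rewrite /upper/= in_itv/= andbT; [split|case].
Qed.

Lemma measurable_char_rect (h : R * R -> R) a b c d : 0 < a + c ->
  measurable_fun (@upper R : set T2) h -> measurable_fun (rect a b c d) (fun z => h (of_char z)).
Proof.
move=> ac mh; apply: (measurable_comp measurable_upper _ mh).
  move=> _ [[x y] /rectE[/andP[ax _] /andP[cy _]] <-]; apply/of_char_upper.
  by apply: (lt_le_trans ac); exact: lerD.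
by apply: measurable_funTS; exact: measurable_of_char.
Qed.

Lemma continuous_line (u : R * R -> R) y : {within @cupper R, continuous u} -> 0 <= y ->
  continuous (fun x => u (x, y)).
Proof.
move=> /subspace_continuousP cu y0 x; apply/cvgrPdist_le => e e0.
have := cu (x, y) y0 => /cvgrPdist_le/(_ e e0); rewrite near_withinE => H.
have /nbhs_ballP[d /= d0 Hd] := H.
near=> x'; apply: (Hd (x', y)) => //.
split; last exact: ballxx.
by near: x'; exact: (nbhsx_ballx x d d0).
Unshelve. all: by end_near. Qed.

Definition strip (k0 k1 T : R) : set T2 := `[k0, k1]%classic `*` `]0, T[%classic.

Section energy.
Variables (u ux ut : R * R -> R).
Hypothesis hclass : energy_class u ux ut.

Let cu : {within @cupper R, continuous u}. Proof. by case: hclass. Qed.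
Let mux : measurable_fun (@upper R : set T2) ux. Proof. by case: hclass. Qed.
Let mut : measurable_fun (@upper R : set T2) ut. Proof. by case: hclass. Qed.

Let q (z : T2) : R := ux z ^+ 2 + ut z ^+ 2.

Let mq : measurable_fun (@upper R : set T2) q.
Proof. by apply: measurable_funD; apply: measurable_funX. Qed.

Let q0 z : 0 <= q z. Proof. by rewrite addr_ge0 ?sqr_ge0. Qed.

Lemma strip_energy (k0 k1 T : R) : 0 < T ->
  (\int[leb2]_z ((EFin \o q) \_ (strip k0 k1 T)) z < +oo)%E.
Proof.
move=> T0; set S := strip k0 k1 T.
have mS : measurable (S : set T2) by apply: measurableX; exact: measurable_itv.
have SU : S `<=` @upper R by move=> [x y] [_] /=; rewrite in_itv/= => /andP[].
have mG : measurable_fun setT ((EFin \o q) \_ S).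
  apply/(measurable_restrictT _ mS); apply/measurable_EFinP.
  exact: measurable_funS measurable_upper SU mq.
have [_ _ _ _ /(_ `[k0, k1]%classic T (@segment_compact _ k0 k1) T0) [C HC]] := hclass.
rewrite /leb2 fubini_tonelli2//; last by move=> z; rewrite patchE; case: ifP => // _; rewrite lee_fin.
have C0 : (\int[mu]_y (((Num.max C 0)%:E) * (\1_(`]0%R, T[%classic : set TR) y)%:E)%E < +oo)%E.
  rewrite ge0_integralZl//.
  - have -> : (\int[mu]_y (\1_(`]0%R, T[%classic : set TR) y : R)%:E = mu `]0%R, T[%classic)%E.
      by rewrite integral_indic// setIT.
    by rewrite lebesgue_measure_itv/= lte_fin T0 -EFinB -EFinM ltry.
  - by apply/measurable_EFinP; exact: measurable_indic.
  - by rewrite lee_fin le_max lexx orbT.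
apply: le_lt_trans C0; apply: ae_ge0_le_integral => //.
- by move=> y _; apply: integral_ge0 => x _; rewrite patchE; case: ifP => // _; rewrite lee_fin.
- apply: measurable_fun_fubini_tonelli_G => // z.
  by rewrite patchE; case: ifP => // _; rewrite lee_fin.
- by move=> y _; rewrite mule_ge0 ?lee_fin ?le_max ?lexx ?orbT.
- by apply: measurable_funeM; apply/measurable_EFinP; exact: measurable_indic.
apply: aeS HC => y Hy _; rewrite /fubini_G indicE.
have [yT|yT] := boolP (y \in `]0%R, T[%classic); last first.
  rewrite mule0 integral0_eq// => x _; rewrite patchE memNset// => -[_ /= yS].
  by move: yT; rewrite notin_setE.
rewrite mule1; move: yT; rewrite inE/= in_itv/= => yT; have /andP[y0 yT'] := yT.
apply: (@le_trans _ _ C%:E); last by rewrite lee_fin le_max lexx.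
apply: le_trans (Hy yT).
rewrite (_ : (fun x => _) = (EFin \o (fun x => q (x, y))) \_ `[k0, k1]); last first.
  apply/funext => x; rewrite !patchE; have [xk|xk] := boolP (x \in `[k0, k1]%classic).
    rewrite mem_set//; split; first by move: xk; rewrite inE.
    by rewrite /= in_itv.
  by rewrite memNset// => -[/= H _]; move: xk; rewrite notin_setE.
rewrite -integral_mkcond.
have mline (h : T2 -> R) : measurable_fun (@upper R : set T2) h -> measurable_fun `[k0, k1] (fun x => h (x, y)).
  move=> mh; apply: (measurable_comp measurable_upper _ mh).
    by move=> _ [x _ <-].
  by apply: measurable_funTS; exact: measurable_pair2.
apply: ge0_le_integral => //.
- by move=> x _; rewrite lee_fin.
- by apply/measurable_EFinP; exact: mline mq.
- apply/measurable_EFinP; apply: measurable_funD; last by apply: measurable_funX; exact: mline mut.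
  apply: measurable_funD; last by apply: measurable_funX; exact: mline mux.
  apply: measurable_funX; apply: measurable_funTS; apply: continuous_measurable_fun.
  exact: continuous_line (ltW y0).
- by move=> x _; rewrite lee_fin /q -addrA lerDr sqr_ge0.
Qed.

Lemma rectL_energy a b c d : 0 < a + c -> rectL (fun z => q (of_char z)) a b c d.
Proof.
move=> ac; have mr := measurable_rect a b c d.
apply/integrableP; split; first by apply/measurable_EFinP; exact: measurable_char_rect.
(* As a + c > 0, the rectangle is empty if b + d <= 0. Otherwise its image lies in a strip of
   positive height; the added 1 is for the strip being open at the top. *)
have [bd|bd] := ltP 0 (b + d); last first.
  rewrite (_ : rect a b c d = set0) ?integral_set0 ?ltry//.
  apply/seteqP; split => // -[x y] /rectE[/andP[h1 h2] /andP[h3 h4]] /=.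
  have := lerD (le_trans h1 h2) (le_trans h3 h4).
  by rewrite leNgt => /negP; apply; exact: le_lt_trans ac.
have T0 : 0 < (b + d) / s2 + 1 by rewrite addr_gt0// divr_gt0// sqrt2_gt0.
apply: le_lt_trans (strip_energy ((a - d) / s2) ((b - c) / s2) T0).
set S := strip _ _ _.
have mS : measurable (S : set T2) by apply: measurableX; exact: measurable_itv.
have SU : S `<=` @upper R by move=> [x y] [_] /=; rewrite in_itv/= => /andP[].
have mG : measurable_fun setT ((EFin \o q) \_ S).
  apply/(measurable_restrictT _ mS); apply/measurable_EFinP.
  exact: measurable_funS measurable_upper SU mq.
have G0 z : (0 <= ((EFin \o q) \_ S) z)%E by rewrite patchE; case: ifP => // _; rewrite lee_fin.
rewrite -(ge0_integral_of_char mG)// integral_mkcond; apply: ge0_le_integral => //.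
- by move=> z _; rewrite patchE; case: ifP => // _; rewrite /= lee_fin.
- apply/(measurable_restrictT _ mr); apply: measurableT_comp => //.
  by apply/measurable_EFinP; exact: measurable_char_rect.
- by apply: measurableT_comp mG (@measurable_of_char R).
move=> [x y] _; rewrite patchE; case: ifPn => [|_] //.
rewrite inE => /rectE[/andP[ax xb] /andP[cy yd]].
rewrite patchE mem_set; first by rewrite /= ger0_norm.
split; rewrite /= in_itv/=.
  by rewrite !ler_pM2r ?invr_gt0 ?sqrt2_gt0// !lerB.
rewrite divr_gt0 ?sqrt2_gt0//; last by apply: (lt_le_trans ac); exact: lerD.
apply: (@le_lt_trans _ _ ((b + d) / s2)); last by rewrite ltrDl.
by rewrite ler_pM2r ?invr_gt0 ?sqrt2_gt0// lerD.
Qed.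

Lemma rectL_le_energy (h : R * R -> R) a b c d : 0 < a + c -> measurable_fun (@upper R : set T2) h ->
  (forall z, `|h z| <= q z + 1) -> rectL (fun z => h (of_char z)) a b c d.
Proof.
move=> ac mh hq; have mr := measurable_rect a b c d.
have L1r : rectL (fun=> 1) a b c d.
  apply: measurable_bounded_integrable => //; first exact: leb2_rect.
  by exists 1; split => // M M1 z _; rewrite normr1 ltW.
have := integrableD mr (rectL_energy b d ac) L1r.
apply: le_integrable => //; first by apply/measurable_EFinP; exact: measurable_char_rect.
by move=> z _ /=; rewrite lee_fin (le_trans (hq _))// ler_norm.
Qed.

End energy.

End solution.

(** * The wave solution as a solution in characteristic variables *)

Section characteristic_solution.
Variable R : realType.
Local Notation mu := (@lebesgue_measure R).
Local Notation T2 := (measurableTypeR R * measurableTypeR R)%type.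
Implicit Types (a b c d e k x y : R) (f g : R -> R).
Local Notation s2 := (Num.sqrt 2 : R).

Lemma s2_sqr_div (t : R) : (t / s2) ^+ 2 = t ^+ 2 / 2.
Proof. by rewrite expr_div_n [s2 ^+ 2]expr2 sqr_sqrt2. Qed.

Lemma ge0_near (X Y k : R) : `|X - 2 * Y| <= 8 * (k / 4) -> 0 <= X -> 0 <= Y + k.
Proof. by rewrite ler_norml => /andP[h1 h2] h3; lra. Qed.

Lemma d_xi_sqr_le (ux ut : R * R -> R) z : d_xi ux ut z ^+ 2 <= ux z ^+ 2 + ut z ^+ 2.
Proof. by rewrite s2_sqr_div; have := sqr_ge0 (ut z - ux z); lra. Qed.

Lemma d_eta_sqr_le (ux ut : R * R -> R) z : d_eta ux ut z ^+ 2 <= ux z ^+ 2 + ut z ^+ 2.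
Proof. by rewrite s2_sqr_div; have := sqr_ge0 (ut z + ux z); lra. Qed.

Lemma Rintegral2Zl (W : T2 -> R) (A : set T2) k : measurable A -> leb2.-integrable A (EFin \o W) ->
  \int[leb2]_(z in A) (k * W z) = k * \int[leb2]_(z in A) W z.
Proof. by move=> mA LW; exact: RintegralZl. Qed.

Variables (u ux ut : R * R -> R).
Hypothesis hclass : energy_class u ux ut.

Let mux : measurable_fun (@upper R : set T2) ux. Proof. by case: hclass. Qed.
Let mut : measurable_fun (@upper R : set T2) ut. Proof. by case: hclass. Qed.

Lemma measurable_d_xi : measurable_fun (@upper R : set T2) (d_xi ux ut).
Proof. by apply: measurable_funM => //; exact: measurable_funD. Qed.

Lemma measurable_d_eta : measurable_fun (@upper R : set T2) (d_eta ux ut).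
Proof. by apply: measurable_funM => //; exact: measurable_funB. Qed.

Definition char_u x y := u (of_char (x, y)).
Definition char_v x y := d_xi ux ut (of_char (x, y)).
Definition char_p x y := d_eta ux ut (of_char (x, y)).

Lemma char_u_cont : half_continuous char_u.
Proof. by case: hclass => cu _ _ _ _; exact: within_continuous_char. Qed.

Lemma rectL_u a b c d : 0 < a + c -> rectL (fun z : T2 => char_u z.1 z.2) a b c d.
Proof. exact: rectL_continuous char_u_cont _ _ _ _. Qed.

Let rectL_pair (h : R * R -> R) a b c d : rectL (fun z => h (of_char z)) a b c d ->
  rectL (fun z : T2 => h (of_char (z.1, z.2))) a b c d.
Proof. by rewrite /rectL; congr (_.-integrable _ _); apply/funext => -[]. Qed.

Lemma rectL_ux a b c d : 0 < a + c -> rectL (fun z : T2 => ux (of_char (z.1, z.2))) a b c d.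
Proof.
move=> ac; apply/rectL_pair/(rectL_le_energy hclass) => // z.
by apply: (le_trans (norm_le_sqr _)); rewrite lerD2r lerDl sqr_ge0.
Qed.

Lemma rectL_ut a b c d : 0 < a + c -> rectL (fun z : T2 => ut (of_char (z.1, z.2))) a b c d.
Proof.
move=> ac; apply/rectL_pair/(rectL_le_energy hclass) => // z.
by apply: (le_trans (norm_le_sqr _)); rewrite lerD2r lerDr sqr_ge0.
Qed.

Lemma rectL_v a b c d : 0 < a + c -> rectL (fun z : T2 => char_v z.1 z.2) a b c d.
Proof.
move=> ac; apply/rectL_pair/(rectL_le_energy hclass) => //; first exact: measurable_d_xi.
by move=> z; apply: (le_trans (norm_le_sqr _)); rewrite lerD2r d_xi_sqr_le.
Qed.

Lemma rectL_p a b c d : 0 < a + c -> rectL (fun z : T2 => char_p z.1 z.2) a b c d.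
Proof.
move=> ac; apply/rectL_pair/(rectL_le_energy hclass) => //; first exact: measurable_d_eta.
by move=> z; apply: (le_trans (norm_le_sqr _)); rewrite lerD2r d_eta_sqr_le.
Qed.

Lemma rectL_v2 a b c d : 0 < a + c -> rectL (fun z : T2 => char_v z.1 z.2 ^+ 2) a b c d.
Proof.
move=> ac; apply: (rectL_pair (h := fun z => d_xi ux ut z ^+ 2)).
apply: (rectL_le_energy hclass (h := fun z => d_xi ux ut z ^+ 2) _ _ ac).
  by apply: measurable_funX; exact: measurable_d_xi.
move=> z; rewrite ger0_norm ?sqr_ge0//; apply: (le_trans (d_xi_sqr_le _ _ _)).
by rewrite lerDl.
Qed.

Lemma rectL_p2 a b c d : 0 < a + c -> rectL (fun z : T2 => char_p z.1 z.2 ^+ 2) a b c d.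
Proof.
move=> ac; apply: (rectL_pair (h := fun z => d_eta ux ut z ^+ 2)).
apply: (rectL_le_energy hclass (h := fun z => d_eta ux ut z ^+ 2) _ _ ac).
  by apply: measurable_funX; exact: measurable_d_eta.
move=> z; rewrite ger0_norm ?sqr_ge0//; apply: (le_trans (d_eta_sqr_le _ _ _)).
by rewrite lerDl.
Qed.

Section identities.
Variables (e e' a b B c d D : R).
Hypotheses (e0 : 0 < e) (e'0 : 0 < e') (ab : a <= b) (cd : c <= d) (bB : b + e <= B) (dD : d + e' <= D)
  (ac : 0 < a + c).
Local Notation f := (plateau e a b).
Local Notation f' := (plateau' e a b).
Local Notation g := (plateau e' c d).
Local Notation g' := (plateau' e' c d).
Local Notation I W h k := (\int[leb2]_(z in rect a B c D) (W z.1 z.2 * (h z.1 * k z.2))).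

Let bf : bounded_measurable f. Proof. exact: bounded_plateau. Qed.
Let bf' : bounded_measurable f'. Proof. exact: bounded_plateau'. Qed.
Let bg : bounded_measurable g. Proof. exact: bounded_plateau. Qed.
Let bg' : bounded_measurable g'. Proof. exact: bounded_plateau'. Qed.
Let df := is_derive_plateau e a b.
Let dg := is_derive_plateau e' c d.
Let mr : measurable (rect a B c D : set T2). Proof. exact: measurable_rect. Qed.

Let supp x y : ~ (a <= x <= B /\ c <= y <= D) ->
  [/\ f x * g y = 0, f' x * g y = 0, f x * g' y = 0 & f' x * g' y = 0].
Proof.
move=> H; have [xB|/(plateau_supp e0 ab bB)[-> ->]] := pselect (a <= x <= B); last by rewrite !mul0r.
have [yD|/(plateau_supp e'0 cd dD)[-> ->]] := pselect (c <= y <= D); last by rewrite !mulr0.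
by exfalso; apply: H.
Qed.

Lemma plateau_test Omega : (forall x y, a <= x <= B -> c <= y <= D -> Omega (of_char (x, y))) ->
  test_function Omega (char_tensor f g).
Proof.
apply: char_tensor_test; [exact: smooth1_plateau|exact: smooth1_plateau| |].
  by move=> x /(plateau_supp e0 ab bB)[].
by move=> x /(plateau_supp e'0 cd dD)[].
Qed.

Lemma plateau_test_upper : test_function (@upper R) (char_tensor f g).
Proof.
apply: plateau_test => x y /andP[ax _] /andP[cy _]; apply/of_char_upper.
by apply: (lt_le_trans ac); exact: lerD.
Qed.

Lemma weak_id (v : R * R) (w : R * R -> R) (k1 k2 : R) : weak_partial v u w ->
  rectL (fun z : T2 => w (of_char (z.1, z.2))) a B c D ->
  (forall z, 'D_v (char_tensor f g) z = k1 * char_tensor f' g z + k2 * char_tensor f g' z) ->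
  k1 * I char_u f' g + k2 * I char_u f g' = - \int[leb2]_(z in rect a B c D) (w (of_char (z.1, z.2)) * (f z.1 * g z.2)).
Proof.
move=> wp Lw DE; have Lu := rectL_u B D ac.
have L1u := rectL_tensor Lu bf' bg; have L2u := rectL_tensor Lu bf bg'.
have Lwt := rectL_tensor Lw bf bg.
have LK := integrableD mr (integrableZl mr k1 L1u) (integrableZl mr k2 L2u).
have E1 : \int[leb2]_(z in @upper R) (u z * 'D_v (char_tensor f g) z) =
    \int[leb2]_(z in rect a B c D) (k1 * (char_u z.1 z.2 * (f' z.1 * g z.2)) +
      k2 * (char_u z.1 z.2 * (f z.1 * g' z.2))).
  apply: (upper_to_rect ac LK) => x y.
    by move=> _ _; rewrite DE !char_tensorE /char_u /=; ring.
  by move=> _ /supp[_ h1 h2 _]; rewrite DE !char_tensorE h1 h2 !mulr0 addr0 mulr0.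
have E2 : \int[leb2]_(z in @upper R) (w z * char_tensor f g z) =
    \int[leb2]_(z in rect a B c D) (w (of_char (z.1, z.2)) * (f z.1 * g z.2)).
  apply: (upper_to_rect ac Lwt) => x y.
    by move=> _ _; rewrite char_tensorE.
  by move=> _ /supp[h1 _ _ _]; rewrite char_tensorE h1 mulr0.
have := wp _ plateau_test_upper; rewrite E1 E2 => <-.
rewrite (RintegralD mr (integrableZl mr k1 L1u) (integrableZl mr k2 L2u)).
by rewrite (Rintegral2Zl k1 mr L1u) (Rintegral2Zl k2 mr L2u).
Qed.

Lemma weak_char : I char_u f' g = - I char_v f g /\ I char_u f g' = - I char_p f g.
Proof.
have [_ _ _ [wx wt] _] := hclass.
have := weak_id (k1 := s2^-1) (k2 := - s2^-1) wx (rectL_ux B D ac).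
move=> /(_ _)/wrap[]; first by move=> z; rewrite (char_tensor_dx df dg); ring.
have := weak_id (k1 := s2^-1) (k2 := s2^-1) wt (rectL_ut B D ac).
move=> /(_ _)/wrap[]; first by move=> z; rewrite (char_tensor_dt df dg); ring.
have Lx := rectL_tensor (rectL_ux B D ac) bf bg; have Lt := rectL_tensor (rectL_ut B D ac) bf bg.
set IX := \int[leb2]_(z in _) (ux _ * _); set IT := \int[leb2]_(z in _) (ut _ * _).
have -> : I char_v f g = s2^-1 * (IT + IX).
  rewrite /IT /IX -(RintegralD mr Lt Lx) -(Rintegral2Zl s2^-1 mr (integrableD mr Lt Lx)).
  by apply: eq_Rintegral => z _; rewrite /char_v /d_xi; ring.
have -> : I char_p f g = s2^-1 * (IT - IX).
  rewrite /IT /IX -(RintegralB mr Lt Lx) -(Rintegral2Zl s2^-1 mr (integrableB mr Lt Lx)).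
  by apply: eq_Rintegral => z _; rewrite /char_p /d_eta; ring.
have h : 2 * (s2^-1 * s2^-1) = 1 :> R by rewrite -invfM sqr_sqrt2 divff.
have arith (A B' X T t : R) : 2 * (t * t) = 1 -> t * A + t * B' = - T -> t * A + - t * B' = - X ->
    A = - (t * (T + X)) /\ B' = - (t * (T - X)).
  move=> tt HT HX; have -> : T = - (t * A + t * B') by rewrite HT opprK.
  have -> : X = - (t * A + - t * B') by rewrite HX opprK.
  split.
    by transitivity (2 * (t * t) * A); [rewrite tt mul1r|ring].
  by transitivity (2 * (t * t) * B'); [rewrite tt mul1r|ring].
exact: arith h.
Qed.

Lemma dalembertian_char :
  \int[leb2]_(z in @upper R) (u z * dalembertian (char_tensor f g) z) = 2 * I char_u f' g'.
Proof.
have Lu := rectL_tensor (rectL_u B D ac) bf' bg'.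
rewrite -(Rintegral2Zl 2 mr Lu); apply: (upper_to_rect ac (integrableZl mr 2 Lu)) => x y.
  move=> _ _; rewrite (dalembertian_char_tensor _ (smooth1_plateau e a b) (smooth1_plateau e' c d) df dg).
  by rewrite char_tensorE /char_u/=; ring.
move=> _ /supp[_ _ _ h].
rewrite (dalembertian_char_tensor _ (smooth1_plateau e a b) (smooth1_plateau e' c d) df dg).
by rewrite char_tensorE h !mulr0.
Qed.

Lemma energy_char : energy_conservation ux ut ->
  \int[leb2]_(z in rect a B c D) (char_v z.1 z.2 ^+ 2 * (f z.1 * g' z.2)) +
  \int[leb2]_(z in rect a B c D) (char_p z.1 z.2 ^+ 2 * (f' z.1 * g z.2)) = 0.
Proof.
move=> /(_ _ plateau_test_upper).
have Lv := rectL_tensor (rectL_v2 B D ac) bf bg'; have Lp := rectL_tensor (rectL_p2 B D ac) bf' bg.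
(* In characteristic terms - 2 u_x u_t = P^2 - V^2 and u_x^2 + u_t^2 = V^2 + P^2, so the terms V^2
   f' g and P^2 f g' cancel and the other two double, over the sqrt 2 of the derivatives. *)
pose k := 2 / s2; have k0 : k != 0 by rewrite mulf_neq0// invr_neq0// sqrt2_neq0.
have LK := integrableZl mr k (integrableD mr Lv Lp).
have E : \int[leb2]_(z in @upper R) ((- 2 * ux z * ut z) * 'D_(dir_x R) (char_tensor f g) z +
      (ux z ^+ 2 + ut z ^+ 2) * 'D_(dir_t R) (char_tensor f g) z) =
    \int[leb2]_(z in rect a B c D) (k * (char_v z.1 z.2 ^+ 2 * (f z.1 * g' z.2) +
      char_p z.1 z.2 ^+ 2 * (f' z.1 * g z.2))).
  apply: (upper_to_rect ac LK) => x y.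
    move=> _ _; rewrite (char_tensor_dx df dg) (char_tensor_dt df dg) !char_tensorE /=.
    rewrite /char_v /char_p /d_xi /d_eta !s2_sqr_div /k.
    by field; exact: sqrt2_neq0.
  move=> _ /supp[_ h1 h2 _]; rewrite (char_tensor_dx df dg) (char_tensor_dt df dg) !char_tensorE /=.
  by rewrite h1 h2 subr0 addr0 !mul0r !mulr0 addr0.
rewrite E (Rintegral2Zl k mr (integrableD mr Lv Lp)) (RintegralD mr Lv Lp).
by move=> /eqP; rewrite mulf_eq0 (negPf k0)/= => /eqP.
Qed.

End identities.

Hypothesis hobst : zero_obstacle u.
Hypothesis henergy : energy_conservation ux ut.

(** Twice the bound of [corner_limit], because box (f g) = 2 f' g' in characteristic variables. *)
Lemma dalembertian_corner a b c d k : a < b -> c < d -> 0 < a + c -> 0 < k ->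
  exists e, [/\ 0 < e, e <= b - a, e <= d - c &
    `|\int[leb2]_(z in @upper R) (u z *
       dalembertian (char_tensor (plateau e a (b - e)) (plateau e c (d - e))) z) -
     2 * rect_inc char_u a b c d| <= 8 * k].
Proof.
move=> ab cd ac k0.
have [e e0 [aeb ced H]] := corner_limit char_u_cont rectL_u ab cd ac k0.
exists e; rewrite !lerBrDl; split => //.
rewrite (dalembertian_char (B := b) (D := d)) ?subrK// ?lerBrDr//.
rewrite -mulrBr normrM gtr0_norm// (_ : 8 * k = 2 * (4 * k)); last by ring.
by rewrite ler_pM2l.
Qed.

Lemma rect_inc_deg a b c d : a <= b -> c <= d -> (a < b /\ c < d) \/ rect_inc char_u a b c d = 0.
Proof.
rewrite le_eqVlt => /predU1P[->|ab]; first by right; rewrite /rect_inc; ring.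
by rewrite le_eqVlt => /predU1P[->|cd]; [right; rewrite /rect_inc; ring|left].
Qed.

Lemma char_u_inc a b c d : a <= b -> c <= d -> 0 < a + c -> 0 <= rect_inc char_u a b c d.
Proof.
move=> ab' cd' ac; have [[ab cd]|-> //] := rect_inc_deg ab' cd'.
apply/ler_addgt0Pr => k k0; have k4 : 0 < k / 4 by rewrite divr_gt0.
have [e [e0 eb ed H]] := dalembertian_corner ab cd ac k4.
have ae : a <= b - e by rewrite lerBrDr -lerBrDl.
have ce : c <= d - e by rewrite lerBrDr -lerBrDl.
have [_ pos _] := hobst.
have := pos (char_tensor (plateau e a (b - e)) (plateau e c (d - e))).
move=> /(_ _)/wrap[]; first by apply: (plateau_test_upper (B := b) (D := d)); rewrite ?subrK.
move=> /(_ _)/wrap[].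
  move=> z; rewrite /char_tensor mulr_ge0//.
    by have /andP[] := plateau_itv (lform (xi_form R) z) e0 ae.
  by have /andP[] := plateau_itv (lform (eta_form R) z) e0 ce.
exact: ge0_near H.
Qed.

Lemma char_u_free a b c d : a <= b -> c <= d -> 0 < a + c ->
  (forall x y, a <= x <= b -> c <= y <= d -> 0 < char_u x y) -> rect_inc char_u a b c d = 0.
Proof.
move=> ab' cd' ac Hpos; have [[ab cd]|-> //] := rect_inc_deg ab' cd'.
apply: (@eq0_small _ 4) => // k k0.
have [e [e0 eb ed]] := dalembertian_corner ab cd ac k0.
have ae : a <= b - e by rewrite lerBrDr -lerBrDl.
have ce : c <= d - e by rewrite lerBrDr -lerBrDl.
have [_ _ zero] := hobst; rewrite zero.
  by rewrite sub0r normrN normrM gtr0_norm// (_ : 8 * k = 2 * (4 * k)) ?ler_pM2l//; ring.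
apply: (plateau_test (B := b) (D := d)); rewrite ?subrK// => x y xab ycd; split.
  apply/of_char_upper; move: xab ycd => /andP[ax _] /andP[cy _].
  by apply: (lt_le_trans ac); exact: lerD.
exact: Hpos.
Qed.

Lemma good_char_v : {ae mu, forall y, good char_u char_v y}.
Proof.
apply: weak_good; [exact: char_u_cont|exact: rectL_u|exact: rectL_v|exact: rectL_v2|].
move=> a b c d n m ab cd ac.
apply: (weak_char (inv_nat_gt0 R n) (inv_nat_gt0 R m) (ltW ab) (ltW cd) _ _ ac).1.
  by rewrite lerD2l inv_nat_le1.
by rewrite lerD2l inv_nat_le1.
Qed.

Lemma rectL_sw (W : R -> R -> R) : (forall a b c d, 0 < a + c -> rectL (fun z : T2 => W z.1 z.2) a b c d) ->
  forall a b c d, 0 < a + c -> rectL (fun z : T2 => W z.2 z.1) a b c d.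
Proof.
by move=> L a b c d ac; have [] := rectL_swap (L c d a b _); rewrite // addrC.
Qed.

Lemma good_char_p : {ae mu, forall x, good (swap char_u) (swap char_p) x}.
Proof.
apply: weak_good.
- move=> x y xy e e0; rewrite addrC in xy; have [d d0 H] := char_u_cont xy e0.
  by exists d => // x' y' xy' xd yd; apply: H => //; rewrite addrC.
- exact: rectL_sw rectL_u.
- exact: rectL_sw rectL_p.
- exact: (@rectL_sw (fun x y => char_p x y ^+ 2) rectL_p2).
move=> a b c d n m ab cd ac; rewrite /swap.
have ca : 0 < c + a by rewrite addrC.
have n0 := inv_nat_gt0 R n; have m0 := inv_nat_gt0 R m.
have bb : b + n.+1%:R^-1 <= b + 1 by rewrite lerD2l inv_nat_le1.
have dd : d + m.+1%:R^-1 <= d + 1 by rewrite lerD2l inv_nat_le1.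
have Lu := rectL_tensor (rectL_u (d + 1) (b + 1) ca) (bounded_plateau m0 (ltW cd)) (bounded_plateau' a b n0).
have Lp := rectL_tensor (rectL_p (d + 1) (b + 1) ca) (bounded_plateau m0 (ltW cd)) (bounded_plateau n0 (ltW ab)).
have := (weak_char m0 n0 (ltW cd) (ltW ab) dd bb ca).2.
rewrite (rectL_swap Lu).2 (rectL_swap Lp).2 => H.
have com (W : R -> R -> R) (h h' : R -> R) :
    \int[leb2]_(z in rect a (b + 1) c (d + 1)) (W z.2 z.1 * (h z.1 * h' z.2)) =
    \int[leb2]_(z in rect a (b + 1) c (d + 1)) (W z.2 z.1 * (h' z.2 * h z.1)).
  by apply: eq_Rintegral => z _; congr (_ * _); rewrite mulrC.
by rewrite !com.
Qed.

Lemma char_solution_of_wave : char_solution char_u char_v char_p.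
Proof.
have [u0 _ _] := hobst.
constructor.
- exact: char_u_cont.
- by move=> x y xy; apply: u0; exact/of_char_cupper.
- exact: char_u_inc.
- exact: char_u_free.
- exact: good_char_v.
- exact: good_char_p.
- move=> e a b c d e0 ab cd ac.
  exact: (rect_tensor (rectL_v2 (b + e) (d + e) ac) (bounded_plateau e0 ab) (bounded_cst1 R)).1.
- move=> e a b c d e0 ab cd ac; rewrite addrC in ac.
  have L := @rectL_sw (fun x y => char_p x y ^+ 2) rectL_p2 c (d + e) a (b + e) ac.
  exact: (rect_tensor L (bounded_plateau e0 cd) (bounded_cst1 R)).1.
- move=> e a b c d e0 aeb ced ac.
  have ab : a <= b by apply: le_trans aeb; rewrite lerDl ltW.
  have cd : c <= d by apply: le_trans ced; rewrite lerDl ltW.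
  have := energy_char e0 e0 ab cd (lexx _) (lexx _) ac henergy.
  have Lp := rectL_tensor (rectL_p2 (b + e) (d + e) ac) (bounded_plateau' a b e0) (bounded_plateau e0 cd).
  have ca : 0 < c + a by rewrite addrC.
  have L := @rectL_sw (fun x y => char_p x y ^+ 2) rectL_p2 c (d + e) a (b + e) ca.
  rewrite (rectL_swap Lp).2.
  rewrite (rect_tensor (rectL_v2 (b + e) (d + e) ac) (bounded_plateau e0 ab) (bounded_plateau' c d e0)).2.
  have -> : \int[leb2]_(z in rect c (d + e) a (b + e)) (char_p (z.2, z.1).1 (z.2, z.1).2 ^+ 2 *
      (plateau' e a b (z.2, z.1).1 * plateau e c d (z.2, z.1).2)) =
    \int[leb2]_(z in rect c (d + e) a (b + e)) (char_p z.2 z.1 ^+ 2 *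
      (plateau e c d z.1 * plateau' e a b z.2)).
    by apply: eq_Rintegral => z _; congr (_ * _); rewrite mulrC.
  by rewrite (rect_tensor L (bounded_plateau e0 cd) (bounded_plateau' a b e0)).2.
Qed.

End characteristic_solution.

(** * Identification of the initial values *)

Section initial_values.
Variable R : realType.
Local Notation mu := (@lebesgue_measure R).
Local Notation TR := (measurableTypeR R).
Local Notation T2 := (TR * TR)%type.
Implicit Types (a b c d e h k l m p s v x y : R).
Local Notation s2 := (Num.sqrt 2 : R).

Lemma double_div_sqrt2 x : (x + x) / s2 = s2 * x.
Proof.
have h := sqrt2_neq0 R; apply: (mulIf h); rewrite mulfVK//.
by rewrite mulrAC sqr_sqrt2 mulr_natl mulr2n.
Qed.

Lemma half_sum_diff v p m l : v + p = s2 * m -> v - p = s2 * l ->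
  v = (m + l) / s2 /\ p = (m - l) / s2.
Proof.
move=> E1 E2; have h := sqrt2_neq0 R; have h2 : s2 * s2 = 2 := sqr_sqrt2 R.
have hi x y : 2 * x = s2 * y -> x = y / s2.
  move=> E; apply: (mulIf h); rewrite mulfVK//; apply: (mulfI h).
  by rewrite -E mulrCA h2 mulrC.
by split; apply: hi; rewrite ?mulrDr ?mulrN -E1 -E2; ring.
Qed.

Lemma of_char_diag s h : of_char (s + h, - s + h) = (s2 * s, s2 * h).
Proof. by rewrite /of_char/= -!double_div_sqrt2; congr (_ / _, _ / _); ring. Qed.

Lemma of_char_initial s : of_char (s, - s) = (s2 * s, 0).
Proof. by rewrite /of_char/= -!double_div_sqrt2 subrr mul0r; congr (_ / _, _); ring. Qed.

(** Both relations follow characteristic steps of length h from (s, - s). Going to (s + h, - s + h)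
    through (s, - s + h) is a motion in time by sqrt 2 h, with increment (v + p) h. Going to (s + h,
    - s - h) through (s + h, - s) is a motion along the initial line, with increment (v - p) h. The
    three clauses of [trace] are those that these two paths use. *)
Lemma initial_trace (u : R * R -> R) (u0 : R -> R) s v p l m :
  (forall x, u (x, 0) = u0 x) ->
  trace (char_u u) s v -> trace (swap (char_u u)) (- s) p ->
  dlim u0 (s2 * s) l ->
  t^-1 * (u (s2 * s, t) - u (s2 * s, 0)) @[t --> 0^'+] --> m ->
  v + p = s2 * m /\ v - p = s2 * l.
Proof.
move=> uE Tv Tp Dl Cm; have s0 := sqrt2_gt0 R.
have C0 : 0 <= 2 + s2 by rewrite addr_ge0// ltW.
split; apply/eqP; rewrite -subr_eq0; apply/eqP; apply: (eq0_small C0) => e e0.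
- have [d1 d10 H1] := Tv e e0; have [d2 d20 H2] := Tp e e0.
  have [d3 d30 H3] : exists2 d, 0 < d & forall t, 0 < t < d -> `|t^-1 * (u (s2 * s, t) - u (s2 * s, 0)) - m| <= e.
    move/cvgrPdist_le : Cm => /(_ e e0)[d /= d0 H]; exists d => // t /andP[t0 td].
    by rewrite distrC; apply: H => //; rewrite /= sub0r normrN gtr0_norm.
  have d4 : 0 < d3 / s2 / 2 by rewrite !divr_gt0.
  have [g [g0 g1 g2]] := ex_min2 d10 d20; have [h [h0 hg h4]] := ex_min2 g0 d4.
  have [A1 _ _] := H1 h (introT andP (conj h0 (le_trans hg g1))).
  have [_ A2 _] := H2 h (introT andP (conj h0 (le_trans hg g2))).
  rewrite /swap opprK in A2.
  have t0 : 0 < s2 * h by rewrite mulr_gt0.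
  have td : s2 * h < d3.
    rewrite mulrC -ltr_pdivlMr//; apply: (le_lt_trans h4).
    by rewrite ltr_pdivrMr// ltr_pMr ?ltr1n// divr_gt0.
  have A3 := H3 _ (introT andP (conj t0 td)).
  have {}A3 : `|u (s2 * s, s2 * h) - u (s2 * s, 0) - m * (s2 * h)| <= e * (s2 * h).
    rewrite -[X in _ <= _ * X]gtr0_norm// -ler_pdivrMr ?normr_gt0 ?gt_eqF// -normfV -normrM.
    by rewrite mulrC mulrBr [_ * (m * _)]mulrCA mulVf ?mulr1// gt_eqF.
  move: A1 A2 A3; rewrite -of_char_diag -of_char_initial /char_u.
  move: (u (of_char (s + h, - s + h))) (u (of_char (s, - s + h))) (u (of_char (s, - s))) => X Y Z A1 A2 A3.
  rewrite -(ler_pM2r h0) -[X in `|_| * X](gtr0_norm h0) -normrM.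
  have -> : (v + p - s2 * m) * h = (X - Z - m * (s2 * h)) - (X - Y - v * h) - (Y - Z - p * h) by ring.
  apply: (le_trans (ler_normB _ _)); rewrite (_ : (2 + s2) * e * h = (e * (s2 * h) + e * h) + e * h); last by ring.
  by apply: lerD => //; apply: (le_trans (ler_normB _ _)); exact: lerD.
- have [d1 d10 H1] := Tv e e0; have [d2 d20 H2] := Tp e e0; have [d3 d30 H3] := Dl e e0.
  have d4 : 0 < d3 / s2 by rewrite divr_gt0.
  have [g [g0 g1 g2]] := ex_min2 d10 d20; have [h [h0 hg h4]] := ex_min2 g0 d4.
  have [_ A1 _] := H1 h (introT andP (conj h0 (le_trans hg g1))).
  have [_ _ A2] := H2 h (introT andP (conj h0 (le_trans hg g2))).
  rewrite /swap opprK -opprD in A2.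
  have t0 : 0 < s2 * h by rewrite mulr_gt0.
  have A3 := H3 (s2 * (s + h)); rewrite -mulrBr (_ : s + h - s = h) in A3; last by ring.
  rewrite gtr0_norm// -!uE -!of_char_initial in A3.
  have {}A3 := A3 (_ : s2 * h <= d3).
  move: A1 A2 A3; rewrite /char_u => A1 A2 /(_ _)/wrap[]; first by rewrite mulrC -ler_pdivlMr.
  move: A1 A2; move: (u (of_char (s + h, - (s + h)))) (u (of_char (s + h, - s))) (u (of_char (s, - s))) => X Y Z A1 A2 A3.
  rewrite -(ler_pM2r h0) -[X in `|_| * X](gtr0_norm h0) -normrM.
  have -> : (v - p - s2 * l) * h = (X - Z - l * (s2 * h)) - (Y - Z - v * h) + (Y - X - p * h) by ring.
  apply: (le_trans (ler_normD _ _)); rewrite (_ : (2 + s2) * e * h = (e * (s2 * h) + e * h) + e * h); last by ring.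
  by apply: lerD => //; apply: (le_trans (ler_normB _ _)); exact: lerD.
Qed.

Lemma continuous_initial (u : R * R -> R) (u0 : R -> R) : {within @cupper R, continuous u} ->
  (forall x, u (x, 0) = u0 x) -> continuous u0.
Proof. by move=> cu uE; rewrite (_ : u0 = fun x => u (x, 0)); [exact: continuous_line|exact/funext]. Qed.

Lemma W12loc_dlim (u du : R -> R) : W12loc u du -> continuous u -> {ae mu, forall x, dlim u x (du x)}.
Proof.
move=> W cu.
suff H (n : nat) : {ae mu, forall x, - n%:R < x -> dlim u x (du x)}.
  apply: aeS (ae_allC H) => x Hx; apply: (Hx (Num.bound (- x))); rewrite ltrNl.
  have [x0|x0] := leP 0 (- x); first exact: archi_boundP.
  by apply: (lt_le_trans x0); exact: ler0n.
apply: ae_exhaust => a b na ab; have [_ Ldu _] := W; have Lab := L2loc_L1 a b Ldu.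
apply: aeS (itg_dlim Lab) => x Hx xab; have /andP[ax xb] := xab.
have x0 : 0 < x - a by rewrite subr_gt0.
apply: (dlim_local (c := u a) x0 _ (Hx xab)) => y; rewrite ler_norml => /andP[+ _].
have -> : - (x - a) = a - x by ring.
rewrite lerD2r le_eqVlt => /predU1P[<-|ay]; first by rewrite itgxx add0r.
by rewrite -(W12loc_increment W cu ay) subrK.
Qed.

Lemma initial_velocities (u0 du0 u1 : R -> R) (u : R * R -> R) (V0 P0 : R -> R) :
  W12loc u0 du0 -> {within @cupper R, continuous u} -> initial_data u0 u1 u ->
  {ae mu, forall s, trace (char_u u) s (V0 s)} ->
  {ae mu, forall s, trace (swap (char_u u)) s (P0 s)} ->
  {ae mu, forall s, V0 s = d_xi0 du0 u1 (s2 * s)} /\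
  {ae mu, forall s, P0 s = d_eta0 du0 u1 (- (s2 * s))}.
Proof.
move=> W cu [uE ut1] TV TP; have s0 := sqrt2_gt0 R.
have D := W12loc_dlim W (continuous_initial cu uE).
have E : {ae mu, forall s, V0 s = d_xi0 du0 u1 (s2 * s) /\ P0 (- s) = d_eta0 du0 u1 (s2 * s)}.
  have := aeI TV (aeI (ae_opp TP) (aeI (ae_affine 0 s0 D) (ae_affine 0 s0 ut1))).
  apply: aeS => s [T1 [T2' [+ +]]]; rewrite addr0 => D1 C1.
  have [E1 E2] := initial_trace uE T1 T2' D1 C1.
  exact: half_sum_diff E1 E2.
split; first by apply: aeS E => s [].
by apply: aeS (ae_opp E) => s [_]; rewrite opprK mulrN.
Qed.

Definition char_half : set T2 := [set c : T2 | 0 < c.1 + c.2].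

Lemma measurable_char_half : measurable char_half.
Proof.
rewrite (_ : char_half = @of_char R @^-1` @upper R); last first.
  by apply/seteqP; split => -[x y] /of_char_upper.
by rewrite -[X in measurable X]setTI; apply: measurable_of_char => //; exact: measurable_upper.
Qed.

Lemma ae_boundary : {ae leb2, forall c : R * R, ~ (c.1 + c.2 = 0)}.
Proof.
apply: (@ae_plane _ [set c : T2 | c.1 + c.2 = 0]).
  rewrite (_ : [set c : T2 | c.1 + c.2 = 0] = (fun c : T2 => c.1 + c.2) @^-1` [set 0])//.
  rewrite -[X in measurable X]setTI; apply: measurable_funD => //; exact: measurable_fst || exact: measurable_snd.
apply: aeW => y; apply: aeS (ae_neq (- y)) => x /eqP xy /= /eqP; rewrite addr_eq0 => /eqP.
exact: xy.
Qed.

(** Fubini in either order: V is controlled on almost every line with eta fixed, P with xi fixed.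
    The initial line, where nothing is known, is null by [ae_boundary]. *)
Lemma ae_half_plane (Q : T2 -> Prop) : measurable (char_half `&` [set c : T2 | ~ Q c]) ->
  {ae mu, forall y, {ae mu, forall x, 0 < x + y -> Q (x, y)}} \/
  {ae mu, forall x, {ae mu, forall y, 0 < x + y -> Q (x, y)}} ->
  {ae leb2, forall c : R * R, 0 <= c.1 + c.2 -> Q c}.
Proof.
move=> mA H.
have H' : {ae leb2, forall c : T2, ~ (char_half `&` [set c : T2 | ~ Q c]) c}.
  case: H => H; [apply: ae_plane|apply: ae_plane_swap] => //; apply: aeS H => y;
    by apply: aeS => x Qx [xy]; apply; exact: Qx.
apply: aeS (aeI ae_boundary H') => c [c0 Hc].
rewrite le_eqVlt => /predU1P[/esym//|cp]; apply: contrapT => nQ.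
by apply: Hc; split.
Qed.

Lemma measurable_neq (K L : T2 -> R) : measurable_fun char_half K -> measurable_fun char_half L ->
  measurable (char_half `&` [set c : T2 | ~ (K c = L c)]).
Proof.
move=> mK mL; rewrite (_ : [set c : T2 | _] = (fun c : T2 => K c - L c) @^-1` (~` [set 0])).
  by apply: measurable_funB => //; [exact: measurable_char_half|apply: measurableC].
apply/seteqP; split => c /= H.
  by move/eqP; rewrite subr_eq0 => /eqP.
by move=> E; apply: H; rewrite E subrr.
Qed.

Lemma measurable_norm_char (h : R * R -> R) : measurable_fun (@upper R : set T2) h ->
  measurable_fun char_half (fun c : T2 => `|h (of_char c)|).
Proof.
move=> mh; suff : measurable_fun char_half (fun c : T2 => h (of_char c)) by exact: measurableT_comp.
apply: (measurable_comp (@measurable_upper R) _ mh).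
  by move=> _ [[x y] /of_char_upper xy <-].
by apply: measurable_funTS; exact: measurable_of_char.
Qed.

End initial_values.

Theorem proposition3p1 (R : realType) (u0 du0 u1 : R -> R)
    (u ux ut : R * R -> R)
    (hu0 : W12loc u0 du0) (hu1 : L2loc u1)
    (hu0_ge0 : forall x, 0 <= u0 x)
    (hu1_ge0 : {ae leb, forall x : R, u0 x = 0 -> 0 <= u1 x})
    (hclass : energy_class u ux ut)
    (hobst : zero_obstacle u)
    (hinit : initial_data u0 u1 u)
    (henergy : energy_conservation ux ut) :
  [/\ indep_eta (fun c => `|d_xi ux ut (of_char c)|),
      indep_xi (fun c => `|d_eta ux ut (of_char c)|),
      {ae leb2, forall z : R * R, 0 <= z.2 ->
        `|d_xi ux ut z| = `|d_xi0 du0 u1 (z.1 + z.2)|} &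
      {ae leb2, forall z : R * R, 0 <= z.2 ->
        `|d_eta ux ut z| = `|d_eta0 du0 u1 (z.1 - z.2)|}].
Proof.
have S := char_solution_of_wave hclass hobst henergy.
have [V0 [TV HV]] := trace_good S; have [P0 [TP HP]] := trace_good (char_solution_swap S).
have cu : {within @cupper R, continuous u} by case: hclass.
have [EV EP] := initial_velocities hu0 cu hinit TV TP.
have [[_ [mdu _] _] [mu1 _]] := (hu0, hu1).
(* On the initial line, the point with xi = x has abscissa sqrt 2 x, and the point with eta = y has
   abscissa - sqrt 2 y. *)
pose f x := `|d_xi0 du0 u1 (Num.sqrt 2 * x)|.
pose g y := `|d_eta0 du0 u1 (- (Num.sqrt 2 * y))|.
have mf : measurable_fun [set: R] f.
  apply: measurableT_comp => //; apply: (@measurableT_comp _ _ _ _ _ _ (d_xi0 du0 u1)).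
    by apply: measurable_funM => //; exact: measurable_funD.
  exact: measurable_funM.
have mg : measurable_fun [set: R] g.
  apply: measurableT_comp => //; apply: (@measurableT_comp _ _ _ _ _ _ (d_eta0 du0 u1)).
    by apply: measurable_funM => //; exact: measurable_funB.
  by apply: measurableT_comp => //; exact: measurable_funM.
have Hxi : {ae leb2, forall c : R * R, 0 <= c.1 + c.2 -> `|d_xi ux ut (of_char c)| = f c.1}.
  apply: ae_half_plane.
    apply: measurable_neq; first by apply: measurable_norm_char; exact: measurable_d_xi hclass.
    by apply: measurable_funTS; apply: measurableT_comp mf _; exact: measurable_fst.
  left; apply: aeS (char_goodV S) => y /HV H.
  apply: aeS (aeI H EV) => x [Hx Vx] xy; rewrite /f/= -Vx; apply: Hx.
  by rewrite -subr_gt0 opprK.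
have Heta : {ae leb2, forall c : R * R, 0 <= c.1 + c.2 -> `|d_eta ux ut (of_char c)| = g c.2}.
  apply: ae_half_plane.
    apply: measurable_neq; first by apply: measurable_norm_char; exact: measurable_d_eta hclass.
    by apply: measurable_funTS; apply: measurableT_comp mg _; exact: measurable_snd.
  right; apply: aeS (char_goodP S) => x /HP H.
  apply: aeS (aeI H EP) => y [Hy Py] xy; rewrite /g/= -Py; apply: Hy.
  by rewrite -subr_gt0 opprK addrC.
have pos (c : R * R) : 0 <= (of_char c).2 -> 0 <= c.1 + c.2.
  by case: c => x y; exact: (of_char_cupper x y).1.
split.
- by exists f.
- by exists g.
- apply: ae_to_char; apply: aeS Hxi => c Hc /pos /Hc ->.
  rewrite /f; congr (`|_ _ _ _|); rewrite -double_div_sqrt2 /of_char/=.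
  by rewrite -mulrDl; congr (_ / _); ring.
- apply: ae_to_char; apply: aeS Heta => c Hc /pos /Hc ->.
  rewrite /g; congr (`|_ _ _ _|); rewrite -double_div_sqrt2 /of_char/=.
  by rewrite -mulrBl -mulNr; congr (_ / _); ring.
Qed.
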